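(* Assume the SHGH conjecture holds. Fix an integer $g\ge 2$. Then there are only finitely many sets of numerical characters $(n;a;b_1,\dots,b_n)$ with $n\ge 0$ and $b_1\ge\cdots\ge b_n\ge 1$ such that $\mathcal L=|a;b_1,\dots,b_n|$ is an effective Cremona minimal linear system on $X_n$ with $g(\mathcal L)=g$.
   Context: Work over $\mathbb C$. $X_n$ is the blow-up of $\mathbb P^2$ at $n$ general points (as usual for statements about all linear systems at once, ''general'' means outside a suitable countable union of proper closed subsets of $(\mathbb P^2)^n$). $H$ is the pullback of a line, $E_1,\dots,E_n$ are the exceptional divisors. $|a;b_1,\dots,b_n|$ denotes the complete linear system $|aH-\sum b_iE_i|$; $a$ is the degree, the $b_i$ are the multiplicities, and these integers are the numerical characters. For $\mathcal L=|a;b_1,\dots,b_n|$: $\dim\mathcal L=h^0-1$, $\mathcal L$ is effective if $\dim \mathcal L\ge 0$, and the arithmetic genus is $g(\mathcal L)=\frac{(a-1)(a-2)}2-\sum\frac{b_i(b_i-1)}2$. Cremona minimal: with $b_1\ge b_2\ge\cdots$ and $b_i=0$ for $i>n$, one has $a\ge b_1+b_2+b_3$. A $(-1)$-curve is a smooth irreducible rational curve $E$ with $E^2=-1$. SHGH (Segre-Harbourne-Gimigliano-Hirschowitz) conjecture: for every $n$ and every effective divisor $D$ on $X_n$, $h^1(X_n,\mathcal O(D))\ne0$ if and only if there is a $(-1)$-curve $E$ on $X_n$ with $D\cdot E\le -2$. *)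

(* Defs.v *)
From HB Require Import structures.
From mathcomp Require Import all_boot all_order all_algebra.
From mathcomp Require Import mpoly complex.
From mathcomp Require Import boolp classical_sets cardinality reals.

Set Implicit Arguments.
Unset Strict Implicit.
Unset Printing Implicit Defensive.

Import Order.TTheory GRing.Theory Num.Theory.

Local Open Scope classical_set_scope.
Local Open Scope ring_scope.

(* Classical algebraic geometry in (P^2)^m over C = R[i].  A point of (P^2)^m
   is represented by an m x 3 matrix with nonzero rows, up to rescaling each row
   separately; subsets of (P^2)^m are handled as sets of representatives.  All
   the sets defined below through multihomogeneous polynomials are invariant
   under rescaling.  The coordinates are the m * 3 variables mxvec_index i j.   *)
Section MultiProjective.
Variables (R : realType) (m : nat).
Local Notation C := R[i].

Definition is_point (P : 'M[C]_(m, 3)) : Prop := forall i, row i P != 0.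

Definition same_point (P Q : 'M[C]_(m, 3)) : Prop :=
  forall i, exists2 c : C, c != 0 & row i P = c *: row i Q.

Definition mev (F : {mpoly C[m * 3]}) (P : 'M[C]_(m, 3)) : C :=
  F.@[mxvec P 0].

Definition multihomog (d : 'I_m -> nat) (F : {mpoly C[m * 3]}) : Prop :=
  forall mu : 'X_{1..m * 3}, mu \in msupp F ->
  forall i, (\sum_(j < 3) mu (mxvec_index i j))%N = d i.

Definition zclosed (Z : set 'M[C]_(m, 3)) : Prop :=
  exists A : set {mpoly C[m * 3]},
    (forall F, A F -> exists d, multihomog d F) /\
    Z = [set P | is_point P /\ forall F, A F -> mev F P = 0].

Definition zopen_in (X U : set 'M[C]_(m, 3)) : Prop :=
  exists2 Z, zclosed Z & U = X `\` Z.

Definition irreducible_closed (E : set 'M[C]_(m, 3)) : Prop :=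
  [/\ zclosed E, E !=set0 &
      forall Z1 Z2, zclosed Z1 -> zclosed Z2 -> E `<=` Z1 `|` Z2 ->
        E `<=` Z1 \/ E `<=` Z2].

(* Sections over U of the restriction of O(k_1, ..., k_m) to X: functions on
   representatives that are locally quotients of multihomogeneous polynomials
   of multidegree difference k. *)
Definition regular_section (X : set 'M[C]_(m, 3)) (k : 'I_m -> int)
    (U : set 'M[C]_(m, 3)) (s : 'M[C]_(m, 3) -> C) : Prop :=
  forall P, U P -> exists V G F dG dF,
    [/\ zopen_in X V, V P, V `<=` U,
        [/\ multihomog dG G, multihomog dF F &
            forall i, (dG i)%:Z - (dF i)%:Z = k i] &
        forall Q, V Q -> mev F Q != 0 /\ s Q = mev G Q / mev F Q].

(* Cech 1-cocycles and 1-coboundaries of the sheaf O(k)|_X for a finite family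
   of open sets U. *)
Definition cech_cocycle (X : set 'M[C]_(m, 3)) (k : 'I_m -> int) (r : nat)
    (U : 'I_r -> set 'M[C]_(m, 3)) (c : 'I_r -> 'I_r -> 'M[C]_(m, 3) -> C) :=
  (forall i j, regular_section X k (U i `&` U j) (c i j)) /\
  (forall i j l P, U i P -> U j P -> U l P -> c i j P + c j l P = c i l P).

Definition cech_coboundary (X : set 'M[C]_(m, 3)) (k : 'I_m -> int) (r : nat)
    (U : 'I_r -> set 'M[C]_(m, 3)) (c : 'I_r -> 'I_r -> 'M[C]_(m, 3) -> C) :=
  exists t : 'I_r -> 'M[C]_(m, 3) -> C,
    (forall i, regular_section X k (U i) (t i)) /\
    (forall i j P, U i P -> U j P -> c i j P = t j P - t i P).

(* H^1(X, O(k)|_X) is the direct limit, over the open covers of X, of the Cech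
   groups H^1 of the covers.  The maps from the H^1 of a cover to the limit are
   injective and finite covers are cofinal (X is quasi-compact), so H^1 is
   nonzero iff some finite open cover has a cocycle that is not a coboundary. *)
Definition H1_nonzero (X : set 'M[C]_(m, 3)) (k : 'I_m -> int) : Prop :=
  exists r (U : 'I_r -> set 'M[C]_(m, 3)) c,
    [/\ forall i, zopen_in X (U i), X `<=` \bigcup_i U i,
        cech_cocycle X k U c & ~ cech_coboundary X k U c].

(* Jacobian criterion on the multi-affine cone over E, which is locally E times
   an m-dimensional torus: the Zariski tangent space of the cone has dimension
   dim + m at every point. *)
Definition smooth_of_dim (dim : nat) (E : set 'M[C]_(m, 3)) : Prop :=
  forall P, E P -> exists2 A : 'M[C]_(dim + m, m * 3), row_free A &
    forall v : 'rV[C]_(m * 3),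
      (v <= A)%MS <->
      (forall F d, multihomog d F -> (forall Q, E Q -> mev F Q = 0) ->
         \sum_k v 0 k * mev (mderiv k F) P = 0).

(* E is birational to P^1, of affine coordinate t: the rational map
   t |-> Phi(t) from P^1 to E and the rational function G / F on E are inverse
   to each other where q(t) != 0, respectively where F != 0. *)
Definition rational_curve (E : set 'M[C]_(m, 3)) : Prop :=
  exists (Phi : 'M[{poly C}]_(m, 3)) (q : {poly C}) G F d,
    let phi t := map_mx (fun f : {poly C} => f.[t]) Phi in
    [/\ multihomog d G /\ multihomog d F, q != 0,
        forall t, q.[t] != 0 ->
          [/\ E (phi t), mev F (phi t) != 0 &
              mev G (phi t) / mev F (phi t) = t] &
        forall P, E P -> mev F P != 0 ->
          same_point P (phi (mev G P / mev F P))].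

(* Q holds outside a countable union of proper closed subsets of (P^2)^m. *)
Definition very_general (Q : 'M[C]_(m, 3) -> Prop) : Prop :=
  exists2 Z : nat -> set 'M[C]_(m, 3),
    forall k, zclosed (Z k) /\ (exists2 P, is_point P & ~ Z k P) &
    forall P, is_point P -> (forall k, ~ Z k P) -> Q P.

End MultiProjective.

(* (a, [b_1; ...; b_n]) stands for the class a H - b_1 E_1 - ... - b_n E_n. *)
Definition divclass (n : nat) : Type := (int * n.-tuple int)%type.

(* H^2 = 1, E_i^2 = -1, all other products are 0. *)
Definition dotdiv (n : nat) (D D' : divclass n) : int :=
  D.1 * D'.1 - \sum_(i < n) tnth D.2 i * tnth D'.2 i.

(* Both quotients are exact. *)
Definition arith_genus (n : nat) (D : divclass n) : int :=
  (((D.1 - 1) * (D.1 - 2)) %/ 2)%Z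
  - \sum_(i < n) ((tnth D.2 i * (tnth D.2 i - 1)) %/ 2)%Z.

(* For multiplicities listed in nonincreasing order. *)
Definition cremona_minimal (n : nat) (D : divclass n) : Prop :=
  nth 0 D.2 0 + nth 0 D.2 1 + nth 0 D.2 2 <= D.1.

Section BlowUp.
Variables (R : realType) (n : nat).
Local Notation C := R[i].
Implicit Types (p : 'M[C]_(n, 3)) (D : divclass n).

(* The blow-up of P^2 at the rows p_1, ..., p_n of p (for distinct points): the
   pairs of a point x (row 0) and, for each i, a line l_i through p_i and x,
   given by its equation (row i, i >= 1).  The fibre over p_i is the pencil of
   lines through p_i, and elsewhere x determines all the l_i. *)
Definition blowup p : set 'M[C]_(n.+1, 3) :=
  [set P | is_point P /\ forall i : 'I_n,
     \sum_(j < 3) P (lift ord0 i) j * p i j = 0 /\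
     \sum_(j < 3) P (lift ord0 i) j * P ord0 j = 0].

(* On the blow-up, O(1) of factor 0 is O(H) and O(1) of the factor of l_i is
   O(H - E_i), so a H - sum b_i E_i = (a - sum b_i) H + sum b_i (H - E_i)
   corresponds to this multidegree. *)
Definition divdeg D (k : 'I_n.+1) : int :=
  if unlift ord0 k is Some i then tnth D.2 i
  else D.1 - \sum_(i < n) tnth D.2 i.

(* h^0(O(D)) >= 1, i.e. dim |D| >= 0. *)
Definition effective p D : Prop :=
  exists2 s, regular_section (blowup p) (divdeg D) (blowup p) s &
    exists2 P, blowup p P & s P != 0.

(* E, as a reduced divisor, is a member of |D|: it is the zero locus of a
   global section s of O(D) that generates the ideal sheaf of E. *)
Definition member p D (E : set 'M[C]_(n.+1, 3)) : Prop :=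
  let X := blowup p in
  exists s,
    [/\ regular_section X (divdeg D) X s,
        E = [set P | X P /\ s P = 0] &
        forall U f, zopen_in X U -> regular_section X (fun=> 0) U f ->
          (forall P, U P -> E P -> f P = 0) ->
          forall P, U P -> exists V t,
            [/\ zopen_in X V, V P, V `<=` U,
                regular_section X (fun k => - divdeg D k) V t &
                forall Q, V Q -> f Q = t Q * s Q]].

(* E is a (-1)-curve of class D. *)
Definition minus_one_curve p D (E : set 'M[C]_(n.+1, 3)) : Prop :=
  [/\ irreducible_closed E /\ E `<` blowup p,
      member p D E,
      smooth_of_dim 1 E,
      rational_curve E &
      dotdiv D D = -1].

End BlowUp.

(* The linear system |D| on the blow-up of P^2 at n general points. *)
Definition effective_general (R : realType) (n : nat) (D : divclass n) : Prop :=
  very_general (fun p : 'M[R[i]]_(n, 3) => effective p D).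

(* Effective divisors are quantified through their classes: both sides of the
   equivalence depend only on the class. *)
Definition SHGH (R : realType) : Prop :=
  forall n : nat, very_general (fun p : 'M[R[i]]_(n, 3) =>
    forall D : divclass n, effective p D ->
      (H1_nonzero (blowup p) (divdeg D) <->
       exists E e, minus_one_curve p e E /\ dotdiv D e <= -2)).

(* Main.v *)
(* On the complement of the exceptional curves a section of aH - sum b_i E_i is, by
   Hartogs, a form of degree a, and it extends across E_i iff the form has multiplicity
   at least b_i at p_i.  Prescribed jets at the p_i give a Cech cocycle, so H^1 = 0 makes
   the jet conditions independent, and for an effective class with H^1 = 0 the expected
   dimension is nonnegative.  The form of a (-1)-curve is irreducible, hence Bezout gives
   E.E' >= -1 for any two of them; by SHGH, H^1(E) = 0, so the same count applied to E
   yields -K.E >= 1 together with 0 <= m_i <= d.  Therefore Cremona minimal classes meet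
   (-1)-curves nonnegatively and have nonnegative expected dimension, that is
   -K.D >= 1 - g.  Subtracting b_9 times the anticanonical class of nine of the points
   leaves a reduced class A on eight points with A^2 >= 0 and -K.A >= a / 3, which
   bounds first -K.A, then the multiplicities after the ninth, b_9 and a. *)

(* Forms are handled as functions on C^3 and studied on lines, where they become polynomials in one
   variable: density, multiplicity and divisibility all reduce to that case. Hartogs is then
   Euclidean division in a direction [o] whose general lines miss every p_i, and the same division
   shows that the form of a (-1)-curve divides each form vanishing on the curve. This divisibility
   is all that Bezout needs when it is proved by comparing dimensions in one large degree.

   Nine points matter because K^2 = 0 there. Writing m = b_9, the part of D at the first nine points
   is A + m(-K), with self-intersection A^2 + 2cm, where c = -K.A. As soon as c > 0 this grows with
   m, while the genus is fixed. The case c = 0 is where g >= 2 enters: the classes (3m; m^9) all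
   have genus 1 and form an infinite family. With at most eight points the adjoint class D + K is
   used instead, through D.(D + K) = 2g - 2; there A = D + K is itself reduced once three points are
   present.

   The bound E.E' >= -1 is obtained without SHGH, so applying SHGH to E is not circular. *)
Require Import Defs.
From HB Require Import structures.
From mathcomp Require Import all_boot all_order all_algebra.
From mathcomp Require Import mpoly complex.
From mathcomp Require Import boolp classical_sets cardinality reals.
From mathcomp Require Import zify ring lra.

Set Implicit Arguments.
Unset Strict Implicit.
Unset Printing Implicit Defensive.

Import Order.TTheory GRing.Theory Num.Theory.
Local Open Scope classical_set_scope.
Local Open Scope ring_scope.

(** * Polynomial functions and forms of integer degree *)

Section PolynomialFunctions.
Variable K : numClosedFieldType.

(** Polynomials are kept as functions because sections are functions on representatives; restriction
    to a line or a change of frame is then mere composition. Over an infinite field no information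
    is lost. *)
Inductive polyf n : ('rV[K]_n -> K) -> Prop :=
| polyf_const c : polyf (fun=> c)
| polyf_coord i : polyf (fun x => x 0 i)
| polyf_add f g : polyf f -> polyf g -> polyf (fun x => f x + g x)
| polyf_mul f g : polyf f -> polyf g -> polyf (fun x => f x * g x).

Lemma polyf_ext n (f g : 'rV[K]_n -> K) : polyf f -> f =1 g -> polyf g.
Proof. by move=> pf /funext <-. Qed.

Lemma polyf_scale n (c : K) (f : 'rV[K]_n -> K) :
  polyf f -> polyf (fun x => c * f x).
Proof. by move=> pf; apply: polyf_mul => //; apply: polyf_const. Qed.

Lemma polyf_opp n (f : 'rV[K]_n -> K) : polyf f -> polyf (fun x => - f x).
Proof. by move=> /(polyf_scale (-1)) /polyf_ext; apply=> x; rewrite mulN1r. Qed.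

Lemma polyf_sub n (f g : 'rV[K]_n -> K) :
  polyf f -> polyf g -> polyf (fun x => f x - g x).
Proof. by move=> pf pg; apply: polyf_add => //; apply: polyf_opp. Qed.

Lemma polyf_exp n (f : 'rV[K]_n -> K) k : polyf f -> polyf (fun x => f x ^+ k).
Proof.
move=> pf; elim: k => [|k IH]; first exact: polyf_const.
by apply: polyf_ext (polyf_mul pf IH) _ => x; rewrite exprS.
Qed.

Lemma polyf_sum n I (r : seq I) (P : pred I) (F : I -> 'rV[K]_n -> K) :
  (forall i, polyf (F i)) -> polyf (fun x => \sum_(i <- r | P i) F i x).
Proof.
move=> pF; elim: r => [|i r IH].
  by apply: polyf_ext (polyf_const _ 0) _ => x; rewrite big_nil.
case Pi: (P i); last by apply: polyf_ext IH _ => x; rewrite big_cons Pi.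
by apply: polyf_ext (polyf_add (pF i) IH) _ => x; rewrite big_cons Pi.
Qed.

Lemma polyf_prod n I (r : seq I) (P : pred I) (F : I -> 'rV[K]_n -> K) :
  (forall i, polyf (F i)) -> polyf (fun x => \prod_(i <- r | P i) F i x).
Proof.
move=> pF; elim: r => [|i r IH].
  by apply: polyf_ext (polyf_const _ 1) _ => x; rewrite big_nil.
case Pi: (P i); last by apply: polyf_ext IH _ => x; rewrite big_cons Pi.
by apply: polyf_ext (polyf_mul (pF i) IH) _ => x; rewrite big_cons Pi.
Qed.

Lemma polyf_comp m n (f : 'rV[K]_n -> K) (h : 'rV[K]_m -> 'rV[K]_n) :
  polyf f -> (forall i, polyf (fun x => h x 0 i)) -> polyf (fun x => f (h x)).
Proof.
move=> pf ph; elim: pf => [c|i|f1 f2 _ p1 _ p2|f1 f2 _ p1 _ p2].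
- exact: polyf_const.
- exact: ph.
- exact: polyf_add.
- exact: polyf_mul.
Qed.

Lemma polyf_mulmx n m (f : 'rV[K]_n -> K) (A : 'M[K]_(m, n)) :
  polyf f -> polyf (fun x => f (x *m A)).
Proof.
move=> pf; apply: (polyf_comp pf) => i.
apply: polyf_ext (polyf_sum _ _ (F := fun j x => x 0 j * A j i) _) _.
  by move=> j; apply: polyf_mul; [exact: polyf_coord|exact: polyf_const].
by move=> x; rewrite mxE.
Qed.

Lemma polyf_meval n (F : {mpoly K[n]}) : polyf (fun v => F.@[v 0]).
Proof.
apply: polyf_ext (polyf_sum (msupp F) xpredT
  (F := fun m v => F@_m * \prod_i v 0 i ^+ m i) _) _.
  move=> m; apply: polyf_scale; apply: polyf_prod => i; apply: polyf_exp.
  exact: polyf_coord.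
by move=> v; rewrite mevalE.
Qed.

Lemma polyf_mpoly n (f : 'rV[K]_n -> K) :
  polyf f -> exists F : {mpoly K[n]}, forall x, f x = F.@[x 0].
Proof.
elim=> [c|i|f1 f2 _ [F1 h1] _ [F2 h2]|f1 f2 _ [F1 h1] _ [F2 h2]].
- by exists c%:MP => x; rewrite mevalC.
- by exists 'X_i => x; rewrite mevalXU.
- by exists (F1 + F2) => x; rewrite mevalD h1 h2.
- by exists (F1 * F2) => x; rewrite mevalM h1 h2.
Qed.

Definition polycurve n (c : K -> 'rV[K]_n) :=
  forall i, exists q : {poly K}, forall t, c t 0 i = q.[t].

Lemma polyf_curve n (f : 'rV[K]_n -> K) (c : K -> 'rV[K]_n) :
  polyf f -> polycurve c -> exists q : {poly K}, forall t, f (c t) = q.[t].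
Proof.
move=> pf hc; elim: pf => [a|i|f1 f2 _ [q1 h1] _ [q2 h2]|f1 f2 _ [q1 h1] _ [q2 h2]].
- by exists a%:P => t; rewrite hornerC.
- exact: hc.
- by exists (q1 + q2) => t; rewrite hornerD h1 h2.
- by exists (q1 * q2) => t; rewrite hornerM h1 h2.
Qed.

Lemma polycurve_line n (x v : 'rV[K]_n) : polycurve (fun t => x + t *: v).
Proof.
by move=> i; exists ((x 0 i)%:P + 'X * (v 0 i)%:P) => t; rewrite !mxE !hornerE.
Qed.

Lemma horner_inj0 (q : {poly K}) : (forall t, q.[t] = 0) -> q = 0.
Proof.
move=> h; apply/eqP/negPn/negP => q0.
pose s := [seq k%:R : K | k <- iota 0 (size q)].
have us : uniq s.
  rewrite map_inj_uniq ?iota_uniq // => i j /eqP.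
  by rewrite eqr_nat => /eqP.
have rs : all (root q) s by apply/allP => t _; rewrite /root h.
by have := max_poly_roots q0 rs us; rewrite size_map size_iota ltnn.
Qed.

Lemma horner_inj (p q : {poly K}) : (forall t, p.[t] = q.[t]) -> p = q.
Proof.
move=> h; apply/eqP; rewrite -subr_eq0; apply/eqP/horner_inj0 => t.
by rewrite hornerD hornerN h subrr.
Qed.

Lemma horner_inj_off (h p q : {poly K}) :
  h != 0 -> (forall t, h.[t] != 0 -> p.[t] = q.[t]) -> p = q.
Proof.
move=> h0 H; apply: (mulfI h0); apply: horner_inj => t.
rewrite !hornerM; have [->|ht] := eqVneq h.[t] 0; first by rewrite !mul0r.
by rewrite H.
Qed.

Lemma horner_inj_nz (p q : {poly K}) :
  (forall t, t != 0 -> p.[t] = q.[t]) -> p = q.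
Proof.
move=> H; apply: (@horner_inj_off 'X); first by rewrite polyX_eq0.
by move=> t; rewrite hornerX; apply: H.
Qed.

(** The line joining a point where [f] is nonzero to an arbitrary [y] reduces the claim to one
    variable, where a nonzero polynomial can be cancelled. *)
Lemma polyf_dense0 n (f g : 'rV[K]_n -> K) : polyf f -> polyf g ->
  (exists x, f x != 0) -> (forall x, f x != 0 -> g x = 0) -> forall x, g x = 0.
Proof.
move=> pf pg [a fa] H y.
have [qf hf] := polyf_curve pf (polycurve_line a (y - a)).
have [qg hg] := polyf_curve pg (polycurve_line a (y - a)).
have qf0 : qf != 0.
  by apply: contraNneq fa => q0; rewrite -[a]addr0 -(scale0r (y - a)) hf q0 horner0.
have /(horner_inj_off qf0) q0 : forall t, qf.[t] != 0 -> qg.[t] = (0 : {poly K}).[t].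
  by move=> t; rewrite -hf -hg horner0; apply: H.
have -> : y = a + 1 *: (y - a) by rewrite scale1r addrC subrK.
by rewrite hg q0 horner0.
Qed.

Lemma polyf_dense n (f g h : 'rV[K]_n -> K) : polyf f -> polyf g -> polyf h ->
  (exists x, f x != 0) -> (forall x, f x != 0 -> g x = h x) -> g =1 h.
Proof.
move=> pf pg ph ef H x; apply/eqP; rewrite -subr_eq0; apply/eqP.
apply: (polyf_dense0 pf (polyf_sub pg ph) ef) => y /H ->; exact: subrr.
Qed.

Lemma polyf_prod_neq0 n I (r : seq I) (F : I -> 'rV[K]_n -> K) :
  (forall i, polyf (F i)) -> (forall i, exists x, F i x != 0) ->
  exists x, \prod_(i <- r) F i x != 0.
Proof.
move=> pF eF; elim: r => [|i r [x hx]]; first by exists 0; rewrite big_nil oner_neq0.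
apply: contrapT => H; case/eqP: hx.
apply: (polyf_dense0 (pF i) (polyf_prod r xpredT pF) (eF i)) => y hy.
apply/eqP/negPn/negP => hy'; apply: H; exists y.
by rewrite big_cons mulf_neq0.
Qed.

(** The degree is an integer since [D.1] and the degree of a quotient may a priori be negative;
    [isform_neg] later excludes this for nonzero forms. *)
Definition homf n (a : int) (f : 'rV[K]_n -> K) :=
  forall t x, t != 0 -> f (t *: x) = t ^ a * f x.

Definition isform n (a : int) (f : 'rV[K]_n -> K) := polyf f /\ homf a f.

Lemma isform_ext n a (f g : 'rV[K]_n -> K) : isform a f -> f =1 g -> isform a g.
Proof. by move=> ff /funext <-. Qed.

Lemma isform_mul n a b (f g : 'rV[K]_n -> K) :
  isform a f -> isform b g -> isform (a + b) (fun x => f x * g x).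
Proof.
move=> [pf hf] [pg hg]; split; first exact: polyf_mul.
by move=> t x t0; rewrite hf // hg // expfzDr // mulrACA.
Qed.

Lemma isform_add n a (f g : 'rV[K]_n -> K) :
  isform a f -> isform a g -> isform a (fun x => f x + g x).
Proof.
move=> [pf hf] [pg hg]; split; first exact: polyf_add.
by move=> t x t0; rewrite hf // hg // mulrDr.
Qed.

Lemma isform0 n a : isform a (fun _ : 'rV[K]_n => 0).
Proof. by split; [exact: polyf_const|move=> t x _; rewrite mulr0]. Qed.

Lemma isform_const n c : isform 0 (fun _ : 'rV[K]_n => c).
Proof. by split; [exact: polyf_const|move=> t x _; rewrite expr0z mul1r]. Qed.

Lemma isform_scale n a c (f : 'rV[K]_n -> K) :
  isform a f -> isform a (fun x => c * f x).
Proof. by move=> /(isform_mul (isform_const n c)); rewrite add0r. Qed.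

Lemma isform_sub n a (f g : 'rV[K]_n -> K) :
  isform a f -> isform a g -> isform a (fun x => f x - g x).
Proof.
move=> ff /(isform_scale (-1)) /(isform_add ff) /isform_ext; apply => x.
by rewrite mulN1r.
Qed.

Lemma isform_coord n i : isform 1 (fun x : 'rV[K]_n => x 0 i).
Proof.
by split; [exact: polyf_coord|move=> t x _; rewrite mxE expr1z].
Qed.

Lemma isform_exp n a k (f : 'rV[K]_n -> K) :
  isform a f -> isform (a *+ k) (fun x => f x ^+ k).
Proof.
move=> ff; elim: k => [|k IH]; first exact: isform_const.
by rewrite mulrS; apply: isform_ext (isform_mul ff IH) _ => x; rewrite exprS.
Qed.

Lemma isform_sum n a I (r : seq I) (P : pred I) (F : I -> 'rV[K]_n -> K) :
  (forall i, isform a (F i)) -> isform a (fun x => \sum_(i <- r | P i) F i x).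
Proof.
move=> pF; elim: r => [|i r IH].
  by apply: isform_ext (isform0 n a) _ => x; rewrite big_nil.
case Pi: (P i); last by apply: isform_ext IH _ => x; rewrite big_cons Pi.
by apply: isform_ext (isform_add (pF i) IH) _ => x; rewrite big_cons Pi.
Qed.

Lemma isform_prod n I (r : seq I) (P : pred I) a (F : I -> 'rV[K]_n -> K) :
  (forall i, isform (a i) (F i)) ->
  isform (\sum_(i <- r | P i) a i) (fun x => \prod_(i <- r | P i) F i x).
Proof.
move=> pF; elim: r => [|i r IH].
  by rewrite big_nil; apply: isform_ext (isform_const n 1) _ => x; rewrite big_nil.
rewrite big_cons; case Pi: (P i); last by apply: isform_ext IH _ => x; rewrite big_cons Pi.
by apply: isform_ext (isform_mul (pF i) IH) _ => x; rewrite big_cons Pi.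
Qed.

Lemma isform_mulmx n m a (f : 'rV[K]_n -> K) (A : 'M[K]_(m, n)) :
  isform a f -> isform a (fun x => f (x *m A)).
Proof.
move=> [pf hf]; split; first exact: polyf_mulmx.
by move=> t x t0; rewrite -scalemxAl hf.
Qed.

(** If a = -(k+1), then t^(k+1) f(t x) = f(x) for all nonzero t, hence as polynomials in t; at t = 0
    this reads f(x) = 0. *)
Lemma isform_neg n a (f : 'rV[K]_n -> K) : a < 0 -> isform a f -> forall x, f x = 0.
Proof.
move=> a0 [pf hf] x.
have [q hq] := polyf_curve pf (polycurve_line 0 x).
have {}hq t : f (t *: x) = q.[t] by rewrite -hq add0r.
case: a a0 hf => // k _ hf.
have E : 'X ^+ k.+1 * q = (f x)%:P.
  apply: horner_inj_nz => t t0.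
  by rewrite hornerM hornerXn hornerC -hq hf // NegzE -exprnN mulrA divff ?mul1r // expf_neq0.
have := congr1 (fun p => p.[0]) E.
by rewrite hornerM hornerXn hornerC expr0n mul0r => <-.
Qed.

End PolynomialFunctions.

(** * Ternary forms in coordinates and multiplicity at a point *)

Section Forms.
Variable K : numClosedFieldType.
Definition i0 : 'I_3 := @Ordinal 3 0 isT.
Definition i1 : 'I_3 := @Ordinal 3 1 isT.
Definition i2 : 'I_3 := @Ordinal 3 2 isT.

Lemma I3_ind (P : 'I_3 -> Prop) : P i0 -> P i1 -> P i2 -> forall i, P i.
Proof.
move=> h0 h1 h2 [[|[|[|//]]] hi].
- by have -> : Ordinal hi = i0 by apply: val_inj.
- by have -> : Ordinal hi = i1 by apply: val_inj.
- by have -> : Ordinal hi = i2 by apply: val_inj.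
Qed.

Lemma sum3 (V : nmodType) (F : 'I_3 -> V) : \sum_i F i = F i0 + F i1 + F i2.
Proof.
rewrite !big_ord_recr big_ord0 /= add0r.
by congr (_ + _ + _); congr F; apply: val_inj.
Qed.

Lemma prod3 (F : 'I_3 -> K) : \prod_i F i = F i0 * F i1 * F i2.
Proof.
rewrite !big_ord_recr big_ord0 /= mul1r.
by congr (_ * _ * _); congr F; apply: val_inj.
Qed.

Definition vec3 (a b c : K) : 'rV[K]_3 := \row_j nth 0 [:: a; b; c] j.

Lemma vec3E a b c :
  (vec3 a b c 0 i0 = a) * (vec3 a b c 0 i1 = b) * (vec3 a b c 0 i2 = c).
Proof. by rewrite !mxE. Qed.

Lemma row3P (u v : 'rV[K]_3) :
  u 0 i0 = v 0 i0 -> u 0 i1 = v 0 i1 -> u 0 i2 = v 0 i2 -> u = v.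
Proof. by move=> h0 h1 h2; apply/rowP; apply: I3_ind. Qed.

(** The index [k] is the order of the monomial at (1 : 0 : 0), so multiplicity at least b there
    means that the coefficients with k < b vanish. *)
Definition mono (a k l : nat) (x : 'rV[K]_3) : K :=
  x 0 i0 ^+ (a - k) * x 0 i1 ^+ l * x 0 i2 ^+ (k - l).

Definition ev (a : nat) (c : nat -> nat -> K) (x : 'rV[K]_3) : K :=
  \sum_(k < a.+1) \sum_(l < k.+1) c k l * mono a k l x.

Lemma mono_isform a k l : (k <= a)%N -> (l <= k)%N -> isform (Posz a) (mono a k l).
Proof.
move=> ka lk.
have H := isform_mul (isform_mul (isform_exp (a - k) (isform_coord K i0))
  (isform_exp l (isform_coord K i1))) (isform_exp (k - l) (isform_coord K i2)).
have E : (1 *+ (a - k) + 1 *+ l + 1 *+ (k - l) : int) = a by rewrite !natz; lia.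
by rewrite E in H.
Qed.

Lemma ev_isform a c : isform (Posz a) (ev a c).
Proof.
apply: isform_sum => k; apply: isform_sum => l; apply: isform_scale.
by apply: mono_isform; rewrite -ltnS.
Qed.

Lemma ev_add a c c' x : ev a (fun k l => c k l + c' k l) x = ev a c x + ev a c' x.
Proof.
rewrite /ev -big_split /=. apply: eq_bigr => k _; rewrite -big_split /=.
by apply: eq_bigr => l _; rewrite mulrDl.
Qed.

Lemma ev_scale a z c x : ev a (fun k l => z * c k l) x = z * ev a c x.
Proof.
rewrite /ev big_distrr /=; apply: eq_bigr => k _; rewrite big_distrr /=.
by apply: eq_bigr => l _; rewrite mulrA.
Qed.

Lemma ev_delta a k0 l0 x : (k0 <= a)%N -> (l0 <= k0)%N ->
  ev a (fun k l => ((k == k0) && (l == l0))%:R) x = mono a k0 l0 x.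
Proof.
move=> ka lk; rewrite /ev (bigD1 (Ordinal (ka : k0 < a.+1)%N)) //=.
rewrite (bigD1 (Ordinal (lk : l0 < k0.+1)%N)) //= !eqxx mul1r !big1 ?addr0 //.
  move=> k; rewrite -val_eqE /= => /negbTE nk; apply: big1 => l _.
  by rewrite nk mul0r.
by move=> l; rewrite -val_eqE /= => /negbTE ->; rewrite mul0r.
Qed.

Lemma mpoly_monomial3 (m : 'X_{1..3}) (x : 'rV[K]_3) a : mdeg m = a ->
  [/\ (m i1 + m i2 <= a)%N, (m i1 <= m i1 + m i2)%N &
  \prod_i x 0 i ^+ m i = mono a (m i1 + m i2) (m i1) x].
Proof.
rewrite mdegE sum3 => E; split; [lia|lia|].
rewrite prod3 /mono -E; congr (_ ^+ _ * _ * _ ^+ _); lia.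
Qed.

Lemma isform_ev (a : nat) f : isform (Posz a) f -> exists c, forall x, f x = ev a c x.
Proof.
move=> [/polyf_mpoly [F hF] hf].
have fE x : f x = \sum_(m <- msupp F | mdeg m == a) F@_m * \prod_i x 0 i ^+ m i.
  (* Grading [F] by total degree gives q(t) = f(t x), which homogeneity forces to be f(x) t^a: only
     the part of [F] of degree [a] contributes. *)
  pose q : {poly K} := \sum_(m <- msupp F) (F@_m * \prod_i x 0 i ^+ m i) *: 'X^(mdeg m).
  have qE : q = f x *: 'X^a.
    apply: horner_inj_nz => t t0.
    rewrite hornerZ hornerXn mulrC -[X in X * _]/(t ^ a) -hf // hF mevalE horner_sum.
    apply: eq_bigr => m _; rewrite hornerZ hornerXn -mulrA; congr (_ * _).
    rewrite mulrC mdegE -prodrXr -big_split /=.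
    by apply: eq_bigr => i _; rewrite mxE exprMn.
  have := congr1 (fun p : {poly K} => p`_a) qE.
  rewrite coefZ coefXn eqxx mulr1 => <-; rewrite coef_sum [RHS]big_mkcond.
  apply: eq_bigr => m _; rewrite coefZ coefXn eq_sym.
  by case: eqP; rewrite ?mulr1 ?mulr0.
suff [c hc] : exists c, forall x : 'rV[K]_3,
    \sum_(m <- msupp F | mdeg m == a) F@_m * \prod_i x 0 i ^+ m i = ev a c x.
  by exists c => x; rewrite fE hc.
elim: (msupp F) => [|m r [c hc]].
  exists (fun _ _ => 0) => x; rewrite big_nil /ev.
  by rewrite big1 // => k _; rewrite big1 // => l _; rewrite mul0r.
case: (altP (mdeg m =P a)) => [E|nE]; last first.
  by exists c => x; rewrite big_cons (negbTE nE) hc.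
exists (fun k l => F@_m * ((k == m i1 + m i2)%N && (l == m i1))%:R + c k l) => x.
have [h1 h2 h3] := mpoly_monomial3 x E.
by rewrite big_cons E eqxx ev_add ev_scale ev_delta // -hc h3.
Qed.

Lemma poly_coef_eq0 n (u : nat -> K) :
  (forall t, \sum_(k < n) u k * t ^+ k = 0) -> forall k, (k < n)%N -> u k = 0.
Proof.
move=> h k kn; have /horner_inj0 : forall t, (\poly_(k < n) u k).[t] = 0.
  by move=> t; rewrite horner_poly.
by move=> /(congr1 (fun p : {poly K} => p`_k)); rewrite coef_poly kn coef0.
Qed.

Lemma ev_affine a c (y z t : K) : ev a c (vec3 1 (t * y) (t * z)) =
  \sum_(k < a.+1) (\sum_(l < k.+1) c k l * (y ^+ l * z ^+ (k - l))) * t ^+ k.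
Proof.
apply: eq_bigr => k _; rewrite big_distrl /=; apply: eq_bigr => l _.
rewrite /mono !vec3E expr1n mul1r !exprMn.
have -> : t ^+ k = t ^+ l * t ^+ (k - l) by rewrite -exprD subnKC // -ltnS.
ring.
Qed.

(** The coefficient of t^k on (1, t y, t z) is the homogeneous part of degree k in (y, z).
    Divisibility by t^b kills it for k < b, and setting one variable to 1 separates its
    coefficients. *)
Lemma ev_divis a b c :
  (forall y z, exists q : {poly K}, forall t,
     ev a c (vec3 1 (t * y) (t * z)) = t ^+ b * q.[t]) ->
  forall k l, (k <= a)%N -> (l <= k)%N -> (k < b)%N -> c k l = 0.
Proof.
move=> h k l ka lk kb.
have {}h y z : \sum_(l < k.+1) c k l * (y ^+ l * z ^+ (k - l)) = 0.
  have [q hq] := h y z.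
  have E : \poly_(k < a.+1) (\sum_(l < k.+1) c k l * (y ^+ l * z ^+ (k - l)))
     = 'X^b * q.
    apply: horner_inj => t; rewrite horner_poly hornerM hornerXn -hq.
    by rewrite ev_affine.
  have := congr1 (fun p : {poly K} => p`_k) E.
  by rewrite coef_poly ltnS ka coefXnM kb.
apply: (@poly_coef_eq0 k.+1 (c k)) => // t; rewrite -[RHS](h t 1).
by apply: eq_bigr => i _; rewrite expr1n mulr1.
Qed.

Lemma ev_inj a c c' : ev a c =1 ev a c' ->
  forall k l, (k <= a)%N -> (l <= k)%N -> c k l = c' k l.
Proof.
move=> h k l ka lk; apply/eqP; rewrite -subr_eq0; apply/eqP.
apply: (@ev_divis a a.+1 (fun k l => c k l - c' k l)) => // y z.
exists 0 => t; rewrite horner0 mulr0.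
rewrite (_ : ev _ _ _ = ev a (fun k l => c k l + (-1) * c' k l) (vec3 1 (t * y) (t * z))).
  by rewrite ev_add ev_scale h mulN1r subrr.
by congr (ev a _ _); apply/funext => ?; apply/funext => ?; rewrite mulN1r.
Qed.

(** The chosen coefficients are unique by [ev_inj]. The default 0 outside the triangle lets jet
    conditions be stated for all indices, even beyond the degree. *)
Definition cf a (f : 'rV[K]_3 -> K) k l : K :=
  if (k <= a)%N && (l <= k)%N
  then xget (fun _ _ => 0) [set c | forall x, f x = ev a c x] k l else 0.

Lemma cf_uniq a f c k l : (forall x, f x = ev a c x) -> (k <= a)%N -> (l <= k)%N ->
  cf a f k l = c k l.
Proof.
move=> h ka lk; rewrite /cf ka lk /=; apply: (@ev_inj a) => // x; rewrite -h.
apply/esym; move: x.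
exact: (xgetPex (fun _ _ => 0) (P := [set c | forall x, f x = ev a c x]) (ex_intro _ c h)).
Qed.

Lemma cf_out a f k l : ~~ ((k <= a)%N && (l <= k)%N) -> cf a f k l = 0.
Proof. by rewrite /cf => /negbTE ->. Qed.

Lemma cf_ev a f : isform (Posz a) f -> forall x, f x = ev a (cf a f) x.
Proof.
move=> /isform_ev [c hc] x; rewrite hc; apply: eq_bigr => k _; apply: eq_bigr => l _.
by rewrite (cf_uniq hc) // -ltnS.
Qed.

Lemma cf_sum a n (v : 'I_n -> K) (F : 'I_n -> 'rV[K]_3 -> K) k l :
  (forall i, isform (Posz a) (F i)) ->
  cf a (fun x => \sum_i v i * F i x) k l = \sum_i v i * cf a (F i) k l.
Proof.
move=> hF; case h: ((k <= a)%N && (l <= k)%N); last first.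
  by rewrite cf_out ?h // big1 // => i _; rewrite cf_out ?h // mulr0.
case/andP: h => ka lk.
rewrite (@cf_uniq a _ (fun k l => \sum_i v i * cf a (F i) k l)) // => x.
rewrite /ev; under eq_bigr => i _ do rewrite (cf_ev (hF i)) /ev big_distrr /=.
rewrite exchange_big /=; apply: eq_bigr => k' _.
under eq_bigr => i _ do rewrite big_distrr /=.
rewrite exchange_big /=; apply: eq_bigr => l' _.
by rewrite big_distrl; apply: eq_bigr => i _ /=; rewrite mulrA.
Qed.

(** Directions [v] proportional to [p] are included; for forms they impose nothing new, by
    homogeneity. *)
Definition mult_ge (f : 'rV[K]_3 -> K) (p : 'rV[K]_3) (b : nat) :=
  forall v, exists q : {poly K}, forall t, f (p + t *: v) = t ^+ b * q.[t].

Lemma mult_ge_ext f g p b : mult_ge f p b -> f =1 g -> mult_ge g p b.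
Proof. by move=> hf /funext <-. Qed.

Lemma mult_ge0 f p : polyf f -> mult_ge f p 0.
Proof.
move=> pf v; have [q hq] := polyf_curve pf (polycurve_line p v).
by exists q => t; rewrite hq mul1r.
Qed.

Lemma mult_geM f g p b c :
  mult_ge f p b -> mult_ge g p c -> mult_ge (fun x => f x * g x) p (b + c).
Proof.
move=> hf hg v; have [q hq] := hf v; have [r hr] := hg v.
by exists (q * r) => t; rewrite hq hr hornerM exprD mulrACA.
Qed.

Definition e0 : 'rV[K]_3 := vec3 1 0 0.

Lemma mult_ge_ev a f g c b : g \in unitmx -> (forall x, f (x *m g) = ev a c x) ->
  mult_ge f (e0 *m g) b <->
  (forall k l, (k <= a)%N -> (l <= k)%N -> (k < b)%N -> c k l = 0).
Proof.
move=> gu hf; split=> [h|h v].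
  apply: ev_divis => y z; have [q hq] := h (vec3 0 y z *m g).
  exists q => t; rewrite -hq -hf scalemxAl -mulmxDl; congr (f (_ *m _)).
  by apply: row3P; rewrite !mxE /=; ring.
suff /(_ (v *m invmx g)) [q hq] : forall w : 'rV[K]_3,
    exists q : {poly K}, forall t, ev a c (e0 + t *: w) = t ^+ b * q.[t].
  by exists q => t; rewrite -hq -hf mulmxDl -scalemxAl mulmxKV.
move=> w.
(* On e0 + t w the last two coordinates are t w_1 and t w_2, so the monomial of index k carries a
   factor t^k; [u] is what is left without it. *)
pose u k l : {poly K} := (1 + 'X * (w 0 i0)%:P) ^+ (a - k) *
   ((w 0 i1) ^+ l * (w 0 i2) ^+ (k - l))%:P.
exists (\sum_(k < a.+1) \sum_(l < k.+1) (c k l)%:P * ('X^(k - b) * u k l)) => t.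
rewrite horner_sum big_distrr /=; apply: eq_bigr => k _.
rewrite horner_sum big_distrr /=; apply: eq_bigr => l _.
rewrite !hornerE /=; have [kb|kb] := ltnP k b.
  by rewrite h ?leq_ord // !(mul0r, mulr0).
rewrite /mono !mxE /= !add0r !exprMn.
have E1 : t ^+ l * t ^+ (k - l) = t ^+ b * t ^+ (k - b).
  by rewrite -!exprD !subnKC // -ltnS ltn_ord.
set A := (1 + t * _) ^+ _; set W1 := w _ _ ^+ l; set W2 := w _ _ ^+ (k - l).
transitivity (c k l * A * W1 * W2 * (t ^+ l * t ^+ (k - l))); last by rewrite E1; ring.
ring.
Qed.

Lemma mult_ge_cf a f g b : g \in unitmx -> isform (Posz a) f ->
  mult_ge f (e0 *m g) b <->
  (forall k l, (k < b)%N -> cf a (fun x => f (x *m g)) k l = 0).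
Proof.
move=> gu ff; have := isform_mulmx g ff => ffg.
rewrite (mult_ge_ev b gu (cf_ev ffg)); split=> h k l.
  move=> kb; case E: ((k <= a)%N && (l <= k)%N); last by rewrite cf_out ?E.
  by case/andP: E => ka lk; apply: h.
by move=> _ _; apply: h.
Qed.

Lemma frame_ex (p : 'rV[K]_3) : p != 0 -> exists2 g, g \in unitmx & e0 *m g = p.
Proof.
move=> p0.
have E : e0 *m (\matrix_(i, j) p 0 j) = p.
  by apply/rowP => j; rewrite mxE sum3 !mxE /=; ring.
have e00 : e0 != 0.
  by apply/eqP => /rowP /(_ i0); rewrite !mxE /= => /eqP; rewrite oner_eq0.
have [|g gu gE] := @complete_unitmx K 1 3 e0 (\matrix_(i, j) p 0 j).
  by rewrite E !rank_rV p0 e00.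
by exists g => //; rewrite -gE.
Qed.

Lemma mult_ge_degree a f p b : p != 0 -> isform (Posz a) f ->
  (exists x, f x != 0) -> mult_ge f p b -> (b <= a)%N.
Proof.
move=> p0 ff [x fx]; have [g gu <-] := frame_ex p0.
move=> /(mult_ge_cf _ gu ff) h; rewrite leqNgt; apply/negP => ab; case/eqP: fx.
rewrite -(mulmxKV gu x) (cf_ev (isform_mulmx g ff)).
apply: big1 => k _; apply: big1 => l _; rewrite h ?mul0r //.
exact: leq_ltn_trans (leq_ord k) ab.
Qed.

(** Used in two ways: [tri a.+1] indexes the monomials of degree [a], and [tri b] the conditions for
    multiplicity [b] at one point. *)
Definition tri b := {k : 'I_b & 'I_k.+1}.

Lemma card_tri b : #|{: tri b}| = 'C(b.+1, 2).
Proof.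
rewrite card_tagged sumnE big_map big_enum /=.
under eq_bigr => k _ do rewrite card_ord.
elim: b => [|b IH]; first by rewrite big_ord0.
by rewrite big_ord_recr /= IH (binS b.+1 1) bin1.
Qed.

Definition kx b (i : 'I_#|{: tri b}|) : nat := tag (enum_val i : tri b).
Definition lx b (i : 'I_#|{: tri b}|) : nat := tagged (enum_val i : tri b).

Lemma kx_le a (i : 'I_#|{: tri a.+1}|) : (kx i <= a)%N.
Proof. by rewrite /kx -ltnS ltn_ord. Qed.

Lemma lx_le b (i : 'I_#|{: tri b}|) : (lx i <= kx i)%N.
Proof. by rewrite /kx /lx -ltnS ltn_ord. Qed.

Definition fv a (v : 'rV[K]_#|{: tri a.+1}|) (x : 'rV[K]_3) : K :=
  \sum_i v 0 i * mono a (kx i) (lx i) x.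

Definition rowof a (f : 'rV[K]_3 -> K) : 'rV[K]_#|{: tri a.+1}| :=
  \row_i cf a f (kx i) (lx i).

Lemma tri_sum a (F : nat -> nat -> K) :
  \sum_(i < #|{: tri a.+1}|) F (kx i) (lx i) =
  \sum_(k < a.+1) \sum_(l < k.+1) F k l.
Proof.
rewrite (@sig_big_dep K 0 +%R 'I_a.+1 (fun k => 'I_k.+1) xpredT (fun=> xpredT)
  (fun k l => F k l)) /=.
have bij : {on xpredT, bijective (fun i : 'I_#|{: tri a.+1}| => enum_val i : tri a.+1)}.
  exact/onW_bij/enum_val_bij.
by rewrite [RHS](reindex _ bij).
Qed.

Lemma fv_rowof a f : isform (Posz a) f -> forall x, fv (rowof a f) x = f x.
Proof.
move=> ff x; rewrite (cf_ev ff) /fv /ev.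
rewrite -(tri_sum a (fun k l => cf a f k l * mono a k l x)).
by apply: eq_bigr => i _; rewrite mxE.
Qed.

Lemma fv_isform a v : isform (Posz a) (@fv a v).
Proof.
apply: isform_sum => i; apply: isform_scale.
by apply: mono_isform; rewrite ?kx_le ?lx_le.
Qed.

Lemma rowof_eq0 a f : isform (Posz a) f -> rowof a f = 0 -> forall x, f x = 0.
Proof.
move=> ff h x; rewrite -(fv_rowof ff) h /fv big1 // => i _.
by rewrite mxE mul0r.
Qed.

Definition mon_i a (i : 'I_#|{: tri a.+1}|) (x : 'rV[K]_3) :=
  mono a (kx i) (lx i) x.

Lemma mon_i_isform a (i : 'I_#|{: tri a.+1}|) : isform (Posz a) (mon_i i).
Proof. by apply: mono_isform; rewrite ?kx_le ?lx_le. Qed.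

Lemma rowof_fv a (v : 'rV[K]_#|{: tri a.+1}|) : rowof a (fv v) = v.
Proof.
apply/rowP => i; rewrite mxE (@cf_sum a _ (v 0) (@mon_i a)); last first.
  by move=> j; apply: mon_i_isform.
rewrite (bigD1 i) //= big1 ?addr0.
  rewrite (@cf_uniq a _ (fun k l => ((k == kx i) &&
    (l == lx i))%:R)) ?eqxx ?mulr1 ?kx_le ?lx_le //.
  by move=> x; rewrite ev_delta ?kx_le ?lx_le.
move=> j ji; rewrite (@cf_uniq a _ (fun k l => ((k == kx j) &&
    (l == lx j))%:R)) ?kx_le ?lx_le //; last first.
  by move=> x; rewrite ev_delta ?kx_le ?lx_le.
case: eqP => [E1|]; last by rewrite mulr0.
case: eqP => [E2|]; last by rewrite mulr0.
case/eqP: ji; apply: enum_val_inj.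
move: E1 E2; rewrite /kx /lx.
case: (enum_val i) (enum_val j) => [k l] [k' l'] /= /val_inj E1.
by subst k' => /val_inj ->.
Qed.

End Forms.

(** * Jet conditions and dimension counts *)

Section Counting.
Variable K : numClosedFieldType.

Lemma fv_sum a I (r : seq I) (v : I -> 'rV[K]_#|{: tri a.+1}|) (x : 'rV[K]_3) :
  fv (\sum_(i <- r) v i) x = \sum_(i <- r) fv (v i) x.
Proof.
rewrite /fv exchange_big /=; apply: eq_bigr => j _.
by rewrite summxE big_distrl.
Qed.

Lemma fv_scale a c (v : 'rV[K]_#|{: tri a.+1}|) (x : 'rV[K]_3) :
  fv (c *: v) x = c * fv v x.
Proof.
by rewrite /fv big_distrr /=; apply: eq_bigr => j _; rewrite mxE mulrA.
Qed.

Definition mulform a e (f : 'rV[K]_3 -> K) :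
    'M[K]_(#|{: tri a.+1}|, #|{: tri e.+1}|) :=
  \matrix_i rowof e (fun x => f x * mon_i i x).

Lemma fv_mulform a e d f (v : 'rV[K]_#|{: tri a.+1}|) x :
  isform (Posz d) f -> e = (d + a)%N -> fv (v *m mulform a e f) x = f x * fv v x.
Proof.
move=> ff ->; rewrite mulmx_sum_row fv_sum [in RHS]/fv big_distrr /=.
apply: eq_bigr => i _; rewrite fv_scale rowK fv_rowof; last first.
  by rewrite PoszD; apply: isform_mul => //; apply: mon_i_isform.
by rewrite /mon_i /= mulrCA.
Qed.

Lemma fv_eq0 a (v : 'rV[K]_#|{: tri a.+1}|) : (forall x, fv v x = 0) -> v = 0.
Proof.
move=> h; rewrite -[v]rowof_fv; have -> : fv v = (fun=> 0) by apply/funext.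
apply/rowP => i; rewrite !mxE (@cf_uniq _ a _ (fun _ _ => 0)) ?kx_le ?lx_le //.
by move=> x; rewrite /ev big1 // => k _; rewrite big1 // => l _; rewrite mul0r.
Qed.

Lemma mulform_free a e d f : isform (Posz d) f -> e = (d + a)%N ->
  (exists x, f x != 0) -> row_free (mulform a e f).
Proof.
move=> ff E nf; apply: inj_row_free => v h; apply: fv_eq0 => x.
apply: (polyf_dense0 (proj1 ff) (proj1 (fv_isform v)) nf) => y fy.
apply: (mulfI fy); rewrite -(fv_mulform _ _ ff E) h mulr0 /fv big1 // => i _.
by rewrite mxE mul0r.
Qed.

(** Lets the leading part at e0 of a product be read from its expansion on lines, without
    multiplying out the factors. *)
Lemma cf_lead N F k0 (u : nat -> K) : isform (Posz N) F -> (k0 <= N)%N ->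
  (forall y z, exists2 q : {poly K}, q.[0] = \sum_(l < k0.+1) u l * (y ^+ l * z ^+ (k0 - l)) &
     forall t, F (vec3 1 (t * y) (t * z)) = t ^+ k0 * q.[t]) ->
  (forall l, (l <= k0)%N -> cf N F k0 l = u l) /\
  (forall k l, (k < k0)%N -> cf N F k l = 0).
Proof.
move=> fF k0N h; split=> [l lk|k l kk0]; last first.
  case E: ((k <= N)%N && (l <= k)%N); last by rewrite cf_out ?E.
  case/andP: E => kN lk; apply: (@ev_divis K N k0) => // y z.
  by have [q _ hq] := h y z; exists q => t; rewrite -(cf_ev fF).
apply/eqP; rewrite -subr_eq0; apply/eqP.
apply: (@poly_coef_eq0 K k0.+1 (fun l => cf N F k0 l - u l)) => // y.
have [q q0 hq] := h y 1.
have E : \poly_(k < N.+1) (\sum_(l < k.+1) cf N F k l * (y ^+ l * 1 ^+ (k - l)))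
     = 'X^k0 * q.
  apply: horner_inj => t; rewrite horner_poly hornerM hornerXn -hq.
  by rewrite (cf_ev fF) ev_affine.
have := congr1 (fun p : {poly K} => p`_k0) E.
rewrite coef_poly ltnS k0N coefXnM ltnn subnn -horner_coef0 q0 => E2.
rewrite -[RHS](subrr (\sum_(l < k0.+1) u l * (y ^+ l * 1 ^+ (k0 - l)))) -[X in X - _]E2.
rewrite -sumrB; apply: eq_bigr => i _; rewrite expr1n mulr1; ring.
Qed.

Variables (n : nat) (g : 'I_n -> 'M[K]_3).
Hypothesis gu : forall j, g j \in unitmx.

Definition cond (b : 'I_n -> nat) := {j : 'I_n & tri (b j)}.

Lemma card_cond b : #|{: cond b}| = (\sum_(j < n) 'C((b j).+1, 2))%N.
Proof.
rewrite card_tagged sumnE big_map big_enum /=.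
by apply: eq_bigr => j _; rewrite card_tri.
Qed.

Section Jets.
Variables (a : nat) (b : 'I_n -> nat).

Definition cj (s : cond b) : 'I_n := tag s.
Definition ck (s : cond b) : nat := tag (tagged s).
Definition cl (s : cond b) : nat := tagged (tagged s).

Lemma ck_lt s : (ck s < b (cj s))%N. Proof. exact: ltn_ord. Qed.
Lemma cl_le s : (cl s <= ck s)%N. Proof. by rewrite -ltnS /cl ltn_ord. Qed.

Lemma cond_inj s s' : cj s = cj s' -> ck s = ck s' -> cl s = cl s' -> s = s'.
Proof.
case: s s' => [j [k l]] [j' [k' l']]; rewrite /cj /ck /cl /= => E.
by subst j' => /val_inj E; subst k' => /val_inj ->.
Qed.

Definition jrow (f : 'rV[K]_3 -> K) : 'rV[K]_#|{: cond b}| :=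
  \row_s cf a (fun x => f (x *m g (cj (enum_val s)))) (ck (enum_val s)) (cl (enum_val s)).

Definition jets : 'M[K]_(#|{: tri a.+1}|, #|{: cond b}|) :=
  \matrix_i jrow (mon_i i).

Lemma mul_jets v : v *m jets = jrow (fv v).
Proof.
apply/rowP => s; rewrite mulmx_sum_row summxE mxE.
rewrite (@cf_sum K a _ (v 0) (fun i x => mon_i i (x *m g (cj (enum_val s))))).
  by apply: eq_bigr => i _; rewrite !mxE.
by move=> i; apply: isform_mulmx; apply: mon_i_isform.
Qed.

Lemma rowof_jets f : isform (Posz a) f -> rowof a f *m jets = jrow f.
Proof.
move=> ff; rewrite mul_jets; congr jrow; apply/funext; exact: fv_rowof.
Qed.

Lemma jrow_eq0 f : isform (Posz a) f ->
  jrow f = 0 <-> forall j, mult_ge f (e0 K *m g j) (b j).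
Proof.
move=> ff; split=> [h j|h].
  apply/(mult_ge_cf _ (gu j) ff) => k l kb.
  case E: ((k <= a)%N && (l <= k)%N); last by rewrite cf_out ?E.
  case/andP: E => ka lk.
  pose s : cond b := existT (fun j => tri (b j)) j (existT (fun k : 'I_(b j) => 'I_k.+1)
    (Ordinal kb) (Ordinal (lk : l < k.+1)%N)).
  by have /rowP /(_ (enum_rank s)) := h; rewrite !mxE enum_rankK.
apply/rowP => s; rewrite !mxE.
exact: (proj1 (mult_ge_cf _ (gu _) ff) (h _)) (ck_lt _).
Qed.

(** The interpolation hypothesis makes the jet map onto, and [f] is a nonzero element of its kernel;
    rank and nullity give the strict inequality. *)
Lemma jets_interpolation_count :
  (forall G : 'I_n -> 'rV[K]_3 -> K, (forall j, isform (Posz a) (G j)) ->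
     exists2 F, isform (Posz a) F &
       forall j, mult_ge (fun x => F x - G j x) (e0 K *m g j) (b j)) ->
  (exists2 f, isform (Posz a) f & (exists x, f x != 0) /\
       forall j, mult_ge f (e0 K *m g j) (b j)) ->
  (\sum_(j < n) 'C((b j).+1, 2) < 'C(a.+2, 2))%N.
Proof.
move=> surj [f ff [[x fx] fm]].
have e0g j : e0 K *m g j != 0.
  apply/eqP => /(congr1 (mulmx^~ (invmx (g j)))); rewrite mulmxK // mul0mx.
  by move=> /rowP /(_ i0); rewrite !mxE /= => /eqP; rewrite oner_eq0.
(* Without this bound some jet coordinates would lie beyond degree [a], where [cf] is 0 by default
   and no form reaches them. *)
have ba j : (b j <= a)%N by apply: mult_ge_degree (e0g j) ff _ (fm j); exists x.
rewrite -card_cond -card_tri.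
have full : row_full jets.
  rewrite -sub1mx; apply/row_subP => s; rewrite rowE mulmx1.
  set y := delta_mx _ _.
  (* [G j] has, at the j-th point, exactly the jet prescribed by the coordinates of [y] that belong
     to that point. *)
  pose G j z := ev a (fun k l => \sum_(s < #|{: cond b}| |
     (cj (enum_val s) == j) && (ck (enum_val s) == k) && (cl (enum_val s) == l)) y 0 s)
     (z *m invmx (g j)).
  have [|F fF hF] := surj G.
    by move=> j; apply: isform_mulmx; apply: ev_isform.
  have -> : y = rowof a F *m jets; last exact: submxMl.
  rewrite rowof_jets //; apply/rowP => r; rewrite [RHS]mxE; apply/esym.
  have fG j : isform (Posz a) (G j) by apply: isform_mulmx; apply: ev_isform.
  have H := isform_sub fF (fG (cj (enum_val r))).
  have := proj1 (mult_ge_cf _ (gu _) H) (hF _) _ (cl (enum_val r)) (ck_lt _).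
  set k := ck _; set l := cl _; set j := cj _ => E.
  have ka : (k <= a)%N by apply: ltnW (leq_trans (ck_lt _) (ba _)).
  have lk : (l <= k)%N by apply: cl_le.
  have hE : forall x, F (x *m g j) = ev a (fun k l =>
      cf a (fun x => F (x *m g j) - G j (x *m g j)) k l +
      \sum_(s < #|{: cond b}| |
     (cj (enum_val s) == j) && (ck (enum_val s) == k) && (cl (enum_val s) == l)) y 0 s) x.
    move=> z; rewrite ev_add -(cf_ev (isform_mulmx (g j) H)) /G mulmxK ?gu //.
    by rewrite subrK.
  apply: (etrans (cf_uniq hE ka lk)); rewrite E add0r (big_pred1 r) // => s' /=.
  apply/andP/eqP => [[/andP[/eqP E1 /eqP E2] /eqP E3]|->]; last by rewrite !eqxx.
  by apply: enum_val_inj; apply: cond_inj.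
rewrite ltnNge; apply/negP => le.
have free : row_free jets.
  by rewrite /row_free eqn_leq rank_leq_row (eqP full).
have := mulmx_free_eq0 (rowof a f) free.
rewrite rowof_jets // (proj2 (jrow_eq0 ff)) // eqxx => /esym /eqP /(rowof_eq0 ff) f0.
by rewrite f0 eqxx in fx.
Qed.

End Jets.

(* A functional vanishing on all jets of forms of degree N is tested against
   prod_(i != j) h_i ^ b_i times a monomial in the frame at the j-th point, whose
   order is the highest one on which the functional is nonzero at that point. *)
Lemma jets_full (N : nat) (b : 'I_n -> nat) :
  (forall i j, i != j -> exists2 h, isform 1 h &
     h (e0 K *m g i) = 0 /\ h (e0 K *m g j) != 0) ->
  (\sum_j b j <= N)%N -> row_full (jets N b).
Proof.
move=> sep bN; rewrite /row_full -mxrank_tr; apply: inj_row_free => v hv.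
have test f : isform (Posz N) f -> \sum_s v 0 s * jrow N b f 0 s = 0.
  move=> ff; rewrite -rowof_jets //.
  have /(congr1 trmx) := hv; rewrite trmx_mul trmxK trmx0 => /(congr1 (mulmx (rowof N f))).
  rewrite mulmxA mulmx0 => /matrixP /(_ 0 0); rewrite [LHS]mxE [RHS]mxE => E; rewrite -[RHS]E.
  by apply: eq_bigr => s _; rewrite [v^T _ _]mxE mulrC.
apply: contrapT => /eqP /rV0Pn [s1 hs1].
pose j := cj (enum_val s1).
pose s0 := [arg max_(s > s1 | (v 0%R s != 0%R) && (cj (enum_val s) == j)) ck (enum_val s)]%N.
have [hs0 js0 max0] : [/\ v 0 s0 != 0, cj (enum_val s0) = j &
    forall s, v 0 s != 0 -> cj (enum_val s) = j -> (ck (enum_val s) <= ck (enum_val s0))%N].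
  rewrite /s0; case: arg_maxnP => [|s /andP[h1 /eqP h2] h3]; first by rewrite hs1 eqxx.
  by split=> // s' h4 h5; apply: h3; rewrite h4 h5 eqxx.
set k0 := ck (enum_val s0) in max0; set l0 := cl (enum_val s0).
have k0b : (k0 < b j)%N by rewrite -js0; apply: ck_lt.
have l0k : (l0 <= k0)%N by apply: cl_le.
have /choice [h hh] : forall i, exists h : 'rV[K]_3 -> K, isform 1 h /\
    (i != j -> h (e0 K *m g i) = 0 /\ h (e0 K *m g j) != 0).
  move=> i; have [ij|ij] := eqVneq i j; first by exists (fun=> 0); split=> //; apply: isform0.
  by have [h h1 h2] := sep _ _ ij; exists h; split.
pose d := (\sum_(i < n | i != j) b i)%N.
have dN : (d + b j <= N)%N by move: bN; rewrite (bigD1 j) //= addnC.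
pose Q x := \prod_(i < n | i != j) h i x ^+ b i.
have fQ : isform (Posz d) Q.
  have := isform_prod (index_enum 'I_n) (fun i => i != j)
    (fun i => isform_exp (b i) (proj1 (hh i))).
  suff -> : \sum_(i | i != j) 1 *+ b i = Posz d :> int by [].
  by rewrite /d (big_morph Posz PoszD (erefl _)); apply: eq_bigr => i _; rewrite natz.
have Qj : Q (e0 K *m g j) != 0.
  by rewrite prodf_seq_neq0; apply/allP => i _; apply/implyP => ij;
     rewrite expf_neq0 //; have [_ /(_ ij) []] := hh i.
pose f x := Q x * mono (N - d) k0 l0 (x *m invmx (g j)).
have kNd : (k0 <= N - d)%N by lia.
have ff : isform (Posz N) f.
  have -> : Posz N = Posz d + Posz (N - d) by rewrite -PoszD; congr Posz; lia.
  by apply: isform_mul => //; apply: isform_mulmx; apply: mono_isform.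
have fi i : i != j -> mult_ge f (e0 K *m g i) (b i).
  move=> ij; rewrite -[b i]addn0; apply: mult_geM; last first.
    by apply: mult_ge0; apply: polyf_mulmx; case: (mono_isform K kNd l0k).
  move=> w; have [q hq] := polyf_curve (proj1 (proj1 (hh i))) (polycurve_line (e0 K *m g i) w).
  have : root q 0.
    by rewrite /root -hq scale0r addr0; have [_ /(_ ij) [-> _]] := hh i.
  move=> /factor_theorem [r hr].
  pose Q' x := \prod_(i' < n | (i' != j) && (i' != i)) h i' x ^+ b i'.
  have pQ' : polyf Q'.
    by apply: polyf_prod => i'; apply: polyf_exp; case: (proj1 (hh i')).
  have [q' hq'] := polyf_curve pQ' (polycurve_line (e0 K *m g i) w).
  exists (r ^+ b i * q') => t; rewrite /Q (bigD1 i) //= -/(Q' _) hq' hq hr.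
  by rewrite !hornerM horner_exp hornerXsubC subr0 exprMn; ring.
have fj : (forall l, (l <= k0)%N -> cf N (fun x => f (x *m g j)) k0 l =
     Q (e0 K *m g j) * (l == l0)%:R) /\
    (forall k l, (k < k0)%N -> cf N (fun x => f (x *m g j)) k l = 0).
  apply: (@cf_lead N _ k0 (fun l => Q (e0 K *m g j) * (l == l0)%:R)); [exact: isform_mulmx|lia|].
  move=> y z.
  have pc : polycurve (fun t => e0 K + t *: vec3 0 y z) by exact: polycurve_line.
  have [q hq] := polyf_curve (polyf_mulmx (g j) (proj1 fQ)) pc.
  exists (q * (y ^+ l0 * z ^+ (k0 - l0))%:P).
    rewrite !hornerE -hq scale0r addr0 (bigD1 (Ordinal (l0k : l0 < k0.+1)%N)) //=.
    rewrite eqxx mulr1 big1 ?addr0 ?mulrA // => i; rewrite -val_eqE /= => /negbTE ->.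
    by rewrite mulr0 mul0r.
  move=> t; rewrite !hornerE -hq /f mulmxK ?gu // /mono !vec3E expr1n mul1r !exprMn.
  have -> : e0 K + t *: vec3 0 y z = vec3 1 (t * y) (t * z).
    by apply: row3P; rewrite !mxE /=; ring.
  have -> : t ^+ k0 = t ^+ l0 * t ^+ (k0 - l0) by rewrite -exprD subnKC.
  move: (Q _) (t ^+ l0) (t ^+ (k0 - l0)) (y ^+ l0) (z ^+ (k0 - l0)) => c1 c2 c3 c4 c5.
  by rewrite /=; ring.
(* Only the term [s0] survives: [f] has the full multiplicity at the other points, its leading part
   at the j-th point is one monomial, and [v] vanishes there on orders above [k0]. *)
have := test f ff; rewrite (bigD1 s0) //= big1 ?addr0.
  rewrite mxE js0 -/k0 -/l0 (proj1 fj) // eqxx mulr1 => /eqP.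
  by rewrite mulf_eq0 (negbTE hs0) (negbTE Qj).
move=> s ss0; have [->|vs] := eqVneq (v 0 s) 0; first by rewrite mul0r.
apply/eqP; rewrite mulf_eq0 (negbTE vs) /= mxE; apply/eqP.
have [js|js] := eqVneq (cj (enum_val s)) j; last first.
  exact: (proj1 (mult_ge_cf _ (gu _) ff) (fi _ js)) (ck_lt _).
rewrite js; have := max0 s vs js; rewrite leq_eqVlt => /orP[/eqP E|]; last exact: (proj2 fj).
rewrite E (proj1 fj); last by rewrite -E cl_le.
have [E2|] := eqVneq (cl (enum_val s)) l0; last by rewrite mulr0.
by case/eqP: ss0; apply: enum_val_inj; apply: cond_inj => //; rewrite js js0.
Qed.

Lemma bin2_double y : ('C(y.+1, 2) * 2 = y * y.+1)%N.
Proof. by elim: y => // y IH; rewrite (binS y.+1 1) bin1; lia. Qed.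

(* Bezout's inequality by counting: fA + f'B has multiplicity at least m + m'
   when A has multiplicity at least m' and B at least m. *)
Lemma bezout_multiplicities (d d' : nat) f f' (m m' : 'I_n -> nat) :
  (forall i j, i != j -> exists2 h, isform 1 h &
     h (e0 K *m g i) = 0 /\ h (e0 K *m g j) != 0) ->
  isform (Posz d) f -> isform (Posz d') f' ->
  (exists x, f x != 0) -> (exists x, f' x != 0) ->
  (forall j, mult_ge f (e0 K *m g j) (m j)) ->
  (forall j, mult_ge f' (e0 K *m g j) (m' j)) ->
  (forall (e : nat) A B, isform (Posz (e + d')) A -> isform (Posz (e + d)) B ->
     (forall x, f x * A x = f' x * B x) ->
     exists2 h, isform (Posz e) h & forall x, A x = f' x * h x) ->
  (\sum_j m j * m' j <= d * d')%N.
Proof.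
move=> sep ff ff' nf nf' mf mf' cop.
(* [N] is at least the sum of the m_j + m'_j, so the jets of that order are independent in degree
   [N]; the excess d + d' leaves degree [S] for the common quotient. *)
pose b j := (m j + m' j)%N; pose S := (\sum_j b j)%N; pose N := (S + d + d')%N.
pose M1 := mulform (S + d') N f; pose M2 := mulform (S + d) N f'.
pose W1 := kermx (jets (S + d') m') *m M1.
pose W2 := kermx (jets (S + d) m) *m M2.
have E1 : N = (d + (S + d'))%N by rewrite /N; lia.
have E2 : N = (d' + (S + d))%N by rewrite /N; lia.
have ker1 a (c : 'I_n -> nat) (u : 'rV_#|{: tri a.+1}|) : (u <= kermx (jets a c))%MS ->
    forall j, mult_ge (fv u) (e0 K *m g j) (c j).
  by move=> /sub_kermxP; rewrite mul_jets => /(jrow_eq0 c (fv_isform u)).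
have sub1 : (W1 <= kermx (jets N b))%MS.
  apply/row_subP => i; rewrite row_mul; apply/sub_kermxP; rewrite mul_jets.
  apply/(jrow_eq0 b (fv_isform _)) => j.
  apply: (mult_ge_ext (f := fun x => f x * fv (row i (kermx (jets (S + d') m'))) x)).
    by apply: mult_geM (mf j) _; apply: ker1; apply: row_sub.
  by move=> x; rewrite (fv_mulform _ _ ff E1).
have sub2 : (W2 <= kermx (jets N b))%MS.
  apply/row_subP => i; rewrite row_mul; apply/sub_kermxP; rewrite mul_jets.
  apply/(jrow_eq0 b (fv_isform _)) => j; rewrite /b (addnC (m j)).
  apply: (mult_ge_ext (f := fun x => f' x * fv (row i (kermx (jets (S + d) m))) x)).
    by apply: mult_geM (mf' j) _; apply: ker1; apply: row_sub.
  by move=> x; rewrite (fv_mulform _ _ ff' E2).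
(* A common element is f A = f' B, and [cop] makes A a multiple of f'; so it has the form f f' h
   with h of degree [S]. *)
have cap : (W1 :&: W2 <= mulform S N (fun x => (f x * f' x)%R))%MS.
  apply/row_subP => i; set u := row i _.
  have uc : (u <= W1 :&: W2)%MS by apply: row_sub.
  have /submxP [v1 hv1] : (u <= M1)%MS.
    exact: submx_trans (submx_trans uc (capmxSl _ _)) (submxMl _ _).
  have /submxP [v2 hv2] : (u <= M2)%MS.
    exact: submx_trans (submx_trans uc (capmxSr _ _)) (submxMl _ _).
  have [x|h fh hE] := cop S _ _ (fv_isform v1) (fv_isform v2).
    by rewrite -(fv_mulform _ _ ff E1) -(fv_mulform _ _ ff' E2) -/M1 -/M2 -hv1 -hv2.
  suff -> : u = rowof S h *m mulform S N (fun x => (f x * f' x)%R) by apply: submxMl.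
  apply/eqP; rewrite -subr_eq0; apply/eqP/fv_eq0 => x.
  have E3 : N = ((d + d') + S)%N by rewrite /N; lia.
  have fff : isform (Posz (d + d')) (fun x => f x * f' x).
    by rewrite PoszD; apply: isform_mul.
  have fvB (v w : 'rV[K]_#|{: tri N.+1}|) : fv (v - w) x = fv v x - fv w x.
    rewrite /fv -sumrB; apply: eq_bigr => k _; rewrite !mxE; ring.
  rewrite fvB (fv_mulform _ _ fff E3) fv_rowof // {1}hv1 (fv_mulform _ _ ff E1) hE; ring.
have r1 : (\rank W1 + \rank W2 = \rank (W1 + W2)%MS + \rank (W1 :&: W2)%MS)%N.
  by rewrite mxrank_sum_cap.
have r2 : (\rank (W1 + W2)%MS <= \rank (kermx (jets N b)))%N.
  by apply: mxrankS; rewrite addsmx_sub sub1 sub2.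
have r3 := mxrankS cap.
have r4 := rank_leq_row (mulform S N (fun x => (f x * f' x)%R)).
have full : row_full (jets N b) by apply: jets_full => //; rewrite /N /S; lia.
rewrite mxrank_ker (eqP full) in r2.
have rW1 : \rank W1 = (#|{: tri (S + d').+1}| - \rank (jets (S + d') m'))%N.
  by rewrite /W1 mxrankMfree ?mxrank_ker // (mulform_free ff E1).
have rW2 : \rank W2 = (#|{: tri (S + d).+1}| - \rank (jets (S + d) m))%N.
  by rewrite /W2 mxrankMfree ?mxrank_ker // (mulform_free ff' E2).
have r5 := rank_leq_col (jets (S + d') m'); have r6 := rank_leq_col (jets (S + d) m).
have r7 := rank_leq_row (jets N b); rewrite (eqP full) in r7.
have bsum : (\sum_j 'C((b j).+1, 2) = \sum_j 'C((m j).+1, 2) + \sum_j 'C((m' j).+1, 2)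
   + \sum_j m j * m' j)%N.
  rewrite -!big_split /=; apply: eq_bigr => j _; rewrite /b.
  by have := bin2_double (m j + m' j); have := bin2_double (m j); have := bin2_double (m' j); nia.
have b1 := bin2_double N.+1; have b2 := bin2_double S.+1.
have b3 := bin2_double (S + d).+1; have b4 := bin2_double (S + d').+1.
(* By [bsum] the separate conditions for [m] and [m'] cancel and only the cross terms m_j m'_j
   remain. The second difference of the four binomials is d d', which ends the proof. *)
have key : ('C((S + d).+2, 2) + 'C((S + d').+2, 2) + \sum_j m j * m' j <=
    'C(N.+2, 2) + 'C(S.+2, 2))%N.
  move: r1 r2 r3 r4 r5 r6 r7; rewrite rW1 rW2.
  move: (\rank (jets (S + d') m')) (\rank (jets (S + d) m)) (\rank (W1 + W2)%MS)
    (\rank (W1 :&: W2)%MS) (\rank (mulform S N _)) => k1 k2 k3 k4 k5.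
  rewrite !card_tri !card_cond bsum.
  move: (\sum_(j < n) 'C((m j).+1, 2))%N (\sum_(j < n) 'C((m' j).+1, 2))%N
    (\sum_j m j * m' j)%N => t1 t2 t3.
  move: 'C(_, _) 'C(_, _) 'C(_, _) 'C(_, _) => u1 u2 u3 u4; lia.
have : (2 * \sum_j m j * m' j + (S + d).+1 * (S + d).+2 + (S + d').+1 * (S + d').+2 <=
  N.+1 * N.+2 + S.+1 * S.+2)%N by rewrite -b1 -b2 -b3 -b4; lia.
have nE : N = (S + d + d')%N by [].
clearbody N S; rewrite nE; move: (\sum_j m j * m' j)%N => T; lia.
Qed.

End Counting.

(** * Global division of forms from local divisibility *)

Section Division.
Variable K : numClosedFieldType.

(** At a root t of the reduced denominator F / gcd(F, G), every relation F' G = Q F forces F'(t) =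
    0. So this denominator has no root and is constant. *)
Lemma locally_divides (F G : {poly K}) : F != 0 ->
  (forall t, exists F' Q : {poly K}, F'.[t] != 0 /\ F' * G = Q * F) -> F %| G.
Proof.
move=> F0 h; pose d := gcdp F G; pose F1 := F %/ d; pose G1 := G %/ d.
have d0 : d != 0 by rewrite gcdp_eq0 (negbTE F0).
have EF : F = F1 * d by rewrite divpK // dvdp_gcdl.
have EG : G = G1 * d by rewrite divpK // dvdp_gcdr.
have cop : coprimep F1 G1 by apply: coprimep_div_gcd; rewrite F0.
suff s1 : size F1 == 1.
  by rewrite EF EG dvdp_mul2r //; apply: (@dvdp_trans _ 1); rewrite ?dvd1p // dvdp1.
apply/negPn/negP => /closed_rootP [t rt].
have [F' [Q [F't E]]] := h t.
have {}E : F' * G1 = Q * F1 by apply: (mulIf d0); rewrite -!mulrA -EF -EG.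
have : F1 %| F' * G1 by rewrite E dvdp_mulIr.
rewrite mulrC Gauss_dvdpr // => /dvdpP [r hr].
by case/eqP: F't; rewrite hr hornerM (rootP rt) mulr0.
Qed.

(** Polynomials of degree less than [N] in the first coordinate; that the coefficients involve only
    the other two is expressed by invariance under translation along e0. *)
Definition xpoly N (f : 'rV[K]_3 -> K) := exists g : nat -> 'rV[K]_3 -> K,
  (forall k, polyf (g k) /\ forall x t, g k (x + t *: e0 K) = g k x) /\
  forall x, f x = \sum_(k < N) g k x * x 0 i0 ^+ k.

Lemma xpoly_ext N f f' : xpoly N f -> f =1 f' -> xpoly N f'.
Proof. by move=> h /funext <-. Qed.

Lemma xpoly0 N : xpoly N (fun=> 0).
Proof.
exists (fun _ _ => 0); split=> [k|x]; first by split=> //; apply: polyf_const.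
by rewrite big1 // => k _; rewrite mul0r.
Qed.

Lemma xpolyD N f f' : xpoly N f -> xpoly N f' -> xpoly N (fun x => f x + f' x).
Proof.
move=> [g [h1 h2]] [g' [h1' h2']]; exists (fun k x => g k x + g' k x).
split=> [k|x]; last first.
  by rewrite h2 h2' -big_split /=; apply: eq_bigr => k _; rewrite mulrDl.
have [p1 q1] := h1 k; have [p2 q2] := h1' k.
by split=> [|x t]; [apply: polyf_add|rewrite q1 q2].
Qed.

Lemma xpoly_sum N n (F : 'I_n -> 'rV[K]_3 -> K) :
  (forall i, xpoly N (F i)) -> xpoly N (fun x => \sum_(i < n) F i x).
Proof.
elim: n F => [|n IH] F hF.
  by apply: xpoly_ext (xpoly0 N) _ => x; rewrite big_ord0.
apply: xpoly_ext (xpolyD (hF ord0) (IH _ (fun i => hF (lift ord0 i)))) _ => x.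
by rewrite big_ord_recl.
Qed.

Lemma xpoly_mon N k (f : 'rV[K]_3 -> K) : (k < N)%N -> polyf f ->
  (forall x t, f (x + t *: e0 K) = f x) -> xpoly N (fun x => f x * x 0 i0 ^+ k).
Proof.
move=> kN pf hf; exists (fun j x => (j == k)%:R * f x); split=> [j|x].
  by split=> [|x t]; [apply: polyf_scale|rewrite hf].
rewrite (bigD1 (Ordinal kN)) //= eqxx mul1r big1 ?addr0 // => j.
by rewrite -val_eqE /= => /negbTE ->; rewrite !mul0r.
Qed.

Definition evk (c : nat -> nat -> K) k (x : 'rV[K]_3) : K :=
  \sum_(l < k.+1) c k l * (x 0 i1 ^+ l * x 0 i2 ^+ (k - l)).

Lemma evk_polyf c k : polyf (evk c k).
Proof.
apply: polyf_sum => l; apply: polyf_scale.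
by apply: polyf_mul; apply: polyf_exp; apply: polyf_coord.
Qed.

Lemma evk_shift c k x t : evk c k (x + t *: e0 K) = evk c k x.
Proof. by apply: eq_bigr => l _; rewrite !mxE /= !mulr0 !addr0. Qed.

Lemma ev_evk a c x : ev a c x = \sum_(k < a.+1) evk c k x * x 0 i0 ^+ (a - k).
Proof.
apply: eq_bigr => k _; rewrite big_distrl; apply: eq_bigr => l _ /=.
rewrite /mono; ring.
Qed.

Lemma ev_xpoly a c : xpoly a.+1 (ev a c).
Proof.
apply: (xpoly_ext (f := fun x => \sum_(k < a.+1) evk c k x * x 0 i0 ^+ (a - k))).
  apply: xpoly_sum => k; apply: xpoly_mon; first by rewrite ltnS leq_subr.
    exact: evk_polyf.
  by move=> x t; apply: evk_shift.
by move=> x; rewrite ev_evk.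
Qed.

(** The coefficient of x_0^d in [F] is the constant F(e0). When it is nonzero, division by [F] in
    the variable x_0 needs no denominators. *)
Lemma form_xpoly d F : isform (Posz d) F ->
  xpoly d (fun x => F x - F (e0 K) * x 0 i0 ^+ d).
Proof.
move=> /isform_ev [c hc].
have E x : F x - F (e0 K) * x 0 i0 ^+ d =
    \sum_(k < d) evk c k.+1 x * x 0 i0 ^+ (d - k.+1).
  have -> : F (e0 K) = c 0%N 0%N.
    rewrite hc ev_evk big_ord_recl /= big1 ?addr0.
      by rewrite /evk big_ord_recl big_ord0 !mxE /= expr1n; ring.
    move=> k _; rewrite /evk big1 ?mul0r // => l _; rewrite !mxE /= !expr0n.
    by case: (nat_of_ord l) => [|l']; rewrite ?subn0 /= ?mulr0 ?mul0r ?mulr0.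
  rewrite hc ev_evk big_ord_recl /= subn0.
  have -> : evk c 0 x = c 0%N 0%N by rewrite /evk big_ord_recl big_ord0 !expr0; ring.
  by rewrite addrC addKr.
apply: xpoly_ext (fun x => esym (E x)).
apply: xpoly_sum => k; apply: xpoly_mon.
- by have := ltn_ord k; lia.
- exact: evk_polyf.
- by move=> x t; apply: evk_shift.
Qed.

Lemma xpoly_divide d F N G : xpoly d (fun x => F x - F (e0 K) * x 0 i0 ^+ d) ->
  F (e0 K) != 0 -> polyf F -> xpoly N G ->
  exists2 Q, polyf Q & xpoly d (fun x => G x - Q x * F x).
Proof.
move=> [f [hf fE]] c0 pF; elim: N G => [|N IH] G [g [hg gE]].
  exists (fun=> 0); first exact: polyf_const.
  by apply: xpoly_ext (xpoly0 d) _ => x; rewrite gE big_ord0 mul0r subr0.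
have [Nd|dN] := ltnP N d.
  exists (fun=> 0); first exact: polyf_const.
  apply: xpoly_ext (xpoly_sum (N := d) (F := fun (k : 'I_N.+1) x => g k x * x 0 i0 ^+ k) _) _.
    by move=> k; apply: xpoly_mon; [have := ltn_ord k; lia| |]; case: (hg k).
  by move=> x; rewrite gE mul0r subr0.
set c := F (e0 K) in c0 fE.
pose q x := g N x / c * x 0 i0 ^+ (N - d).
have pq : polyf q.
  apply: polyf_mul; last by apply: polyf_exp; apply: polyf_coord.
  by apply: polyf_mul; [case: (hg N)|apply: polyf_const].
have [|Q pQ hQ] := IH (fun x => G x - q x * F x).
  have E x : G x - q x * F x = \sum_(k < N) g k x * x 0 i0 ^+ k +
     \sum_(k < d) (- (g N x / c) * f k x) * x 0 i0 ^+ (k + (N - d)).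
    have -> : F x = \sum_(k < d) f k x * x 0 i0 ^+ k + c * x 0 i0 ^+ d.
      by rewrite -fE subrK.
    rewrite gE big_ord_recr /= mulrDr.
    have -> : q x * (c * x 0 i0 ^+ d) = g N x * x 0 i0 ^+ N.
      by rewrite /q mulrACA divfK // -exprD subnK.
    rewrite opprD addrACA subrr addr0; congr (_ + _).
    rewrite big_distrr -sumrN; apply: eq_bigr => k _ /=.
    by rewrite /q exprD; move: (x 0 i0 ^+ (N - d)) (x 0 i0 ^+ k) => u v; ring.
  apply: xpoly_ext (fun x => esym (E x)).
  apply: xpolyD; apply: xpoly_sum => k; apply: xpoly_mon.
  - exact: ltn_ord.
  - by case: (hg k).
  - by case: (hg k).
  - by have := ltn_ord k; lia.
  - apply: polyf_mul; last by case: (hf k).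
    by apply: polyf_opp; apply: polyf_mul; [case: (hg N)|apply: polyf_const].
  - by move=> x t; rewrite (proj2 (hg N)) (proj2 (hf k)).
exists (fun x => q x + Q x); first exact: polyf_add.
by apply: xpoly_ext hQ _ => x; ring.
Qed.

Lemma xpoly_polyf N f : xpoly N f -> polyf f.
Proof.
move=> [g [hg gE]]; apply: (polyf_ext (f := fun x => \sum_(k < N) g k x * x 0 i0 ^+ k)) => //.
apply: polyf_sum => k; apply: polyf_mul; first by case: (hg k).
by apply: polyf_exp; apply: polyf_coord.
Qed.

Lemma xpoly_line N f (x : 'rV[K]_3) : xpoly N f -> exists2 p : {poly K}, (size p <= N)%N &
  forall t, f (x + (t - x 0 i0) *: e0 K) = p.[t].
Proof.
move=> [g [hg gE]]; exists (\poly_(k < N) g k x); first exact: size_poly.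
move=> t; rewrite gE horner_poly; apply: eq_bigr => k _; rewrite (proj2 (hg k)) !mxE /=.
by congr (_ * _ ^+ _); ring.
Qed.

(** On every line in direction e0 the restriction of [F] has exact degree d. On the lines selected
    by [D] it divides that of [G], so the remainder, of smaller degree, is zero there, and then
    everywhere by density. *)
Lemma form_division_e0 (d e : nat) (F G D : 'rV[K]_3 -> K) : isform (Posz d) F -> isform (Posz e) G ->
  F (e0 K) != 0 -> polyf D -> (exists x, D x != 0) ->
  (forall x, D x != 0 -> forall t, exists F' Q, [/\ polyf F', polyf Q,
     F' (x + t *: e0 K) != 0 & forall z, F' z * G z = Q z * F z]) ->
  exists2 Q, polyf Q & forall x, G x = Q x * F x.
Proof.
move=> fF fG Fe pD nD loc.
have xF := form_xpoly fF.
have xG : xpoly e.+1 G.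
  have [c hc] := isform_ev fG.
  by apply: xpoly_ext (ev_xpoly e c) _ => x; rewrite hc.
have [Q pQ xR] := xpoly_divide xF Fe (proj1 fF) xG.
exists Q => // x; apply/eqP; rewrite -subr_eq0; apply/eqP; move: x.
apply: (polyf_dense0 pD (xpoly_polyf xR) nD) => x Dx.
have [r sr hr] := xpoly_line x xR.
have [f' sf hf] := xpoly_line x xF.
pose fF' := f' + F (e0 K) *: 'X^d.
pose c t := x + (t - x 0 i0) *: e0 K.
have pc : polycurve c.
  move=> i; exists ((x 0 i)%:P + ('X - (x 0 i0)%:P) * (e0 K 0 i)%:P) => t.
  by rewrite /c !hornerE !mxE.
have hF t : F (c t) = fF'.[t].
  rewrite hornerD hornerZ hornerXn -hf -/(c t).
  have -> : c t 0 i0 = t by rewrite /c !mxE /=; ring.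
  by rewrite subrK.
have sF : size fF' = d.+1.
  rewrite /fF' addrC size_polyDl size_scale // size_polyXn //.
have F'0 : fF' != 0 by rewrite -size_poly_eq0 sF.
have [gG hG] := polyf_curve (proj1 fG) pc.
have [qQ hQ] := polyf_curve pQ pc.
have E : gG = qQ * fF' + r.
  by apply: horner_inj => t; rewrite hornerD hornerM -hG -hQ -hF -hr -/(c t); ring.
have : fF' %| gG.
  apply: locally_divides => // t.
  have [F' [Q' [pF' pQ' nz eq]]] := loc x Dx (t - x 0 i0).
  have [f1 hf1] := polyf_curve pF' pc; have [q1 hq1] := polyf_curve pQ' pc.
  exists f1, q1; split; first by rewrite -hf1.
  by apply: horner_inj => s; rewrite !hornerM -hf1 -hG -hq1 -hF.
rewrite E dvdp_addr ?dvdp_mulIr // => dv.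
have r0 : r = 0.
  apply/eqP/negPn/negP => rn0; by have := dvdp_leq rn0 dv; rewrite sF ltnNge sr.
by have := hr (x 0 i0); rewrite subrr scale0r addr0 r0 horner0.
Qed.

Lemma form_division (d e : nat) (F G D : 'rV[K]_3 -> K) (o : 'rV[K]_3) : isform (Posz d) F -> isform (Posz e) G ->
  o != 0 -> F o != 0 -> polyf D -> (exists x, D x != 0) ->
  (forall x, D x != 0 -> forall t, exists F' Q, [/\ polyf F', polyf Q,
     F' (x + t *: o) != 0 & forall z, F' z * G z = Q z * F z]) ->
  exists2 Q, polyf Q & forall x, G x = Q x * F x.
Proof.
move=> fF fG /frame_ex [g gu <-] Fo pD [x Dx] loc.
have [||||||Q pQ hQ] := @form_division_e0 d e (fun x => F (x *m g)) (fun x => G (x *m g))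
    (fun x => D (x *m g)).
- exact: isform_mulmx.
- exact: isform_mulmx.
- by [].
- exact: polyf_mulmx.
- by exists (x *m invmx g); rewrite mulmxKV.
- move=> y Dy t; have [F' [Q [pF' pQ nz eq]]] := loc _ Dy t.
  exists (fun z => F' (z *m g)), (fun z => Q (z *m g)); split=> //.
  + exact: polyf_mulmx.
  + exact: polyf_mulmx.
  + by rewrite mulmxDl -scalemxAl.
exists (fun x => Q (x *m invmx g)); first exact: polyf_mulmx.
by move=> y; have := hQ (y *m invmx g); rewrite mulmxKV.
Qed.

End Division.

(** * Lines as cross products, and extension across finitely many points *)

Section Cross.
Variable K : numClosedFieldType.
Implicit Types u v w x : 'rV[K]_3.

Definition crossp u v : 'rV[K]_3 := vec3 (u 0 i1 * v 0 i2 - u 0 i2 * v 0 i1)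
  (u 0 i2 * v 0 i0 - u 0 i0 * v 0 i2) (u 0 i0 * v 0 i1 - u 0 i1 * v 0 i0).

Definition dotp u v : K := \sum_j u 0 j * v 0 j.

Lemma cross_eq0 u v : v != 0 -> crossp u v = 0 -> exists c, u = c *: v.
Proof.
move=> /rV0Pn [k hk] /rowP h.
have := h i0; have := h i1; have := h i2; rewrite !mxE /=.
move=> /subr0_eq h2 /subr0_eq h1 /subr0_eq h0.
exists (u 0 k / v 0 k); apply: row3P; rewrite !mxE; apply: (mulIf hk); rewrite mulrAC divfK //;
  move: k {hk}; apply: I3_ind; by rewrite ?h0 ?h1 ?h2.
Qed.

Lemma dot_crossl u v : dotp u (crossp u v) = 0.
Proof. by rewrite /dotp sum3 !vec3E; ring. Qed.

Lemma dot_crossr u v : dotp v (crossp u v) = 0.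
Proof. by rewrite /dotp sum3 !vec3E; ring. Qed.

Lemma dot_cross_swap u v w : dotp u (crossp v w) = - dotp v (crossp u w).
Proof. by rewrite /dotp !sum3 !vec3E; ring. Qed.

Lemma dotpDl u v w : dotp (u + v) w = dotp u w + dotp v w.
Proof. by rewrite /dotp !sum3 !mxE; ring. Qed.

Lemma dotpZl c u w : dotp (c *: u) w = c * dotp u w.
Proof. by rewrite /dotp !sum3 !mxE; ring. Qed.

Lemma dotpC u w : dotp u w = dotp w u.
Proof. by rewrite /dotp !sum3; ring. Qed.

Lemma dotp0 u : dotp u 0 = 0.
Proof. by rewrite /dotp !sum3 !mxE; ring. Qed.

Lemma crosspDl u v w : crossp (u + v) w = crossp u w + crossp v w.
Proof. by apply: row3P; rewrite !mxE /=; ring. Qed.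

Lemma crosspZl c u w : crossp (c *: u) w = c *: crossp u w.
Proof. by apply: row3P; rewrite !mxE /=; ring. Qed.

Lemma crossp0l w : crossp 0 w = 0.
Proof. by apply: row3P; rewrite !mxE /=; ring. Qed.

Lemma crosspp u : crossp u u = 0.
Proof. by apply: row3P; rewrite !mxE /=; ring. Qed.

Lemma orth_cross l u v : dotp l u = 0 -> dotp l v = 0 -> crossp u v != 0 ->
  exists c, l = c *: crossp u v.
Proof.
rewrite /dotp !sum3 => h1 h2 h3; apply: cross_eq0 => //.
have E k : crossp l (crossp u v) 0 k =
    u 0 k * (l 0 i0 * v 0 i0 + l 0 i1 * v 0 i1 + l 0 i2 * v 0 i2) -
    v 0 k * (l 0 i0 * u 0 i0 + l 0 i1 * u 0 i1 + l 0 i2 * u 0 i2).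
  by move: k; apply: I3_ind; rewrite !mxE /=; ring.
by apply/rowP => k; rewrite E h1 h2 !mulr0 subr0 mxE.
Qed.

Variables (n : nat) (p : 'I_n -> 'rV[K]_3).
Hypothesis p0 : forall i, p i != 0.

Definition good x := forall i, crossp x (p i) != 0.

Lemma crossp_polyf v k : polyf (fun x => crossp x v 0 k).
Proof.
have h i c : polyf (fun x : 'rV[K]_3 => x 0 i * c).
  by apply: polyf_mul; [apply: polyf_coord|apply: polyf_const].
move: k; apply: I3_ind; [apply: polyf_ext (polyf_sub (h i1 (v 0 i2)) (h i2 (v 0 i1))) _
 |apply: polyf_ext (polyf_sub (h i2 (v 0 i0)) (h i0 (v 0 i2))) _
 |apply: polyf_ext (polyf_sub (h i0 (v 0 i1)) (h i1 (v 0 i0))) _];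
 by move=> x; rewrite /crossp !vec3E.
Qed.

Lemma crossp_neq0_ex v : v != 0 -> exists x k, crossp x v 0 k != 0.
Proof.
move=> v0; apply: contrapT => h.
have {}h x : crossp x v = 0.
  apply/rowP => k; rewrite [RHS]mxE; apply/eqP/negPn/negP => hk; apply: h; by exists x, k.
have /rV0Pn [k hk] := v0; case/eqP: hk.
have := h (vec3 1 0 0); have := h (vec3 0 1 0) => /rowP h1 /rowP h2.
have := h1 i2; have := h2 i1; have := h2 i2.
rewrite !mxE /= !(mul0r, mul1r, sub0r, subr0) => a1 /eqP; rewrite oppr_eq0 => /eqP a2 /eqP.
rewrite oppr_eq0 => /eqP a3; by move: k; apply: I3_ind.
Qed.

Lemma good_dense : exists2 h : 'rV[K]_3 -> K, polyf h &
  (exists x, h x != 0) /\ forall x, h x != 0 -> good x.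
Proof.
have /choice [k hk] : forall i, exists k, exists x, crossp x (p i) 0 k != 0.
  by move=> i; have [x [k h]] := crossp_neq0_ex (p0 i); exists k, x.
exists (fun x => \prod_i crossp x (p i) 0 (k i)).
  by apply: polyf_prod => i; apply: crossp_polyf.
split; first by apply: polyf_prod_neq0 => // i; apply: crossp_polyf.
move=> x; rewrite prodf_seq_neq0 => /allP h i.
have := h i (mem_index_enum _) => /= hi.
by apply: contraNneq hi => ->; rewrite mxE.
Qed.

Lemma polyf_common_neq0 (f f' : 'rV[K]_3 -> K) : polyf f -> polyf f' ->
  (exists x, f x != 0) -> (exists x, f' x != 0) ->
  exists x, f x != 0 /\ f' x != 0.
Proof.
move=> pf pf' nf [y hy]; apply: contrapT => H; case/eqP: hy.
apply: (polyf_dense0 pf pf' nf) => x fx.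
by apply/eqP/negPn/negP => f'x; apply: H; exists x.
Qed.

Lemma good_density f f' h : polyf f -> polyf f' -> polyf h -> (exists x, h x != 0) ->
  (forall x, good x -> x != 0 -> h x != 0 -> f x = f' x) -> f =1 f'.
Proof.
move=> pf pf' ph nh H; have [h' ph' [nh' gh']] := good_dense.
have pl : polyf (fun x : 'rV[K]_3 => x 0 i0) by exact: polyf_coord.
have [x [x1 x2]] := polyf_common_neq0 ph' ph nh' nh.
have n2 : exists x : 'rV[K]_3, x 0 i0 != 0 by exists (e0 K); rewrite mxE oner_eq0.
have [y [y1 y2]] := polyf_common_neq0 (polyf_mul ph' ph) pl
   (ex_intro _ x (mulf_neq0 x1 x2)) n2.
apply: (polyf_dense (polyf_mul (polyf_mul ph' ph) pl) pf pf').
  by exists y; apply: mulf_neq0.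
move=> z; rewrite !mulf_eq0 !negb_or => /andP[/andP[z1 z2] z3].
by apply: H => //; [apply: gh'|apply: contraNneq z3 => ->; rewrite mxE].
Qed.

(** The line through x and o can contain p_i only if det(x, o, p_i) = 0. A general line through a
    good [o] therefore misses all the points, so sections can be examined along it. *)
Lemma bad_lines o : good o -> exists2 D : 'rV[K]_3 -> K, polyf D &
  (exists x, D x != 0) /\ forall x, D x != 0 -> forall t, good (x + t *: o).
Proof.
move=> go; exists (fun x => \prod_i dotp x (crossp o (p i))).
  apply: polyf_prod => i; apply: polyf_sum => j.
  by apply: polyf_mul; [apply: polyf_coord|apply: polyf_const].
split.
  apply: polyf_prod_neq0 => i.
    apply: polyf_sum => j.
    by apply: polyf_mul; [apply: polyf_coord|apply: polyf_const].
  have /rV0Pn [k hk] := go i; exists (delta_mx 0 k).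
  rewrite /dotp (bigD1 k) //= big1 ?addr0; first by rewrite mxE !eqxx mul1r.
  by move=> j jk; rewrite mxE eqxx (negbTE jk) mul0r.
move=> x; rewrite prodf_seq_neq0 => /allP h t i.
have := h i (mem_index_enum _) => /= hi; apply: contra_neq hi => E.
have := dot_cross_swap (x + t *: o) o (p i).
by rewrite E dotp0 oppr0 dotpDl dotpZl dot_crossl mulr0 addr0.
Qed.

Lemma good_exists : exists x, good x /\ x != 0.
Proof.
apply: contrapT => H; case/eqP: (oner_neq0 K).
suff /(_ 0) : (fun=> 1 : K) =1 (fun _ : 'rV[K]_3 => 0) by [].
apply: (@good_density _ _ (fun=> 1)); try exact: polyf_const.
  by exists 0; apply: oner_neq0.
by move=> x gx x0; case: H; exists x.
Qed.

(* Hartogs: a function on the complement of finitely many points that is locally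
   a quotient of forms is a polynomial. *)
Lemma quotient_form (f : 'rV[K]_3 -> K) :
  (forall x0, good x0 -> x0 != 0 -> exists (d e : nat) (g h : 'rV[K]_3 -> K),
     [/\ isform (Posz d) g, isform (Posz e) h, h x0 != 0 &
         forall x, good x -> x != 0 -> h x * f x = g x]) ->
  exists2 Q, polyf Q & forall x, good x -> x != 0 -> f x = Q x.
Proof.
move=> loc; have [o [go o0]] := good_exists.
have [d [e [g [h [fg fh ho hE]]]]] := loc o go o0.
have nh : exists x, h x != 0 by exists o.
(* [o] is a centre of projection: [D] selects lines through it that miss all p_i, and the cross
   product with [o] excludes x proportional to [o], so that x + t o is never 0. *)
have [D pD [nD hD]] := bad_lines go.
have [w [k hwk]] := crossp_neq0_ex o0.
have pC := crossp_polyf o k.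
have nC : exists x, crossp x o 0 k != 0 by exists w.
have [y [y1 y2]] := polyf_common_neq0 pD pC nD nC.
have compat x : good x -> x != 0 -> exists F' Q, [/\ polyf F', polyf Q,
    F' x != 0, forall z, good z -> z != 0 -> F' z * f z = Q z &
    forall z, F' z * g z = Q z * h z].
  move=> gx x0; have [d' [e' [g' [h' [fg' fh' ho' hE']]]]] := loc x gx x0.
  exists h', g'; split=> //; [exact: (proj1 fh')|exact: (proj1 fg')|].
  apply: (@good_density _ _ (fun=> 1)).
  - by apply: polyf_mul; [case: fh'|case: fg].
  - by apply: polyf_mul; [case: fg'|case: fh].
  - exact: polyf_const.
  - by exists 0; apply: oner_neq0.
  by move=> z gz z0 _; rewrite -hE // -hE' // mulrA mulrAC [h' z * _]mulrC; ring.
have [||Q pQ hQ] := form_division fh fg o0 ho (polyf_mul pD pC).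
- by exists y; apply: mulf_neq0.
- move=> x; rewrite mulf_eq0 negb_or => /andP[Dx Cx] t.
  have xt0 : x + t *: o != 0.
    apply: contraNneq Cx => E.
    have := congr1 (fun z => crossp z o) E.
    rewrite /= crosspDl crosspZl crosspp scaler0 addr0 => ->.
    by rewrite crossp0l mxE.
  by have [F' [Q [pF' pQ nz _ hz]]] := compat _ (hD x Dx t) xt0; exists F', Q.
exists Q => // x gx x0; have [F' [Q' [pF' pQ' nz hf hz]]] := compat x gx x0.
apply: (mulfI nz); rewrite hf //.
have E : (fun z => F' z * Q z) =1 Q'.
  apply: (polyf_dense (proj1 fh)) => //; first exact: polyf_mul.
  by move=> z hz0; apply: (mulIf hz0); rewrite -mulrA -hQ hz.
by rewrite -E.
Qed.

End Cross.

(** * Regular sections as local quotients of multihomogeneous functions *)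

Section MultihomogeneousFunctions.
Variables (R : realType) (m : nat).
Local Notation C := (R[i] : numClosedFieldType).
Local Notation pointT := 'M[R[i]]_(m, 3).

Definition mhf (d : 'I_m -> nat) (f : pointT -> R[i]) :=
  exists2 F : {mpoly R[i][m * 3]}, multihomog d F & forall P, mev F P = f P.

Lemma mhf_ext d d' f f' : mhf d f -> d =1 d' -> f =1 f' -> mhf d' f'.
Proof. by move=> h /funext <- /funext <-. Qed.

Lemma mhf_const c : mhf (fun=> 0%N) (fun=> c).
Proof.
exists c%:MP => [mu|P]; last by rewrite /mev mevalC.
rewrite msuppC; case: eqP => // _; rewrite inE => /eqP -> i.
by rewrite big1 // => j _; rewrite mnm0E.
Qed.

Lemma mhf0 d : mhf d (fun=> 0).
Proof. by exists 0 => [mu|P]; rewrite ?msupp0 // /mev meval0. Qed.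

Lemma mhf_coord i j : mhf (fun k => nat_of_bool (k == i)) (fun P => P i j).
Proof.
exists 'X_(mxvec_index i j) => [mu|P]; last by rewrite /mev mevalXU mxvecE.
rewrite msuppX inE => /eqP -> k; under eq_bigr => j' _ do rewrite mnm1E.
have E j' : (mxvec_index i j == mxvec_index k j') = (k == i) && (j' == j).
  apply/eqP/andP => [/(congr1 (fun q => vec_mx (delta_mx 0 q) : 'M[nat]_(m, 3)))|[/eqP -> /eqP ->]//].
  rewrite !vec_mx_delta => /matrixP /(_ k j'); rewrite !mxE !eqxx.
  by case: eqP => // _; case: eqP.
under eq_bigr => j' _ do rewrite E.
case: eqP => _ /=; last by rewrite big1.
by rewrite (bigD1 j) //= eqxx big1 // => j' /negbTE ->.
Qed.

Lemma mhf_add d f f' : mhf d f -> mhf d f' -> mhf d (fun P => f P + f' P).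
Proof.
move=> [F hF fE] [F' hF' fE']; exists (F + F') => [mu|P].
  by move=> /msuppD_le; rewrite mem_cat => /orP[]; [apply: hF|apply: hF'].
by rewrite /mev mevalD -fE -fE'.
Qed.

Lemma mhf_mul d d' f f' : mhf d f -> mhf d' f' ->
  mhf (fun i => d i + d' i)%N (fun P => f P * f' P).
Proof.
move=> [F hF fE] [F' hF' fE']; exists (F * F') => [mu|P].
  move=> /msuppM_le /allpairsP [[m1 m2] /= [/hF h1 /hF' h2 ->]] i.
  by under eq_bigr => j _ do rewrite mnmDE; rewrite big_split /= h1 h2.
by rewrite /mev mevalM -fE -fE'.
Qed.

Lemma mhf_scale d c f : mhf d f -> mhf d (fun P => c * f P).
Proof. by move=> h; apply: mhf_ext (mhf_mul (mhf_const c) h) _ _. Qed.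

Lemma mhf_sum d I (r : seq I) (F : I -> pointT -> R[i]) :
  (forall i, mhf d (F i)) -> mhf d (fun P => \sum_(i <- r) F i P).
Proof.
move=> pF; elim: r => [|i r IH].
  by apply: mhf_ext (mhf0 d) _ _ => // x; rewrite big_nil.
by apply: mhf_ext (mhf_add (pF i) IH) _ _ => // x; rewrite big_cons.
Qed.

Lemma mhf_prod I (r : seq I) (q : pred I) (d : I -> 'I_m -> nat) (F : I -> pointT -> R[i]) :
  (forall i, mhf (d i) (F i)) ->
  mhf (fun k => \sum_(i <- r | q i) d i k)%N (fun P => \prod_(i <- r | q i) F i P).
Proof.
move=> pF; elim: r => [|i r IH].
  by apply: mhf_ext (mhf_const 1) _ _ => x; rewrite big_nil.
case h: (q i); last by apply: mhf_ext IH _ _ => x; rewrite big_cons h.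
by apply: mhf_ext (mhf_mul (pF i) IH) _ _ => x; rewrite big_cons h.
Qed.

Lemma mhf_exp d f k : mhf d f -> mhf (fun i => d i * k)%N (fun P => f P ^+ k).
Proof.
move=> h; elim: k => [|k IH]; first by apply: mhf_ext (mhf_const 1) _ _ => // i; rewrite muln0.
by apply: mhf_ext (mhf_mul h IH) _ _ => [i|P]; rewrite ?mulnS ?exprS.
Qed.

Lemma mhf_form (a : nat) (f : 'rV[R[i]]_3 -> R[i]) r : isform (Posz a) f ->
  mhf (fun k => (k == r) * a)%N (fun P => f (row r P)).
Proof.
move=> /isform_ev [c hc]; apply: (@mhf_ext (fun k => (k == r) * a)%N _
  (fun P => ev a c (row r P))) => //; last first.
apply: mhf_sum => k; apply: mhf_sum => l; apply: mhf_scale.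
have h1 j := mhf_coord r j.
apply: mhf_ext (mhf_mul (mhf_mul (mhf_exp (a - k) (h1 i0)) (mhf_exp l (h1 i1)))
  (mhf_exp (k - l) (h1 i2))) _ _ => [i|P]; last by rewrite /mono !mxE.
by have := ltn_ord l; have := ltn_ord k; case: (i == r) => /=; lia.
Qed.

Lemma mev_scale d F (c : 'I_m -> R[i]) (P Q : pointT) : multihomog d F ->
  (forall i, row i Q = c i *: row i P) -> mev F Q = \prod_i c i ^+ d i * mev F P.
Proof.
move=> hF hQ; rewrite /mev !mevalE big_distrr /= big_seq [RHS]big_seq.
apply: eq_bigr => mu /hF hmu; rewrite mulrCA; congr (_ * _).
have E (M : pointT) : \prod_(k < m * 3) mxvec M 0 k ^+ mu k =
    \prod_i \prod_j M i j ^+ mu (mxvec_index i j).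
  rewrite pair_big (reindex _ (curry_mxvec_bij m 3)) /=.
  by apply: eq_bigr => [[i j] _] /=; rewrite mxvecE.
rewrite !E -big_split; apply: eq_bigr => i _ /=.
rewrite -hmu -prodrXr -big_split; apply: eq_bigr => j _ /=.
by have /rowP /(_ j) := hQ i; rewrite !mxE => ->; rewrite exprMn.
Qed.

Lemma mev_polyf n F (M : 'rV[R[i]]_n -> pointT) :
  (forall i j, polyf (fun x => M x i j)) -> polyf (fun x => mev F (M x)).
Proof.
move=> h; apply: (polyf_comp (h := fun x => mxvec (M x)) (polyf_meval F)) => k.
have [i j] := mxvec_indexP k; apply: polyf_ext (h i j) _ => x.
by rewrite mxvecE.
Qed.

Lemma mev_curve F (M : R[i] -> pointT) :
  (forall i j, exists q : {poly R[i]}, forall t, M t i j = q.[t]) ->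
  exists q : {poly R[i]}, forall t, mev F (M t) = q.[t].
Proof.
move=> h; apply: (polyf_curve (c := fun t => mxvec (M t)) (polyf_meval F)) => k.
have [i j] := mxvec_indexP k; have [q hq] := h i j; exists q => t.
by rewrite mxvecE.
Qed.

Variable X : set pointT.
Hypothesis Xpt : X `<=` [set P | is_point P].

Lemma zopen_basic V P : zopen_in X V -> V P ->
  exists2 A, (exists d, multihomog d A) &
    mev A P != 0 /\ forall Q, X Q -> mev A Q != 0 -> V Q.
Proof.
move=> [Z [S [hS ->]] ->] [XP /= nZ].
have [A [SA AP]] : exists A, S A /\ mev A P != 0.
  apply: contrapT => H; apply: nZ; split; first exact: Xpt.
  move=> F SF; apply/eqP/negPn/negP => FP; apply: H; by exists F.
exists A; first exact: hS.
by split=> // Q XQ AQ; split=> // -[_ /(_ _ SA) /eqP]; apply/negP.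
Qed.

Lemma zopen_union (S : set (pointT -> R[i])) :
  (forall f, S f -> exists d, mhf d f) ->
  zopen_in X [set P | X P /\ exists2 f, S f & f P != 0].
Proof.
move=> hS; pose A := [set F : {mpoly R[i][m * 3]} | (exists d, multihomog d F) /\
  exists2 f, S f & forall P, mev F P = f P].
exists [set P | is_point P /\ forall F, A F -> mev F P = 0].
  by exists A; split=> // F [].
apply/seteqP; split=> P [XP] => [[f Sf fP]|nZ]; split=> //.
  move=> [_ h]; have [d [F hF fE]] := hS f Sf.
  by case/eqP: fP; rewrite -fE; apply: h; split; [exists d|exists f].
apply: contrapT => H; apply: nZ; split; first exact: Xpt.
move=> F [_ [f Sf fE]]; apply/eqP/negPn/negP => FP; apply: H.
by exists f => //; rewrite -fE.
Qed.

(** Numerator and denominator are multiplied by a form [A], nonzero at [P] and zero on X outside the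
    neighbourhood. The identity F s = G then holds on all of X, both sides being 0 where [A] is. *)
Lemma section_local (k : 'I_m -> int) U s P : regular_section X k U s -> U P ->
  exists G F dG dF, [/\ multihomog dG G, multihomog dF F,
    forall i, (dG i)%:Z - (dF i)%:Z = k i, mev F P != 0 &
    forall Q, X Q -> mev F Q * s Q = mev G Q /\ (mev F Q != 0 -> U Q)].
Proof.
move=> /[apply] [[V [G [F [dG [dF [oV VP VU [hG hF hd] hV]]]]]]].
have [A [dA hA] [AP AV]] := zopen_basic oV VP.
have M d d' (F1 F2 : {mpoly R[i][m * 3]}) : multihomog d F1 -> multihomog d' F2 ->
    multihomog (fun i => d i + d' i)%N (F1 * F2).
  move=> h1 h2 mu /msuppM_le /allpairsP [[m1 m2] /= [/h1 h3 /h2 h4 ->]] i.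
  by under eq_bigr => j _ do rewrite mnmDE; rewrite big_split /= h3 h4.
exists (G * A), (F * A), (fun i => dG i + dA i)%N, (fun i => dF i + dA i)%N.
split; [exact: M|exact: M|by move=> i; rewrite -hd !PoszD; ring| |].
  by rewrite /mev mevalM mulf_neq0 //; case: (hV _ VP).
move=> Q XQ; rewrite /mev !mevalM -/(mev G Q) -/(mev F Q) -/(mev A Q).
have [->|AQ] := eqVneq (mev A Q) 0; first by rewrite !mulr0 mul0r eqxx.
have VQ := AV Q XQ AQ; have [FQ ->] := hV Q VQ.
by split=> [|_]; [rewrite mulrAC [mev F Q * _]mulrC divfK|apply: VU].
Qed.

Lemma regular_of_local (k : 'I_m -> int) U s : zopen_in X U ->
  (forall P, U P -> exists G F dG dF, [/\ mhf dG G, mhf dF F,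
     forall i, (dG i)%:Z - (dF i)%:Z = k i, F P != 0 &
     forall Q, U Q -> F Q != 0 -> s Q = G Q / F Q]) ->
  regular_section X k U s.
Proof.
move=> oU h P UP; have [G [F [dG [dF [[G' hG GE] [F' hF FE] hd FP hs]]]]] := h P UP.
have [A [dA hA] [AP AU]] := zopen_basic oU UP.
have XP : X P by case: oU UP => Z _ -> [].
have hAF : mhf (fun i => dA i + dF i)%N (fun Q => mev A Q * F Q).
  by apply: mhf_mul; [exists A|exists F'].
exists [set Q | X Q /\ exists2 f, [set fun Q => mev A Q * F Q] f & f Q != 0].
exists G', F', dG, dF; split.
- by apply: zopen_union => f ->; exists (fun i => dA i + dF i)%N.
- by split=> //; exists (fun Q => mev A Q * F Q) => //; apply: mulf_neq0.
- by move=> Q [XQ [f -> ]]; rewrite mulf_eq0 negb_or => /andP[AQ _]; apply: AU.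
- by split.
move=> Q [XQ [f -> ]]; rewrite mulf_eq0 negb_or => /andP[AQ FQ].
by rewrite FE GE; split=> //; apply: hs => //; apply: AU.
Qed.

End MultihomogeneousFunctions.

(** * Sections on the blow-up as plane forms *)

Section BlowUpSections.
Variables (R : realType) (n : nat) (p : 'M[R[i]]_(n, 3)).
Local Notation K := (R[i] : numClosedFieldType).
Local Notation pp i := (row i p).
Local Notation X := (blowup p).
Implicit Types (x v : 'rV[R[i]]_3) (P : 'M[R[i]]_(n.+1, 3)).

Hypothesis p0 : forall i, pp i != 0.

Local Notation goodx := (good (fun i : 'I_n => pp i)).

Definition mkpt x (l : 'I_n -> 'rV[R[i]]_3) : 'M[R[i]]_(n.+1, 3) :=
  \matrix_(k, j) if unlift ord0 k is Some i then l i 0 j else x 0 j.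

Lemma mkpt0 x l : row ord0 (mkpt x l) = x.
Proof. by apply/rowP => j; rewrite !mxE unlift_none. Qed.

Lemma mkptS x l i : row (lift ord0 i) (mkpt x l) = l i.
Proof. by apply/rowP => j; rewrite !mxE liftK. Qed.

Lemma mkpt_eta P : P = mkpt (row ord0 P) (fun i => row (lift ord0 i) P).
Proof.
by apply/matrixP => k j; rewrite !mxE; case: unliftP => [i ->|->]; rewrite ?mxE.
Qed.

Lemma blowupE P : X P <-> [/\ row ord0 P != 0, forall i, row (lift ord0 i) P != 0 &
  forall i, dotp (row (lift ord0 i) P) (pp i) = 0 /\
            dotp (row (lift ord0 i) P) (row ord0 P) = 0].
Proof.
have E (i : 'I_n) : dotp (row (lift ord0 i) P) (pp i) = \sum_(j < 3) P (lift ord0 i) j * p i j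
   /\ dotp (row (lift ord0 i) P) (row ord0 P) = \sum_(j < 3) P (lift ord0 i) j * P ord0 j.
  by split; rewrite /dotp; apply: eq_bigr => j _; rewrite [row _ _ _ _]mxE [X in _ * X]mxE.
split=> [[h1 h2]|[h1 h2 h3]].
  by split=> // i; have [e1 e2] := E i; rewrite e1 e2; apply: h2.
split=> [k|i]; last by have [<- <-] := E i; apply: h3.
by case: (unliftP ord0 k) => [i ->|->].
Qed.

Lemma blowup_mkpt x l : X (mkpt x l) <-> [/\ x != 0, forall i, l i != 0 &
  forall i, dotp (l i) (pp i) = 0 /\ dotp (l i) x = 0].
Proof.
rewrite blowupE mkpt0; split=> [] [h1 h2 h3]; split=> // i.
- by rewrite -(mkptS x l).
- by rewrite -(mkptS x l); apply: h3.
- by rewrite mkptS.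
- by rewrite mkptS; apply: h3.
Qed.

Lemma Xpt : X `<=` [set P | is_point P].
Proof. by move=> P []. Qed.

(** Over a good x the line l_i must be a multiple of x × p_i; [c] records the representatives. *)
Definition gpt x (c : 'I_n -> R[i]) := mkpt x (fun i => c i *: crossp x (pp i)).

Lemma blowup_gpt x c : goodx x -> x != 0 -> (forall i, c i != 0) -> X (gpt x c).
Proof.
move=> gx x0 c0; apply/blowup_mkpt; split=> // i.
  by rewrite scaler_eq0 (negbTE (c0 i)) (negbTE (gx i)).
rewrite !dotpZl; split.
  by rewrite dotpC dot_crossr mulr0.
by rewrite dotpC dot_crossl mulr0.
Qed.

Lemma gptP P : X P -> goodx (row ord0 P) ->
  exists2 c, (forall i, c i != 0) & P = gpt (row ord0 P) c.
Proof.
move=> /blowupE [h1 h2 h3] gx.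
have /choice [c hc] : forall i, exists c, row (lift ord0 i) P = c *: crossp (row ord0 P) (pp i).
  by move=> i; have [a b] := h3 i; apply: orth_cross.
exists c => [i|]; last by rewrite [LHS]mkpt_eta; congr mkpt; apply/funext.
by apply: contraNneq (h2 i) => ci; rewrite hc ci scale0r.
Qed.

Definition goodset (S : pred 'I_n) : set 'M[R[i]]_(n.+1, 3) :=
  [set P | X P /\ forall i, S i -> crossp (row ord0 P) (pp i) != 0].

Lemma mhf_cross i k :
  mhf (fun k => nat_of_bool (k == ord0)) (fun P => crossp (row ord0 P) (pp i) 0 k).
Proof.
have h : isform (Posz 1) (fun x => crossp x (pp i) 0 k).
  split; first exact: crossp_polyf.
  by move=> t x _; rewrite crosspZl mxE expr1z.
by apply: mhf_ext (mhf_form ord0 h) _ _ => // l; rewrite muln1.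
Qed.

Lemma goodset_open S : zopen_in X (goodset S).
Proof.
have -> : goodset S = [set P | X P /\ exists2 f,
   [set f | exists kk : 'I_n -> 'I_3, f = fun P =>
      \prod_(i | S i) crossp (row ord0 P) (pp i) 0 (kk i)] f & f P != 0].
  apply/seteqP; split=> P [XP].
    move=> h; split=> //.
    have /choice [kk hk] : forall i, exists k, S i -> crossp (row ord0 P) (pp i) 0 k != 0.
      move=> i; case Si: (S i); last by exists i0.
      by have /rV0Pn [k hk] := h i Si; exists k.
    exists (fun P => \prod_(i | S i) crossp (row ord0 P) (pp i) 0 (kk i)); first by exists kk.
    by apply/prodf_neq0 => i Si; apply: hk.
  move=> [f [kk ->] /prodf_neq0 h]; split=> // i Si.
  by have := h i Si; apply: contraNneq => ->; rewrite mxE.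
apply: zopen_union; first exact: Xpt.
move=> f [kk ->]; exists (fun k => \sum_(i | S i) (k == ord0))%N.
by apply: mhf_prod => i; apply: mhf_cross.
Qed.

Lemma section_scale (k : 'I_n.+1 -> int) U s P Q (c : 'I_n.+1 -> R[i]) :
  regular_section X k U s -> U P -> X Q -> (forall i, c i != 0) ->
  (forall i, row i Q = c i *: row i P) -> s Q = \prod_i c i ^ k i * s P.
Proof.
move=> hs UP XQ c0 hQ.
have XP : X P by case: (hs P UP) => V [G [F [dG [dF [[Z _ -> [XP _]]]]]]].
have [G [F [dG [dF [hG hF hd FP loc]]]]] := section_local Xpt hs UP.
have FQ := mev_scale hF hQ; have GQ := mev_scale hG hQ.
have pF0 : \prod_i c i ^+ dF i != 0 by apply/prodf_neq0 => i _; rewrite expf_neq0.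
have FQ0 : mev F Q != 0 by rewrite FQ mulf_neq0.
apply: (mulfI FQ0); have [-> _] := loc Q XQ.
rewrite GQ FQ; have [<- _] := loc P XP.
rewrite !mulrA; congr (_ * _).
rewrite mulrAC -big_split; congr (_ * _) => /=.
by apply: eq_bigr => i _; rewrite -hd -[c i ^+ dF i]/(c i ^ dF i) -expfzDr // addrC subrK.
Qed.

Section Class.
Variable D : divclass n.
Local Notation a := D.1.
Local Notation b i := (tnth D.2 i).

Lemma divdeg0 : divdeg D ord0 = a - \sum_(i < n) b i.
Proof. by rewrite /divdeg unlift_none. Qed.

Lemma divdegS i : divdeg D (lift ord0 i) = b i.
Proof. by rewrite /divdeg liftK. Qed.

(** O(D) has degree b_i in l_i, so rescaling l_i by c_i contributes c_i^(b_i); what remains is the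
    plane form of [s]. *)
Definition represents (s : 'M[R[i]]_(n.+1, 3) -> R[i]) (f : 'rV[R[i]]_3 -> R[i]) :=
  forall x c, goodx x -> x != 0 -> (forall i, c i != 0) ->
    s (gpt x c) = f x * \prod_(i < n) c i ^ b i.

(** Rescaling x by t rescales every row of [pt x] by t, since x × p_i is linear in x. The total
    weight is (a - sum b_i) + sum b_i = a, and polynomiality comes from [quotient_form]. *)
Lemma section_form U s : regular_section X (divdeg D) U s -> goodset predT `<=` U ->
  exists2 f, isform a f & represents s f.
Proof.
move=> hs hU; pose pt x := gpt x (fun=> 1).
have Xpt' x : goodx x -> x != 0 -> X (pt x).
  by move=> gx x0; apply: blowup_gpt => // i; apply: oner_neq0.
have Upt x : goodx x -> x != 0 -> U (pt x).
  move=> gx x0; apply: hU; split; first exact: Xpt'.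
  by move=> i _; rewrite mkpt0.
have pe i j : polyf (fun x => pt x i j).
  case: (unliftP ord0 i) => [i' ->|->].
    apply: polyf_ext (crossp_polyf (pp i') j) _ => x.
    by rewrite [RHS]mxE liftK scale1r.
  by apply: polyf_ext (polyf_coord _ j) _ => x; rewrite [RHS]mxE unlift_none.
have ptZ t x i : row i (pt (t *: x)) = t *: row i (pt x).
  case: (unliftP ord0 i) => [i' ->|->]; last by rewrite !mkpt0.
  by rewrite !mkptS !scale1r crosspZl.
have fpt d F : multihomog d F -> isform (Posz (\sum_i d i)) (fun x => mev F (pt x)).
  move=> hF; split; first exact: mev_polyf.
  by move=> t x t0; rewrite (mev_scale hF (ptZ t x)) prodrXr.
have goodZ t x : t != 0 -> goodx x -> goodx (t *: x).
  by move=> t0 gx i; rewrite crosspZl scaler_eq0 (negbTE t0) (negbTE (gx i)).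
have [|f pf hf] := @quotient_form K n (fun i => pp i) p0 (fun x => s (pt x)).
  move=> x0 gx0 nx0.
  have [G [F [dG [dF [hG hF hd FP loc]]]]] := section_local Xpt hs (Upt _ gx0 nx0).
  exists (\sum_i dG i)%N, (\sum_i dF i)%N, (fun x => mev G (pt x)), (fun x => mev F (pt x)).
  split=> //; [exact: fpt|exact: fpt|].
  by move=> x gx nx; case: (loc _ (Xpt' _ gx nx)).
have prodZ (t : R[i]) : t != 0 -> \prod_(i < n.+1) t ^ divdeg D i = t ^ a.
  move=> t0; rewrite big_ord_recl divdeg0 (eq_bigr (fun i : 'I_n => t ^ b i)); last first.
    by move=> i _; rewrite divdegS.
  have -> : \prod_(i < n) t ^ b i = t ^ (\sum_(i < n) b i).
    by rewrite (big_morph _ (fun u w : int => expfzDr u w t0) (expr0z t)).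
  by rewrite -expfzDr // subrK.
exists f.
  split=> // t x t0; move: x.
  apply: (@good_density K n (fun i => pp i) p0 _ _ (fun=> 1)).
  - apply: (polyf_comp (h := fun x => t *: x) pf) => i.
    by apply: polyf_ext (polyf_scale t (polyf_coord _ i)) _ => x; rewrite mxE.
  - exact: polyf_scale.
  - exact: polyf_const.
  - by exists 0; apply: oner_neq0.
  move=> x gx x0 _; have tx0 : t *: x != 0 by rewrite scaler_eq0 (negbTE t0).
  rewrite -!hf //; last exact: goodZ.
  rewrite (@section_scale _ _ _ (pt x) (pt (t *: x)) (fun=> t) hs) ?prodZ //.
  - exact: Upt.
  - by apply: Xpt' => //; apply: goodZ.
move=> x c gx x0 c0; rewrite -hf //.
rewrite (@section_scale _ _ _ (pt x) (gpt x c)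
   (fun k => if unlift ord0 k is Some i then c i else 1) hs).
- rewrite mulrC big_ord_recl unlift_none exp1rz mul1r; congr (_ * _).
  by apply: eq_bigr => i _; rewrite liftK divdegS.
- exact: Upt.
- exact: blowup_gpt.
- by move=> i; case: unliftP => [i' _|_]; rewrite ?oner_neq0.
- move=> i; case: (unliftP ord0 i) => [i' ->|->].
    by rewrite !mkptS scale1r.
  by rewrite !mkpt0 scale1r.
Qed.

Lemma represents_uniq s f f' : polyf f -> polyf f' ->
  represents s f -> represents s f' -> f =1 f'.
Proof.
move=> pf pf' h h'; apply: (@good_density K n (fun i => pp i) p0 _ _ (fun=> 1)) => //.
- exact: polyf_const.
- by exists 0; apply: oner_neq0.
move=> x gx x0 _; have c0 (i : 'I_n) : (1 : R[i]) != 0 by apply: oner_neq0.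
have := h x _ gx x0 c0; rewrite (h' x _ gx x0 c0) big1 ?mulr1 // => i _.
by rewrite exp1rz.
Qed.

Hypothesis pdist : forall i j, i != j -> crossp (pp j) (pp i) != 0.

(* The curve of points p_j + t v; at t = 0 it meets the exceptional curve of p_j. *)
Definition excurve j v t := mkpt (pp j + t *: v)
  (fun i => if i == j then crossp v (pp j) else crossp (pp j + t *: v) (pp i)).

Lemma excurve_poly j v i k : exists q : {poly R[i]}, forall t, excurve j v t i k = q.[t].
Proof.
have hc : polycurve (fun t : K => pp j + t *: v) by exact: polycurve_line.
case: (unliftP ord0 i) => [i' ->|->]; last first.
  have [q hq] := hc k; exists q => t; rewrite -hq.
  by rewrite [LHS]mxE unlift_none.
have [E|ne] := eqVneq i' j.
  by exists (crossp v (pp j) 0 k)%:P => t; rewrite hornerC [LHS]mxE liftK E eqxx.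
have [q hq] := polyf_curve (crossp_polyf (pp i') k) hc.
by exists q => t; rewrite -hq [LHS]mxE liftK (negbTE ne).
Qed.

(** Since (p_j + t v) × p_j = t (v × p_j), the curve uses c_j = 1/t. This is how t^(-b_j) enters the
    section while the curve still extends to t = 0. *)
Lemma excurve_gpt j v t : t != 0 ->
  excurve j v t = gpt (pp j + t *: v) (fun i => if i == j then t^-1 else 1).
Proof.
move=> t0; congr mkpt; apply/funext => i; case: (eqVneq i j) => [->|_].
  by rewrite crosspDl crosspp add0r crosspZl scalerA mulVf // scale1r.
by rewrite scale1r.
Qed.

Lemma excurve0_in j v : crossp v (pp j) != 0 -> X (excurve j v 0).
Proof.
move=> hv; apply/blowup_mkpt; rewrite scale0r addr0; split=> // i.
  by case: (eqVneq i j) => [_|ij] //; apply: pdist.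
have [->|ij] := eqVneq i j.
  by split; rewrite dotpC dot_crossr.
by rewrite dotpC dot_crossr dotpC dot_crossl.
Qed.

Lemma excurve_good j v : crossp v (pp j) != 0 -> exists2 w : {poly R[i]}, w.[0] != 0 &
  forall t, t != 0 -> w.[t] != 0 -> goodx (pp j + t *: v) /\ pp j + t *: v != 0.
Proof.
move=> hv; have hc : polycurve (fun t : K => pp j + t *: v) by exact: polycurve_line.
have /choice [w hw] : forall i, exists w : {poly R[i]}, w.[0] != 0 /\
    forall t, t != 0 -> w.[t] != 0 -> crossp (pp j + t *: v) (pp i) != 0.
  move=> i; have [->|ij] := eqVneq i j.
    exists 1; split=> [|t t0 _]; first by rewrite hornerC oner_neq0.
    by rewrite crosspDl crosspp add0r crosspZl scaler_eq0 (negbTE t0).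
  have /rV0Pn [k hk] := pdist ij.
  have [q hq] := polyf_curve (crossp_polyf (pp i) k) hc.
  exists q; split=> [|t _]; first by rewrite -hq scale0r addr0.
  by rewrite -hq; apply: contraNneq => ->; rewrite mxE.
have /rV0Pn [k hk] := p0 j; have [q hq] := hc k.
exists (q * \prod_i w i).
  rewrite hornerM mulf_neq0 //; first by rewrite -hq scale0r addr0.
  by rewrite horner_prod; apply/prodf_neq0 => i _; case: (hw i).
move=> t t0; rewrite hornerM mulf_eq0 negb_or => /andP[q0].
rewrite horner_prod => /prodf_neq0 h; split=> [i|].
  by have [_ h2] := hw i; apply: h2 => //; apply: h.
by apply: contraNneq q0 => E; rewrite -hq E mxE.
Qed.

(** On the curve [s] is t^(-b_j) f(p_j + t v) for general t, and also a quotient G / F with F(0)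
    nonzero; comparing the two relates the order of [f] at p_j to b_j. *)
Lemma section_near U s f j v : regular_section X (divdeg D) U s -> represents s f ->
  crossp v (pp j) != 0 -> U (excurve j v 0) ->
  exists F G : {poly R[i]}, [/\ F.[0] != 0, F.[0] * s (excurve j v 0) = G.[0] &
    forall t, t != 0 -> F.[t] * f (pp j + t *: v) = t ^ b j * G.[t]].
Proof.
move=> hs hf hv hU.
have [G [F [dG [dF [_ _ _ FP loc]]]]] := section_local Xpt hs hU.
have [qF hqF] := mev_curve F (excurve_poly j v).
have [qG hqG] := mev_curve G (excurve_poly j v).
have [w w0 hw] := excurve_good hv.
exists (w * qF), (w * qG); rewrite !hornerM; split.
- by rewrite mulf_neq0 // -hqF.
- rewrite -mulrA -hqF -hqG; congr (_ * _).
  by case: (loc _ (excurve0_in hv)).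
move=> t t0; rewrite !hornerM.
have [->|wt] := eqVneq w.[t] 0; first by rewrite !mul0r mulr0.
have [gx x0] := hw t t0 wt.
have c0 i : (if i == j then t^-1 else 1 : R[i]) != 0.
  by case: (i == j); rewrite ?invr_eq0 ?t0 ?oner_neq0.
have S : s (excurve j v t) = f (pp j + t *: v) * t ^ (- b j).
  rewrite excurve_gpt // hf // (bigD1 j) //= eqxx big1 ?mulr1 ?exprz_inv // => i /negbTE ->.
  by rewrite exp1rz.
have := blowup_gpt gx x0 c0; rewrite -excurve_gpt // => /loc [E _].
rewrite -hqG -E hqF S.
have tt : t ^ b j * t ^ (- b j) = 1 by rewrite -expfzDr // subrr.
move: (t ^ b j) (t ^ - b j) (f _) tt => A B z tt.
have -> : A * (w.[t] * (qF.[t] * (z * B))) = (A * B) * (w.[t] * qF.[t] * z) by ring.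
by rewrite tt mul1r.
Qed.

Lemma section_mult_ge U s f j (m : nat) : regular_section X (divdeg D) U s ->
  isform a f -> represents s f -> b j = Posz m ->
  (forall v, crossp v (pp j) != 0 -> U (excurve j v 0)) -> mult_ge f (pp j) m.
Proof.
move=> hs [pf hhf] hf bm hU.
have gen v : crossp v (pp j) != 0 ->
    exists q : {poly R[i]}, forall t, f (pp j + t *: v) = t ^+ m * q.[t].
  move=> hv; have [F [G [F0 _ E]]] := section_near hs hf hv (hU v hv).
  have [qf hqf] := polyf_curve pf (polycurve_line (pp j) v).
  have E2 : F * qf = 'X^m * G.
    by apply: horner_inj_nz => t t0; rewrite !hornerM hornerXn -hqf E // bm.
  have : 'X^m %| qf.
    have cop : coprimep 'X^m F.
      apply: coprimep_expl; have -> : 'X = 'X - 0%:P :> {poly R[i]} by rewrite polyC0 subr0.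
      by rewrite coprimep_sym coprimep_XsubC.
    by rewrite -(Gauss_dvdpr _ cop) E2 dvdp_mulIl.
  move=> /dvdpP [q hq]; exists q => t.
  by rewrite hqf hq hornerM hornerXn mulrC.
(* [excurve] does not cover the direction of p_j itself. For m > 0 another direction gives f(p_j) =
   0, and by homogeneity [f] vanishes on all multiples of p_j. *)
move=> v; have [E|] := eqVneq (crossp v (pp j)) 0; last exact: gen.
have [c ->] := cross_eq0 (p0 j) E.
case: m bm gen => [|m] bm gen.
  have [q hq] := polyf_curve pf (polycurve_line (pp j) (c *: pp j)).
  by exists q => t; rewrite hq mul1r.
have fp : f (pp j) = 0.
  have [w [k hw]] := crossp_neq0_ex (p0 j).
  have [|q hq] := gen w; first by apply: contraNneq hw => ->; rewrite mxE.
  by have := hq 0; rewrite scale0r addr0 expr0n mul0r.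
have [q hq] := polyf_curve pf (polycurve_line (pp j) (c *: pp j)).
exists 0 => t; rewrite horner0 mulr0 hq.
suff -> : q = 0 by rewrite horner0.
apply: (@horner_inj_off K (1 + c *: 'X)).
  apply/eqP => /(congr1 (fun r : {poly R[i]} => r.[0])).
  by rewrite hornerD hornerZ hornerX hornerC mulr0 addr0 horner0 => /eqP; rewrite oner_eq0.
move=> u; rewrite hornerD hornerC hornerZ hornerX => nz; rewrite horner0 -hq.
have -> : pp j + u *: (c *: pp j) = (1 + c * u) *: pp j.
  by rewrite scalerDl scale1r scalerA mulrC.
by rewrite hhf // fp mulr0.
Qed.

End Class.
End BlowUpSections.

(** * From vanishing of H^1 to the expected dimension *)

Section Cohomology.
Variables (R : realType) (n : nat) (p : 'M[R[i]]_(n, 3)).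
Local Notation K := (R[i] : numClosedFieldType).
Local Notation pp i := (row i p).
Local Notation X := (blowup p).
Hypothesis p0 : forall i, pp i != 0.
Hypothesis pdist : forall i j, i != j -> crossp (pp j) (pp i) != 0.
Local Notation goodx := (good (fun i : 'I_n => pp i)).

Lemma cross_onto (l q : 'rV[R[i]]_3) : q != 0 -> dotp l q = 0 -> exists v, crossp v q = l.
Proof.
move=> /rV0Pn [k hk]; rewrite /dotp sum3 => h.
move: k hk; apply: I3_ind => hk; [exists (vec3 0 (- l 0 i2 / q 0 i0) (l 0 i1 / q 0 i0))|
  exists (vec3 (l 0 i2 / q 0 i1) 0 (- l 0 i0 / q 0 i1))|
  exists (vec3 (- l 0 i1 / q 0 i2) (l 0 i0 / q 0 i2) 0)];
  apply: row3P; rewrite !mxE /=; apply: (mulIf hk);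
  by [field; exact: hk | rewrite -[RHS]subr0 -[in RHS]h; field; exact: hk].
Qed.

(** Over p_j each l_i with i different from j must join p_i to p_j, so only l_j is free, and any
    line through p_j is v × p_j for some v. *)
Lemma exceptional_point P j : X P -> crossp (row ord0 P) (pp j) = 0 ->
  exists v c, [/\ crossp v (pp j) != 0, forall k, c k != 0 &
    forall k, row k P = c k *: row k (excurve p j v 0)].
Proof.
move=> /(blowupE _) [h1 h2 h3] E.
have [c0 xE] := cross_eq0 (p0 j) E.
have c00 : c0 != 0 by apply: contraNneq h1 => c0E; rewrite xE c0E scale0r.
have [v hv] := cross_onto (p0 j) (proj1 (h3 j)).
have /choice [c hc] : forall i, exists c, c != 0 /\ row (lift ord0 i) P =
    c *: (if i == j then crossp v (pp j) else crossp (pp j) (pp i)).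
  move=> i; have [->|ij] := eqVneq i j.
    by exists 1; rewrite oner_neq0 scale1r hv.
  have d1 : dotp (row (lift ord0 i) P) (pp j) = 0.
    have [_ d] := h3 i; rewrite xE dotpC dotpZl in d.
    by move/eqP: d; rewrite mulf_eq0 (negbTE c00) dotpC => /eqP.
  have [c hc] := orth_cross d1 (proj1 (h3 i)) (pdist ij).
  by exists c; split=> //; apply: contraNneq (h2 i) => cE; rewrite hc cE scale0r.
exists v, (fun k => if unlift ord0 k is Some i then c i else c0); split.
- by rewrite hv.
- by move=> k; case: (unlift ord0 k) => [i|//]; case: (hc i).
move=> k; case: (unliftP ord0 k) => [i ->|->].
  by rewrite mkptS scale0r addr0; case: (hc i).
by rewrite mkpt0 scale0r addr0.
Qed.

Section Class.
Variable D : divclass n.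
Local Notation b i := (tnth D.2 i).

(** At points over p_j the zero form leaves [section_near] with zero numerator, so the section
    cannot survive on the exceptional curves alone. *)
Lemma global_section_eq0 s : regular_section X (divdeg D) X s ->
  represents p D s (fun=> 0) -> forall P, X P -> s P = 0.
Proof.
move=> hs h P XP.
have [gx|] := pselect (goodx (row ord0 P)).
  have [c c0 ->] := gptP XP gx.
  have /(blowupE _) [x0 _ _] := XP.
  by rewrite h // mul0r.
move=> /existsNP [j /negP]; rewrite negbK => /eqP /(exceptional_point XP) [v [c [hv c0 hP]]].
have Xe := excurve0_in p0 pdist hv.
rewrite (section_scale hs Xe XP c0 hP).
have [F [G [F0 E1 E2]]] := section_near p0 pdist hs h hv Xe.
have G0 : G = 0.
  apply: horner_inj_nz => t t0; have := E2 t t0.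
  rewrite mulr0 horner0 => /esym /eqP; rewrite mulf_eq0 expfz_eq0 (negbTE t0) andbF.
  by move=> /eqP.
move: E1; rewrite G0 horner0 => /eqP; rewrite mulf_eq0 (negbTE F0) => /eqP ->.
by rewrite mulr0.
Qed.

Lemma global_section_form s P : regular_section X (divdeg D) X s -> X P -> s P != 0 ->
  exists f, [/\ isform D.1 f, represents p D s f, exists x, f x != 0 &
    forall j m, b j = Posz m -> mult_ge f (pp j) m].
Proof.
move=> hs XP sP; have [|f ff hf] := section_form p0 hs; first by move=> Q [].
exists f; split=> //.
  apply: contrapT => H; case/eqP: sP.
  apply: (global_section_eq0 hs) XP.
  move=> x c gx x0 c0; rewrite hf //; congr (_ * _).
  by apply/eqP/negPn/negP => fx; apply: H; exists x.
move=> j m bm; apply: (section_mult_ge p0 pdist hs ff hf bm) => v hv.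
exact: excurve0_in.
Qed.

Variables (a : nat) (m : 'I_n -> nat).
Hypothesis aE : D.1 = Posz a.
Hypothesis mE : forall j, b j = Posz (m j).

(** The ratio of the proportional vectors l_i and x × p_i, read in any coordinate where the latter
    is nonzero; the default 0 concerns only points over p_i. *)
Definition lam P i : R[i] :=
  if [pick k | crossp (row ord0 P) (pp i) 0 k != 0] is Some k
  then P (lift ord0 i) k / crossp (row ord0 P) (pp i) 0 k else 0.

Lemma lamE P i k : X P -> goodx (row ord0 P) -> crossp (row ord0 P) (pp i) 0 k != 0 ->
  lam P i = P (lift ord0 i) k / crossp (row ord0 P) (pp i) 0 k.
Proof.
move=> XP gx hk; have [c c0 PE] := gptP XP gx.
have E k' : P (lift ord0 i) k' = c i * crossp (row ord0 P) (pp i) 0 k'.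
  have /rowP /(_ k') := congr1 (row (lift ord0 i)) PE.
  by rewrite mkptS mxE [RHS]mxE.
rewrite /lam; case: pickP => [k' hk'|/(_ k)]; last by rewrite hk.
by rewrite !E !mulfK.
Qed.

Definition sec (g : 'rV[R[i]]_3 -> R[i]) P := g (row ord0 P) * \prod_(i < n) lam P i ^+ m i.

Lemma sec_represents g : represents p D (sec g) g.
Proof.
move=> x c gx x0 c0; rewrite /sec mkpt0; congr (_ * _); apply: eq_bigr => i _.
have /rV0Pn [k hk] := gx i.
rewrite (@lamE _ i k) ?mkpt0 //; last exact: blowup_gpt.
have /rowP /(_ k) := mkptS x (fun i => c i *: crossp x (pp i)) i.
by rewrite mxE => ->; rewrite mxE mulfK // mE.
Qed.

Lemma sec_regular g : isform (Posz a) g ->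
  regular_section X (divdeg D) (goodset p predT) (sec g).
Proof.
move=> fg; apply: (regular_of_local (@Xpt _ _ p) (goodset_open _ _)) => P [XP gP].
have /choice [kk hk] : forall i, exists k, crossp (row ord0 P) (pp i) 0 k != 0.
  by move=> i; apply/rV0Pn; apply: gP.
have hc i := mhf_cross p i (kk i).
have hl (i : 'I_n) := mhf_coord R (lift ord0 i) (kk i).
(* The exponent m_i + 1, balanced by an extra factor in [hG], makes a nonzero denominator imply that
   every chosen coordinate is nonzero, even when m_i = 0. *)
have hF := mhf_prod (index_enum 'I_n) xpredT (fun i => mhf_exp (m i).+1 (hc i)).
have hG := mhf_mul (mhf_form ord0 fg) (mhf_prod (index_enum 'I_n) xpredT
  (fun i => mhf_mul (mhf_exp (m i) (hl i)) (hc i))).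
eexists _, _, _, _; split; [exact: hG|exact: hF| | |].
- move=> k; case: (unliftP ord0 k) => [i ->|->].
    have Z : (lift ord0 i == ord0) = false by rewrite eq_sym (negbTE (neq_lift ord0 i)).
    rewrite divdegS mE Z mul0n add0n [X in _ - Posz X]big1 ?subr0; last first.
      by move=> j _; rewrite mul0n.
    rewrite (bigD1 i) //= eqxx mul1n addn0 big1 ?addn0 // => j ji.
    by rewrite (inj_eq (@lift_inj _ ord0)) eq_sym (negbTE ji).
  rewrite divdeg0 aE eqxx !mul1n.
  under eq_bigr => i _ do rewrite (negbTE (neq_lift ord0 i)) mul0n add0n.
  under [X in _ - Posz X]eq_bigr => i _ do rewrite mul1n -add1n.
  rewrite big_split /= !PoszD; set S := (\sum_i 1)%N.
  have -> : \sum_(i < n) b i = Posz (\sum_i m i)%N.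
    by rewrite (big_morph Posz PoszD (erefl _)); apply: eq_bigr => i _; rewrite mE.
  ring.
- by apply/prodf_neq0 => i _; rewrite expf_neq0.
move=> Q [XQ gQ] FQ; apply: (mulIf FQ); rewrite divfK // /sec -mulrA; congr (_ * _).
rewrite -big_split /=; apply: eq_bigr => i _.
have hQ : crossp (row ord0 Q) (pp i) 0 (kk i) != 0.
  by move/prodf_neq0: FQ => /(_ i isT); apply: contraNneq => ->; rewrite expr0n.
rewrite (lamE XQ _ hQ); last by move=> i'; apply: gQ.
rewrite exprS expr_div_n; field; exact: expf_neq0.
Qed.

(** Even 0 must be written as a quotient of the right multidegree; a - sum m_i may be negative,
    hence the denominator of degree sum m_i in x. *)
Lemma zero_regular U : zopen_in X U -> regular_section X (divdeg D) U (fun=> 0).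
Proof.
move=> oU; apply: (regular_of_local (@Xpt _ _ p) oU) => P UP.
have XP : X P by case: oU UP => Z _ -> [].
have /(blowupE _) [/rV0Pn [k hk] _ _] := XP.
pose N := (\sum_(i < n) m i)%N.
exists (fun=> 0), (fun Q => Q ord0 k ^+ N),
  (fun j => if unlift ord0 j is Some i then m i else a),
  (fun j => (nat_of_bool (j == ord0) * N)%N); split.
- exact: mhf0.
- exact: mhf_exp _ (mhf_coord _ _ _).
- move=> j; case: (unliftP ord0 j) => [i ->|->].
    by rewrite divdegS mE eq_sym (negbTE (neq_lift ord0 i)) mul0n subr0.
  rewrite divdeg0 aE eqxx mul1n /N (big_morph Posz PoszD (erefl _)).
  by congr (_ - _); apply: eq_bigr => i _; rewrite mE.
- by rewrite expf_neq0 //; move: hk; rewrite mxE.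
by move=> Q _ _; rewrite mul0r.
Qed.

(** Index 0 removes all exceptional curves, and index j + 1 all but the j-th. Any two distinct
    members meet in the same open set, so a cocycle is just a family of differences there. *)
Definition coverset (k : 'I_n.+1) : set 'M[R[i]]_(n.+1, 3) :=
  goodset p (fun i => unlift ord0 k != Some i).

Lemma goodset_cover k : goodset p predT `<=` coverset k.
Proof. by move=> P [XP h]; split=> // i _; apply: h. Qed.

Lemma coverset_inter k l : k != l -> coverset k `&` coverset l = goodset p predT.
Proof.
move=> kl; apply/seteqP; split=> [P [[XP h1] [_ h2]]|P hP]; last by split; apply: goodset_cover.
split=> // i _; have [E|] := eqVneq (unlift ord0 k) (Some i); last exact: h1.
apply: h2; apply: contra kl => /eqP E2; apply/eqP; move: E E2.
by case: unliftP => [i' -> [->]|//]; case: unliftP => [i'' -> [->]|].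
Qed.

Lemma coverset_cover : X `<=` \bigcup_k coverset k.
Proof.
move=> P XP; have [gx|] := pselect (goodx (row ord0 P)).
  by exists ord0 => //; split=> // i _; apply: gx.
move=> /existsNP [j /negP]; rewrite negbK => /eqP E.
have /(blowupE _) [h1 _ _] := XP; have [c xE] := cross_eq0 (p0 j) E.
exists (lift ord0 j) => //; split=> // i; rewrite liftK => ij.
have ij' : i != j by apply: contraNneq ij => ->.
rewrite xE crosspZl scaler_eq0 negb_or pdist // andbT.
by apply: contraNneq h1 => c0; rewrite xE c0 scale0r.
Qed.

(* The prescribed jets G_j define a cocycle on the cover; writing it as a coboundary
   produces a global form with these jets. *)
Lemma jets_of_H1 : ~ H1_nonzero X (divdeg D) ->
  forall G : 'I_n -> 'rV[R[i]]_3 -> R[i], (forall j, isform (Posz a) (G j)) ->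
  exists2 F, isform (Posz a) F & forall j, mult_ge (fun x => F x - G j x) (pp j) (m j).
Proof.
move=> H1 G fG.
pose Gk (k : 'I_n.+1) x := if unlift ord0 k is Some j then G j x else 0.
have fGk k : isform (Posz a) (Gk k).
  by rewrite /Gk; case: (unlift ord0 k) => [j|]; [exact: fG|exact: isform0].
pose c k l := sec (fun x => Gk l x - Gk k x).
have cocy : cech_cocycle X (divdeg D) coverset c.
  split=> [k l|k l o P _ _ _]; last by rewrite /c /sec -mulrDl; congr (_ * _); ring.
  have [->|kl] := eqVneq k l.
    rewrite setIid (_ : c l l = fun=> 0); first exact: zero_regular (goodset_open _ _).
    by apply/funext => P; rewrite /c /sec subrr mul0r.
  by rewrite coverset_inter //; apply: sec_regular; apply: isform_sub.
have /contrapT [t [ht hc]] : ~ ~ cech_coboundary X (divdeg D) coverset c.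
  move=> nc; apply: H1; exists n.+1, coverset, c; split=> //.
    by move=> k; apply: goodset_open.
  exact: coverset_cover.
have /choice [F hF] : forall k, exists F, isform D.1 F /\ represents p D (t k) F.
  by move=> k; have [F h1 h2] := section_form p0 (ht k) (@goodset_cover k); exists F.
rewrite aE in hF.
have E k l : (fun x => Gk l x - Gk k x) =1 (fun x => F l x - F k x).
  have [f1 r1] := hF k; have [f2 r2] := hF l.
  apply: (represents_uniq p0 (s := c k l) (D := D)).
  - by case: (isform_sub (fGk l) (fGk k)).
  - by case: (isform_sub f2 f1).
  - exact: sec_represents.
  move=> x e gx x0 e0; have U0 : goodset p predT (gpt p x e).
    by split; [apply: blowup_gpt|move=> i _; rewrite mkpt0].
  by rewrite hc ?r1 ?r2 -?mulrBl //; apply: goodset_cover.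
(* From G_j = F_(j+1) - F_0, the form -F_0 - G_j equals -F_(j+1), which has multiplicity m_j since
   [t (lift ord0 j)] is regular along the j-th exceptional curve. *)
exists (fun x => - 1 * F ord0 x); first by apply: isform_scale; case: (hF ord0).
move=> j; have [fj rj] := hF (lift ord0 j).
have fj' : isform D.1 (F (lift ord0 j)) by rewrite aE.
have mj : mult_ge (F (lift ord0 j)) (pp j) (m j).
  apply: (section_mult_ge p0 pdist (ht _) fj' rj (mE j)) => v hv.
  split; first exact: excurve0_in.
  move=> i; rewrite liftK mkpt0 scale0r addr0 => ij; apply: pdist.
  by apply: contraNneq ij => ->.
move=> v; have [q hq] := mj v; exists (- q) => u.
have := E ord0 (lift ord0 j) (pp j + u *: v); rewrite /Gk liftK unlift_none subr0 => ->.
by rewrite hornerN mulrN -hq; ring.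
Qed.

End Class.

Lemma frames_exist : exists g : 'I_n -> 'M[R[i]]_3,
  (forall j, g j \in unitmx) /\ forall j, e0 K *m g j = pp j.
Proof.
have /choice [g hg] : forall j, exists g : 'M[R[i]]_3, g \in unitmx /\ e0 K *m g = pp j.
  by move=> j; have [g h1 h2] := frame_ex (p0 j); exists g.
by exists g; split=> j; case: (hg j).
Qed.

Lemma effective_count (D : divclass n) (m : 'I_n -> nat) :
  (forall j, tnth D.2 j = Posz (m j)) -> effective p D -> ~ H1_nonzero X (divdeg D) ->
  exists2 a : nat, D.1 = Posz a & (\sum_(j < n) 'C((m j).+1, 2) < 'C(a.+2, 2))%N.
Proof.
move=> mE [s hs [P XP sP]] H1.
have [f [ff _ [x fx] fm]] := global_section_form hs XP sP.
have [a aE] : exists a : nat, D.1 = Posz a.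
  case E: D.1 => [a|a]; first by exists a.
  by case/eqP: fx; apply: isform_neg ff _; rewrite E.
exists a => //; have [g [gu gE]] := frames_exist.
apply: (jets_interpolation_count gu).
  move=> G fG; have [F fF hF] := jets_of_H1 aE mE H1 fG.
  by exists F => // j; rewrite gE.
exists f; first by rewrite -aE.
by split=> [|j]; [exists x|rewrite gE; apply: fm].
Qed.

End Cohomology.

(** * The plane form of a (-1)-curve *)

Section MinusOneCurves.
Variables (R : realType) (n : nat) (p : 'M[R[i]]_(n, 3)).
Local Notation K := (R[i] : numClosedFieldType).
Local Notation pp i := (row i p).
Local Notation X := (blowup p).
Hypothesis p0 : forall i, pp i != 0.
Hypothesis pdist : forall i j, i != j -> crossp (pp j) (pp i) != 0.
Local Notation goodx := (good (fun i : 'I_n => pp i)).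
Local Notation vanishes A E := (forall P, E P -> A (row ord0 P) = 0).

Definition pt x := gpt p x (fun=> 1).

Lemma pt_in x : goodx x -> x != 0 -> X (pt x).
Proof. by move=> gx x0; apply: blowup_gpt => // i; apply: oner_neq0. Qed.

Lemma good_point_off f : polyf f -> (exists x, f x != 0) ->
  exists o, [/\ goodx o, o != 0 & f o != 0].
Proof.
move=> pf [x fx]; apply: contrapT => H; case/eqP: fx; move: x.
apply: (@good_density K n (fun i => pp i) p0 f (fun=> 0) (fun=> 1)) => //; try exact: polyf_const.
  by exists 0; apply: oner_neq0.
move=> x gx x0 _; apply/eqP/negPn/negP => fx; apply: H; by exists x.
Qed.

Lemma pt_polyf F : polyf (fun x => mev F (pt x)).
Proof.
apply: mev_polyf => i j; case: (unliftP ord0 i) => [i' ->|->].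
  apply: polyf_ext (crossp_polyf (pp i') j) _ => x.
  by rewrite [RHS]mxE liftK scale1r.
by apply: polyf_ext (polyf_coord _ j) _ => x; rewrite [RHS]mxE unlift_none.
Qed.

Definition chart (r : 'I_3) : set 'M[R[i]]_(n.+1, 3) := [set P | X P /\ P ord0 r != 0].

Lemma chart_open r : zopen_in X (chart r).
Proof.
have -> : chart r = [set P | X P /\ exists2 f, [set fun P : 'M[R[i]]_(n.+1, 3) => P ord0 r] f & f P != 0].
  apply/seteqP; split=> P [XP]; first by move=> h; split=> //; exists (fun P => P ord0 r).
  by move=> [f -> h]; split.
apply: zopen_union; first exact: Xpt.
by move=> f ->; exists (fun k => nat_of_bool (k == ord0)); apply: mhf_coord.
Qed.

(** The ideal condition in [member] concerns regular functions, so a form must first be divided by a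
    power of a coordinate. *)
Lemma ratio_regular k A r : isform (Posz k) A ->
  regular_section X (fun=> 0) (chart r) (fun P => A (row ord0 P) / P ord0 r ^+ k).
Proof.
move=> fA; apply: (regular_of_local (@Xpt _ _ p) (chart_open r)) => P [XP hr].
exists (fun P => A (row ord0 P)), (fun P => P ord0 r ^+ k),
  (fun j => (j == ord0) * k)%N, (fun j => (j == ord0) * k)%N; split.
- exact: mhf_form.
- exact: mhf_exp (mhf_coord _ _ _).
- by move=> j; rewrite subrr.
- exact: expf_neq0.
by [].
Qed.

Lemma zclosed_form k A : isform (Posz k) A ->
  zclosed [set P : 'M[R[i]]_(n.+1, 3) | is_point P /\ A (row ord0 P) = 0].
Proof.
move=> /(mhf_form (ord0 : 'I_n.+1)) [F hF FE]; exists [set F]; split.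
  by move=> _ ->; exists (fun j => (j == ord0) * k)%N.
apply/seteqP; split=> P [Pp h]; split=> //; first by move=> _ ->; rewrite FE.
by rewrite -FE; apply: h.
Qed.

Section Curve.
Variables (e : divclass n) (E : set 'M[R[i]]_(n.+1, 3)).
Hypothesis hE : minus_one_curve p e E.

Lemma curve_in P : E P -> X P.
Proof. by case: hE => [[_ [h _]] _ _ _ _]; apply: h. Qed.

Lemma curve_effective : effective p e.
Proof.
case: hE => [[_ [_ h]] [s [hs sE _]] _ _ _].
exists s => //; apply: contrapT => H; apply: h => P XP.
rewrite sE; split=> //; apply/eqP/negPn/negP => sP; apply: H; by exists P.
Qed.

Lemma curve_irreducible k k' A B : isform (Posz k) A -> isform (Posz k') B ->
  (forall P, E P -> A (row ord0 P) * B (row ord0 P) = 0) -> vanishes A E \/ vanishes B E.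
Proof.
move=> fA fB h; case: hE => [[[_ _ irr] _] _ _ _ _].
have [] := irr _ _ (zclosed_form fA) (zclosed_form fB).
- move=> P EP; have Pp := Xpt (curve_in EP).
  by have /eqP := h P EP; rewrite mulf_eq0 => /orP[] /eqP h'; [left|right].
- by move=> H; left=> P /H [].
- by move=> H; right=> P /H [].
Qed.

Definition curve_form f :=
  [/\ isform e.1 f, exists x, f x != 0,
      forall j m, tnth e.2 j = Posz m -> mult_ge f (pp j) m,
      forall x, goodx x -> x != 0 -> (E (pt x) <-> f x = 0) &
      exists s, [/\ regular_section X (divdeg e) X s, represents p e s f &
        forall U g, zopen_in X U -> regular_section X (fun=> 0) U g ->
          (forall P, U P -> E P -> g P = 0) ->
          forall P, U P -> exists V t,
            [/\ zopen_in X V, V P, V `<=` U,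
                regular_section X (fun k => - divdeg e k) V t &
                forall Q, V Q -> g Q = t Q * s Q]]].

Lemma curve_form_ex : exists f, curve_form f.
Proof.
case: hE => [[_ [_ h]] [s [hs sE hdiv]] _ _ _].
have [P [XP sP]] : exists P, X P /\ s P != 0.
  apply: contrapT => H; apply: h => P XP.
  rewrite sE; split=> //; apply/eqP/negPn/negP => sP; apply: H; by exists P.
have [f [ff hf nf mf]] := global_section_form p0 pdist hs XP sP.
exists f; split=> //; last by exists s; split.
move=> x gx x0; rewrite sE /= /pt hf // => [|i]; last exact: oner_neq0.
rewrite big1 => [|i _]; last exact: exp1rz.
rewrite mulr1; split=> [[]//|fx]; split=> //; exact: pt_in.
Qed.

Variable f : 'rV[R[i]]_3 -> R[i].
Hypothesis hf : curve_form f.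

Lemma curve_degree : exists a : nat, e.1 = Posz a.
Proof.
case: hf => ff [x fx] _ _ _; case Ee: e.1 => [a|a]; first by exists a.
by case/eqP: fx; apply: isform_neg ff _; rewrite Ee.
Qed.

(** On each chart A / x_r^k lies in the ideal of [E], hence is locally a multiple of [s]. Restricted
    to lines missing the p_i, this is the local divisibility required by [form_division]. *)
Lemma curve_divides k A : isform (Posz k) A -> vanishes A E ->
  exists2 c, isform (Posz k - e.1) c & forall x, A x = f x * c x.
Proof.
move=> fA vA; have [d dE] := curve_degree.
case: hf => ff [o0 fo0] _ _ [s [hs sf hdiv]]; rewrite dE in ff.
have [o [go on0 o3]] := good_point_off (proj1 ff) (ex_intro _ o0 fo0).
have [D pD [nD hD]] := bad_lines go.
have [w [k1 hwk]] := crossp_neq0_ex on0.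
have pC := crossp_polyf o k1.
have nC : exists x, crossp x o 0 k1 != 0 by exists w.
have [y [y1 y2]] := polyf_common_neq0 pD pC nD nC.
have [||Q pQ hQ] := form_division ff fA on0 o3 (polyf_mul pD pC).
- by exists y; apply: mulf_neq0.
- move=> x; rewrite mulf_eq0 negb_or => /andP[Dx Cx] t.
  set z := x + t *: o.
  have z0 : z != 0.
    apply: contraNneq Cx => zE; have := congr1 (fun u => crossp u o) zE.
    by rewrite /= crosspDl crosspZl crosspp scaler0 addr0 => ->; rewrite crossp0l mxE.
  have gz : goodx z by apply: hD.
  have /rV0Pn [r hr] := z0.
  have cz : chart r (pt z) by split; [apply: pt_in|rewrite mxE unlift_none].
  have vr P : chart r P -> E P -> A (row ord0 P) / P ord0 r ^+ k = 0.
    by move=> _ EP; rewrite vA // mul0r.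
  have [V [u [oV VP VU hu Vu]]] := hdiv _ _ (chart_open r) (ratio_regular (r := r) fA) vr _ cz.
  have [G [F [dG [dF [_ _ _ FP loc]]]]] := section_local (@Xpt _ _ p) hu VP.
  exists (fun x => mev F (pt x)), (fun x : 'rV[R[i]]_3 => x 0 r ^+ k * mev G (pt x)).
  split=> //; [exact: pt_polyf| |].
    by apply: polyf_mul; [apply/polyf_exp/polyf_coord|apply: pt_polyf].
  apply: (@good_density K n (fun i => pp i) p0 _ _ (fun x : 'rV[R[i]]_3 => mev F (pt x) * x 0 r)).
  - by apply: polyf_mul; [apply: pt_polyf|case: fA].
  - apply: polyf_mul; last by case: ff.
    by apply: polyf_mul; [apply/polyf_exp/polyf_coord|apply: pt_polyf].
  - by apply: polyf_mul; [apply: pt_polyf|apply: polyf_coord].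
  - by exists z; apply: mulf_neq0.
  move=> q gq q0; rewrite mulf_eq0 negb_or => /andP[Fq qr].
  have [E1 E2] := loc _ (pt_in gq q0).
  have := Vu _ (E2 Fq); rewrite {1}/pt mkpt0 [pt q ord0 r]mxE unlift_none.
  have -> : s (pt q) = f q.
    rewrite /pt sf // => [|i]; last exact: oner_neq0.
    by rewrite big1 ?mulr1 // => i _; rewrite exp1rz.
  move=> E3; have qk : q 0 r ^+ k != 0 by rewrite expf_neq0.
  have -> : A q = q 0 r ^+ k * (u (pt q) * f q) by rewrite -E3 mulrC divfK.
  by rewrite -E1; ring.
exists Q; last by move=> x; rewrite hQ mulrC.
split=> // t x t0; move: x.
apply: (polyf_dense (proj1 ff)).
- apply: (polyf_comp (h := fun x => t *: x) pQ) => i.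
  by apply: polyf_ext (polyf_scale t (polyf_coord _ i)) _ => x; rewrite mxE.
- exact: polyf_scale.
- by exists o.
move=> x fx; have := hQ (t *: x); rewrite (proj2 fA) // (proj2 ff) // hQ dE expfzDr //.
move=> H; apply: (mulIf fx); have td : t ^ d != 0 by rewrite expfz_neq0.
apply: (mulIf td); rewrite -mulrA [f x * _]mulrC -H.
have tt : t ^ (- Posz d) * t ^ d = 1 by rewrite -expfzDr // addNr.
move: (t ^ - Posz d) (t ^ d) (t ^ k) (Q x) (f x) tt => b1 b2 b3 b4 b5 tt.
have -> : b3 * b1 * b4 * b5 * b2 = (b1 * b2) * (b3 * (b4 * b5)) by ring.
by rewrite tt mul1r.
Qed.

Lemma curve_form_zero a : e.1 = Posz a.+1 -> exists x, [/\ goodx x, x != 0 & f x = 0].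
Proof.
move=> aE; case: hf => ff [o0 fo0] _ _ _; rewrite aE in ff.
have [o [go on0 o2]] := good_point_off (proj1 ff) (ex_intro _ o0 fo0).
have [D pD [nD hD]] := bad_lines go.
have [w [k1 hwk]] := crossp_neq0_ex on0.
have nC : exists x, crossp x o 0 k1 != 0 by exists w.
have [x [x1 x2]] := polyf_common_neq0 pD (crossp_polyf o k1) nD nC.
have [q hq] := polyf_curve (proj1 ff) (polycurve_line x o).
have [r hr] := polyf_curve (proj1 ff) (polycurve_line o x).
have /closed_rootP [t rt] : size q != 1%N.
  apply/eqP => /eqP /size_poly1P [c c0 qc].
  (* A constant value c on x + t o would give f(o + t x) = c t^(a+1), and t = 0 contradicts f(o)
     being nonzero. *)
  have rE : r = c *: 'X ^+ a.+1.
    apply: horner_inj_nz => t t0; rewrite hornerZ hornerXn -hr.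
    have -> : o + t *: x = t *: (x + t^-1 *: o) by rewrite scalerDr scalerA divff // scale1r addrC.
    by rewrite (proj2 ff) // hq qc hornerC mulrC.
  by case/eqP: o2; rewrite -[o]addr0 -(scale0r x) hr rE hornerZ hornerXn expr0n mulr0.
exists (x + t *: o); split.
- exact: hD.
- apply: contraNneq x2 => zE; have := congr1 (fun u => crossp u o) zE.
  by rewrite /= crosspDl crosspZl crosspp scaler0 addr0 => ->; rewrite crossp0l mxE.
- by rewrite hq; apply/rootP.
Qed.

(** [E] lies in the union of the zero set of [f] and the exceptional curves. It has a point off the
    latter by [curve_form_zero], so irreducibility leaves only the former. *)
Lemma curve_form_vanishes a : e.1 = Posz a.+1 -> vanishes f E.
Proof.
move=> aE; have [x [gx x0 fx]] := curve_form_zero aE.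
case: hf => ff _ _ Ef _; rewrite aE in ff.
have [Z cZ UZ] := goodset_open p predT.
case: hE => [[[_ _ irr] _] _ _ _ _].
have [P EP||] := irr _ _ (zclosed_form ff) cZ.
- have XP := curve_in EP.
  have [gP|] := pselect (goodset p predT P); last first.
    by rewrite UZ => h; right; apply: contrapT => nZ; apply: h.
  left; split; first exact: (Xpt XP).
  have gx' : goodx (row ord0 P) by move=> i; apply: (proj2 gP).
  have /(blowupE _) [P0 _ _] := XP.
  case: hE => [_ [s [hs sE _]] _ _ _].
  apply/(Ef _ gx' P0); rewrite sE; split; first exact: pt_in.
  have [c c0 PE] := gptP XP gx'.
  move: EP; rewrite sE => -[_ sP].
  have c1 (k : 'I_n.+1) : (if unlift ord0 k is Some i then (c i)^-1 else 1) != 0.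
    by case: (unlift ord0 k) => [i|]; rewrite ?oner_neq0 // invr_eq0.
  have XQ := pt_in gx' P0.
  rewrite (section_scale hs XP XQ c1) ?sP ?mulr0 // => k.
  rewrite [in RHS]PE; case: (unliftP ord0 k) => [i ->|->].
    by rewrite !mkptS scalerA mulVf.
  by rewrite !mkpt0 scale1r.
- by move=> h P /h [].
move=> h; have /h : E (pt x) by apply/Ef.
have : goodset p predT (pt x).
  by split; [apply: pt_in|move=> i _; rewrite mkpt0].
by rewrite UZ => -[_ /[apply]].
Qed.

(** A negative multiplicity -(m+1) would make [s] equal t^(m+1) f along a curve crossing the
    exceptional curve. But [f] is itself locally a multiple of [s], so the multiplier would need a
    pole at t = 0. The direction [v] is chosen so that [f] is not identically zero on this curve. *)
Lemma curve_mult_ge0 a j : e.1 = Posz a.+1 -> 0 <= tnth e.2 j.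
Proof.
move=> aE; have vf := curve_form_vanishes aE.
case: hf => ff [y fy] _ _ [s [hs sf hdiv]].
rewrite leNgt; apply/negP => mneg.
have [m mE] : exists m, tnth e.2 j = - (Posz m.+1).
  by case E1: (tnth e.2 j) mneg => [//|m] _; exists m; rewrite NegzE.
have ff' : isform (Posz a.+1) f by rewrite -aE.
have pshift : polyf (fun v => f (pp j + v)).
  apply: (polyf_comp (proj1 ff)) => k.
  apply: polyf_ext (polyf_add (polyf_const _ (pp j 0 k)) (polyf_coord _ k)) _ => v.
  by rewrite [RHS]mxE.
have [w [k1 hw]] := crossp_neq0_ex (p0 j).
have nC : exists v, crossp v (pp j) 0 k1 != 0 by exists w.
have nS : exists v, f (pp j + v) != 0 by exists (y - pp j); rewrite addrC subrK.
have [v [v1 v2]] := polyf_common_neq0 (crossp_polyf (pp j) k1) pshift nC nS.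
have hv : crossp v (pp j) != 0 by apply: contraNneq v1 => ->; rewrite mxE.
have /rV0Pn [r hr] := p0 j.
have cz : chart r (excurve p j v 0).
  by split; [apply: excurve0_in|rewrite mxE unlift_none scale0r addr0].
have vr P : chart r P -> E P -> f (row ord0 P) / P ord0 r ^+ a.+1 = 0.
  by move=> _ EP; rewrite vf // mul0r.
have [V [u [oV VP VU hu Vu]]] := hdiv _ _ (chart_open r) (ratio_regular (r := r) ff') vr _ cz.
have [G [F [dG [dF [_ _ _ FP loc]]]]] := section_local (@Xpt _ _ p) hu VP.
have [qF hqF] := mev_curve F (excurve_poly p j v).
have [qG hqG] := mev_curve G (excurve_poly p j v).
have [qr hqr] := excurve_poly p j v ord0 r.
have [qf hqf] := polyf_curve (proj1 ff) (polycurve_line (pp j) v).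
have [wt wt0 hwt] := excurve_good p0 pdist hv.
have nz : wt * qF * qr * qf != 0.
  rewrite !mulf_neq0 //.
  - by apply: contraNneq wt0 => ->; rewrite horner0.
  - by apply: contraNneq FP => qF0; rewrite hqF qF0 horner0.
  - apply: contraNneq hr => qr0; have := hqr 0; rewrite qr0 horner0.
    by rewrite mxE unlift_none scale0r addr0 => ->.
  by apply: contraNneq v2 => qf0; rewrite -[v]scale1r hqf qf0 horner0.
have EF : qF = qG * qr ^+ a.+1 * 'X ^+ m.+1.
  apply: (horner_inj_off (h := 'X * (wt * qF * qr * qf))).
    by rewrite mulf_neq0 // polyX_eq0.
  move=> t; rewrite !hornerM hornerX !mulf_eq0 !negb_or => /andP[t0 /andP[/andP[/andP[w1 w2] w3] w4]].
  have [gx x0] := hwt t t0 w1.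
  have c0 i : (if i == j then t^-1 else 1 : R[i]) != 0.
    by case: (i == j); rewrite ?invr_eq0 ?t0 ?oner_neq0.
  have XQ := blowup_gpt gx x0 c0; rewrite -excurve_gpt // in XQ.
  have [E1 E2] := loc _ XQ.
  have := Vu _ (E2 _); rewrite hqF => /(_ w2).
  have -> : s (excurve p j v t) = qf.[t] * t ^+ m.+1.
    rewrite excurve_gpt // sf // (bigD1 j) //= eqxx big1 => [|i /negbTE ->]; last exact: exp1rz.
    by rewrite mulr1 mE exprz_inv opprK hqf.
  rewrite hqr {1}/excurve mkpt0 hqf => E3.
  rewrite hqF hqG in E1.
  rewrite horner_exp hornerXn -E1; apply: (mulIf w4).
  have wr : qr.[t] ^+ a.+1 != 0 by rewrite expf_neq0.
  transitivity (qF.[t] * (u (excurve p j v t) * (qf.[t] * t ^+ m.+1) * qr.[t] ^+ a.+1)).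
    by rewrite -E3 divfK.
  by move: (u _) (t ^+ m.+1) (qr.[t] ^+ a.+1) => z1 z2 z3; ring.
have : qF.[0] = 0 by rewrite EF hornerM hornerXn expr0n mulr0.
by rewrite -hqF => F0; rewrite F0 eqxx in FP.
Qed.

Lemma curve_degree0_mult j : e.1 = 0 -> tnth e.2 j <= 0.
Proof.
move=> e1; case: hf => ff [y fy] mf _ _; rewrite e1 in ff.
case E1: (tnth e.2 j) => [[|m]|m] //.
have mj := mf j _ E1; have := mult_ge_degree (p0 j) ff _ mj.
by move=> /(_ (ex_intro _ y fy)).
Qed.

End Curve.
End MinusOneCurves.

(** * Intersection numbers of (-1)-curves *)

Section CurvePairs.
Variables (R : realType) (n : nat) (p : 'M[R[i]]_(n, 3)).
Local Notation K := (R[i] : numClosedFieldType).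
Local Notation pp i := (row i p).
Local Notation X := (blowup p).
Hypothesis p0 : forall i, pp i != 0.
Hypothesis pdist : forall i j, i != j -> crossp (pp j) (pp i) != 0.
Local Notation vanishes A E := (forall P, E P -> A (row ord0 P) = 0).

(** Write f = f' c. Since [E] is irreducible, f' or c vanishes on it. In the first case f divides f'
    and the degrees agree; in the second f divides c, whose degree is too small. *)
Lemma vanishing_degree e e' E E' f f' d d' :
  minus_one_curve p e E -> minus_one_curve p e' E' ->
  curve_form p e E f -> curve_form p e' E' f' ->
  e.1 = Posz d.+1 -> e'.1 = Posz d'.+1 -> vanishes f E' -> d = d'.
Proof.
move=> hE hE' hf hf' dE dE' vf.
have [ff [y fy] _ _ _] := hf; have [ff' [y' fy'] _ _ _] := hf'.
rewrite dE in ff; rewrite dE' in ff'.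
have deg_ge0 (z : int) c c' h : isform z c -> (forall x, h x = c' x * c x) ->
    (exists x : 'rV[R[i]]_3, h x != 0) -> exists k : nat, z = Posz k.
  move=> fc hE1 [x hx]; case: z fc => k fc; first by exists k.
  by case/eqP: hx; rewrite hE1 (isform_neg _ fc) ?mulr0.
have [c fc fE] := curve_divides p0 hf' ff vf.
have [k kE] := deg_ge0 _ _ _ _ fc fE (ex_intro _ y fy).
rewrite kE in fc.
have [|vf'|vc] := curve_irreducible hE ff' fc.
- by move=> P EP; rewrite -fE (curve_form_vanishes p0 hE hf dE).
- have [c' fc' fE'] := curve_divides p0 hf ff' vf'.
  have [k' kE'] := deg_ge0 _ _ _ _ fc' fE' (ex_intro _ y' fy').
  by move: kE kE'; rewrite dE dE'; lia.
have [c' fc' cE] := curve_divides p0 hf fc vc.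
have nc : exists x, c x != 0.
  by exists y; apply: contraNneq fy => cy; rewrite fE cy mulr0.
have [k' kE'] := deg_ge0 _ _ _ _ fc' cE nc.
by move: kE kE'; rewrite dE dE'; lia.
Qed.

(** For equal degrees d the squares give 2 sum m_j m'_j <= 2(d^2 + 1), which suffices. For different
    degrees neither form vanishes on the other curve, and Bezout even gives a nonnegative
    product. *)
Lemma minus_one_pair e e' E E' d d' :
  minus_one_curve p e E -> minus_one_curve p e' E' ->
  e.1 = Posz d.+1 -> e'.1 = Posz d'.+1 -> - 1 <= dotdiv e e'.
Proof.
move=> hE hE' dE dE'.
have [f hf] := curve_form_ex p0 pdist hE; have [f' hf'] := curve_form_ex p0 pdist hE'.
have m0 j := curve_mult_ge0 p0 pdist hE hf j dE.
have m0' j := curve_mult_ge0 p0 pdist hE' hf' j dE'.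
have same : d = d' -> -1 <= dotdiv e e'.
  move=> dd; have [_ _ _ _ s1] := hE; have [_ _ _ _ s2] := hE'.
  have cs : (\sum_(i < n) tnth e.2 i * tnth e'.2 i) * 2 <=
      \sum_(i < n) tnth e.2 i * tnth e.2 i + \sum_(i < n) tnth e'.2 i * tnth e'.2 i.
    by rewrite -big_split big_distrl /=; apply: ler_sum => i _;
      have := sqr_ge0 (tnth e.2 i - tnth e'.2 i); rewrite expr2; lia.
  move: s1 s2 cs; rewrite /dotdiv dE dE' dd.
  move: (\sum_(i < n) _) (\sum_(i < n) tnth e.2 i * tnth e.2 i)
    (\sum_(i < n) tnth e'.2 i * tnth e'.2 i) => t1 t2 t3; lia.
have [vf|nvf] := pselect (vanishes f E').
  by apply: same; apply: (vanishing_degree hE hE' hf hf' dE dE' vf).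
have [vf'|nvf'] := pselect (vanishes f' E).
  by apply: same; rewrite (vanishing_degree hE' hE hf' hf dE' dE vf').
have [ff nf mf _ _] := hf; have [ff' nf' mf' _ _] := hf'.
have [g [gu gE]] := frames_exist p0.
rewrite dE in ff; rewrite dE' in ff'.
have mE j : tnth e.2 j = Posz `|tnth e.2 j|%N by rewrite gez0_abs.
have mE' j : tnth e'.2 j = Posz `|tnth e'.2 j|%N by rewrite gez0_abs.
have := @bezout_multiplicities K n g gu d.+1 d'.+1 f f' (fun j => `|tnth e.2 j|%N)
   (fun j => `|tnth e'.2 j|%N) _ ff ff' nf nf'.
have sep (i j : 'I_n) : i != j -> exists2 h, isform 1 h &
     h (e0 K *m g i) = 0 /\ h (e0 K *m g j) != 0.
  move=> ij; rewrite !gE; have /rV0Pn [k hk] := pdist ij.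
  exists (fun x => crossp x (pp i) 0 k); last by rewrite crosspp mxE.
  split; first exact: crossp_polyf.
  by move=> t x _; rewrite crosspZl mxE expr1z.
move=> /(_ sep) bez.
suff : (\sum_j `|tnth e.2 j| * `|tnth e'.2 j| <= d.+1 * d'.+1)%N.
  rewrite /dotdiv dE dE' -lez_nat (big_morph Posz PoszD (erefl _)) => h.
  have -> : \sum_(i < n) tnth e.2 i * tnth e'.2 i =
      \sum_j Posz (`|tnth e.2 j| * `|tnth e'.2 j|)%N.
    by apply: eq_bigr => j _; rewrite PoszM -mE -mE'.
  by move: h; rewrite PoszM; move: (\sum_j Posz _) => S h; rewrite -subr_ge0 in h; lia.
apply: bez => [j|j|k A B fA fB AB].
- by rewrite gE; apply: mf; apply: mE.
- by rewrite gE; apply: mf'; apply: mE'.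
(* The divisibility hypothesis of Bezout: f A = f' B vanishes on the irreducible E' and f does not,
   so A does, and f' divides A. *)
have vA : vanishes A E'.
  have [||//] := curve_irreducible hE' ff fA.
    by move=> P EP; rewrite AB (curve_form_vanishes p0 hE' hf' dE') ?mul0r.
  by move=> vf; case: nvf.
have [h fh Ah] := curve_divides p0 hf' fA vA.
by exists h => //; move: fh; rewrite dE' PoszD addrK.
Qed.

Hypothesis shgh : forall D : divclass n, effective p D ->
      (H1_nonzero (blowup p) (divdeg D) <->
       exists E e, minus_one_curve p e E /\ dotdiv D e <= -2).

(** The first alternative accounts for exceptional curves; the last inequality of the second is -K.e
    >= 0. *)
Definition nef_like (e : divclass n) :=
  (e.1 = 0 /\ forall j, tnth e.2 j <= 0) \/
  [/\ 0 <= e.1, forall j, 0 <= tnth e.2 j <= e.1 & \sum_(j < n) tnth e.2 j <= 3 * e.1].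

(** With E^2 = -1, that is sum m_j^2 = d^2 + 1, the strict count of conditions becomes sum m_j <= 3d
    - 1. *)
Lemma curve_numerics e E : minus_one_curve p e E -> nef_like e.
Proof.
move=> hE; have [f hf] := curve_form_ex p0 pdist hE.
have [a aE] := curve_degree hf.
case: a aE => [|a] aE.
  by left; split=> // j; apply: (curve_degree0_mult p0 hf).
right; have m0 j := curve_mult_ge0 p0 pdist hE hf j aE.
have mE j : tnth e.2 j = Posz `|tnth e.2 j|%N by rewrite gez0_abs.
split=> [|j|]; first by rewrite aE.
  rewrite m0 /=; have [ff nf mf _ _] := hf; rewrite aE in ff *.
  by rewrite mE lez_nat; apply: (mult_ge_degree (p0 j) ff nf); apply: mf; apply: mE.
have eff := curve_effective hE.
have nH : ~ H1_nonzero X (divdeg e).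
  move=> /(shgh eff) [E' [e' [hE' h]]].
  have [f' hf'] := curve_form_ex p0 pdist hE'.
  have [a' aE'] := curve_degree hf'.
  suff : -1 <= dotdiv e e' by lia.
  case: a' aE' => [|a'] aE'; last exact: minus_one_pair hE hE' aE aE'.
  rewrite /dotdiv aE' mulr0 sub0r lerN2.
  apply: (@le_trans _ _ 0) => //; apply: sumr_le0 => j _.
  by rewrite mulr_ge0_le0 //; apply: (curve_degree0_mult p0 hf').
have [a' aE'] := effective_count p0 pdist mE eff nH.
move: (aE'); rewrite aE => -[<-] cnt.
have [_ _ _ _ sq] := hE.
have dbl : (\sum_(j < n) 'C((`|tnth e.2 j|%N).+1, 2))%N%:Z * 2 =
    \sum_(i < n) tnth e.2 i * tnth e.2 i + \sum_(i < n) tnth e.2 i.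
  rewrite (big_morph Posz PoszD (erefl _)) big_distrl -big_split /=; apply: eq_bigr => j _.
  have tE := mE j; move: (`|tnth e.2 j|%N) tE => k ->; have := bin2_double k; lia.
move: sq dbl cnt; rewrite /dotdiv aE; have := bin2_double a.+2.
move: (\sum_(j < n) 'C(_, _))%N 'C(_, _) => B C.
move: (\sum_(i < n) tnth e.2 i * tnth e.2 i) (\sum_(i < n) tnth e.2 i) => S2 S1; lia.
Qed.

End CurvePairs.

(** * Arithmetic of reduced classes *)

Section Numerics.

Lemma nth_noninc (s : seq int) i j : sorted >=%R s -> all (fun b => 1 <= b) s ->
  (i <= j)%N -> 0 <= nth 0 s j <= nth 0 s i.
Proof.
move=> ss s1 ij.
have ge0 k : 0 <= nth 0 s k.
  have [h|h] := ltnP k (size s); last by rewrite nth_default.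
  by have /allP /(_ _ (mem_nth 0 h)) := s1; apply: le_trans.
rewrite ge0 /=; have [h|h] := ltnP j (size s); last by rewrite (nth_default _ h).
apply: (sorted_leq_nth (leT := >=%R) _ _ 0 ss) => //.
- by move=> x y z /= xy yz; apply: le_trans xy.
- by move=> x /=.
- by rewrite inE (leq_ltn_trans ij).
Qed.

(** The case k >= n, where no index matches, occurs when there are fewer than two points. *)
Lemma sum_single n (k : nat) (u : 'I_n -> int) M : 0 <= M -> (forall j, u j <= M) ->
  \sum_(j < n) (j == k :> nat)%:R * u j <= M.
Proof.
move=> M0 uM; have [kn|nk] := ltnP k n.
  rewrite (bigD1 (Ordinal kn)) //= eqxx mul1r big1 ?addr0 // => j.
  by rewrite -val_eqE /= => /negbTE ->; rewrite mul0r.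
rewrite big1 // => j _; have := ltn_ord j; case: eqP => [-> |]; last by rewrite mul0r.
by rewrite ltnNge nk.
Qed.

(** Each b_j is at most b_3, plus b_1 - b_3 or b_2 - b_3 at the first two places. Weighting by 0 <=
    m_j <= d with sum m_j <= 3d gives sum b_j m_j <= (b_1 + b_2 + b_3) d <= a d. *)
Lemma cremona_nef n (D e : divclass n) : sorted >=%R D.2 -> all (fun b => 1 <= b) D.2 ->
  cremona_minimal D -> nef_like e -> 0 <= dotdiv D e.
Proof.
move=> ss s1 cr; pose B k := nth 0 D.2 k.
have nn i j := @nth_noninc D.2 i j ss s1.
have tB j : tnth D.2 j = B j by rewrite (tnth_nth 0).
case=> [[e0 em]|[d0 em sm]]; rewrite /dotdiv.
  rewrite e0 mulr0 sub0r oppr_ge0; apply: sumr_le0 => j _.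
  by rewrite tB mulr_ge0_le0 //; have /andP[] := nn 0%N j isT.
rewrite subr_ge0.
have B10 := nn 0%N 1%N isT; have B21 := nn 1%N 2%N isT.
rewrite -/(B 0%N) -/(B 1%N) -/(B 2%N) in B10 B21.
have le j : tnth D.2 j * tnth e.2 j <= B 2%N * tnth e.2 j +
   ((j == 0 :> nat)%:R * ((B 0%N - B 2%N) * tnth e.2 j) +
    (j == 1 :> nat)%:R * ((B 1%N - B 2%N) * tnth e.2 j)).
  have /andP[h1 h2] := em j; rewrite tB.
  have bj : B j <= B 2%N + ((j == 0 :> nat)%:R * (B 0%N - B 2%N) +
      (j == 1 :> nat)%:R * (B 1%N - B 2%N)).
    case: (nat_of_ord j) => [|[|k]] /=; rewrite ?mulr1n ?mulr0n ?mul1r ?mul0r; [lia|lia|].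
    by rewrite !addr0; have /andP[] := nn 2%N k.+2 isT.
  apply: (le_trans (ler_wpM2r h1 bj)); rewrite le_eqVlt; apply/orP; left; apply/eqP; ring.
apply: (le_trans (ler_sum _ (fun j _ => le j))).
rewrite !big_split /= -big_distrr /=.
have M1 : 0 <= (B 0%N - B 2%N) * e.1 by apply: mulr_ge0 => //; lia.
have M2 : 0 <= (B 1%N - B 2%N) * e.1 by apply: mulr_ge0 => //; lia.
have s_1 : \sum_(j < n) (j == 0 :> nat)%:R * ((B 0%N - B 2%N) * tnth e.2 j) <=
    (B 0%N - B 2%N) * e.1.
  by apply: sum_single => // j; apply: ler_wpM2l; [lia|case/andP: (em j)].
have s_2 : \sum_(j < n) (j == 1 :> nat)%:R * ((B 1%N - B 2%N) * tnth e.2 j) <=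
    (B 1%N - B 2%N) * e.1.
  by apply: sum_single => // j; apply: ler_wpM2l; [lia|case/andP: (em j)].
have s_3 : B 2%N * (\sum_(j < n) tnth e.2 j) <= B 2%N * (3 * e.1).
  by apply: ler_wpM2l => //; lia.
have cr' : (B 0%N + B 1%N + B 2%N) * e.1 <= D.1 * e.1 by apply: ler_wpM2r.
apply: (le_trans (lerD s_3 (lerD s_1 s_2))); apply: le_trans cr'.
by rewrite le_eqVlt; apply/orP; left; apply/eqP; ring.
Qed.

Lemma half_exact (y : int) : ((y * (y - 1)) %/ 2)%Z * 2 = y * (y - 1).
Proof.
have := divz_eq y 2; have := @modz_ge0 y 2 isT; have := @ltz_mod y 2 isT.
set q := (y %/ 2)%Z; set r := (y %% 2)%Z; rewrite /= => r2 r0 ->.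
have [->|->] : r = 0 \/ r = 1 by lia.
  have -> : (q * 2 + 0) * (q * 2 + 0 - 1) = (q * (q * 2 - 1)) * 2 by ring.
  by rewrite mulzK.
have -> : (q * 2 + 1) * (q * 2 + 1 - 1) = ((q * 2 + 1) * q) * 2 by ring.
by rewrite mulzK.
Qed.

Lemma arith_genusE n (D : divclass n) :
  arith_genus D * 2 = D.1 * D.1 - 3 * D.1 + 2 - \sum_(b <- D.2) (b * b - b).
Proof.
rewrite /arith_genus mulrBl.
have -> : (D.1 - 1) * (D.1 - 2) = (D.1 - 1) * ((D.1 - 1) - 1) by ring.
rewrite half_exact big_distrl /= big_tuple.
have -> : \sum_(i < n) (tnth D.2 i * (tnth D.2 i - 1) %/ 2)%Z * 2 =
    \sum_(i < n) (tnth D.2 i * tnth D.2 i - tnth D.2 i).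
  by apply: eq_bigr => i _; rewrite half_exact; ring.
by ring.
Qed.

(* A nonnegative self-intersection and -K.A >= a / 3 for a reduced class A on
   the blow-up at 8 points. *)
Lemma reduced8 (a x1 x2 x3 x4 x5 x6 x7 x8 : int) :
  x1 >= x2 -> x2 >= x3 -> x3 >= x4 -> x4 >= x5 -> x5 >= x6 -> x6 >= x7 -> x7 >= x8 ->
  x8 >= 0 -> x1 + x2 + x3 <= a ->
  x1 * x1 + x2 * x2 + x3 * x3 + x4 * x4 + x5 * x5 + x6 * x6 + x7 * x7 + x8 * x8 <= a * a
  /\ a <= 3 * (3 * a - (x1 + x2 + x3 + x4 + x5 + x6 + x7 + x8)).
Proof.
move=> h1 h2 h3 h4 h5 h6 h7 h8 ha; split; last by lia.
have sq (x y : int) : 0 <= y -> y <= x -> y * y <= x * x by move=> ? ?; nia.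
have s4 : x4 * x4 <= x3 * x3 by apply: sq; lia.
have s5 : x5 * x5 <= x3 * x3 by apply: sq; lia.
have s6 : x6 * x6 <= x3 * x3 by apply: sq; lia.
have s7 : x7 * x7 <= x3 * x3 by apply: sq; lia.
have s8 : x8 * x8 <= x3 * x3 by apply: sq; lia.
have sa : (x1 + x2 + x3) * (x1 + x2 + x3) <= a * a by apply: sq; lia.
(* Expanding (x1 + x2 + x3)^2, the cross terms contribute at least 6 x3^2, enough for the five
   remaining squares. *)
have c12 : x3 * x3 <= x1 * x2 by apply: ler_pM; lia.
have c13 : x3 * x3 <= x1 * x3 by apply: ler_pM; lia.
have c23 : x3 * x3 <= x2 * x3 by apply: ler_pM; lia.
lia.
Qed.

(** For A = D + K = (a - 3; b_i - 1) the genus relation reads A^2 - K.A = 2G, and [reduced8] gives a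
    - 3 <= 6G. With three or more points A is automatically reduced; fewer points need the separate
    cases. *)
Lemma small_bound (G a : int) (s : seq int) : 1 <= G -> (size s <= 8)%N ->
  sorted >=%R s -> all (fun b => 1 <= b) s ->
  nth 0 s 0 + nth 0 s 1 + nth 0 s 2 <= a ->
  a * a - 3 * a - \sum_(b <- s) (b * b - b) = 2 * G -> a <= 6 * G + 4.
Proof.
move=> G1; rewrite -[sorted _ s]/(sorted (fun x y : int => y <= x) s).
case: s => [|b1 [|b2 [|b3 s]]] /=; rewrite ?big_cons ?big_nil.
- by move=> _ _ _ a0; nia.
- move=> _ _ /andP[b10 _] ha E.
  have [h|h] := leP (b1 + 2) a; last first.
    have [E1|E1] : a = b1 \/ a = b1 + 1 by lia.
      by rewrite E1 in E; lia.
    by rewrite E1 in E; lia.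
  have : (b1 - 1) * (b1 - 1) <= (a - 3) * (a - 3) by apply: ler_pM; lia.
  by lia.
- move=> _ /andP[h12 _] /and3P[b10 b20 _] ha E.
  have [h|h] := leP (b1 + b2 + 1) a.
    have [r1 r2] := @reduced8 (a - 3) (b1 - 1) (b2 - 1) 0 0 0 0 0 0 ltac:(lia) ltac:(lia)
       ltac:(lia) ltac:(lia) ltac:(lia) ltac:(lia) ltac:(lia) ltac:(lia) ltac:(lia).
    by lia.
  (* Here A is not reduced, but the genus relation factors and bounds both multiplicities
     directly. *)
  have E1 : a = b1 + b2 by lia.
  have E2 : (b1 - 1) * (b2 - 1) = G + 1 by rewrite E1 in E; lia.
  have p2 : 1 <= b2 - 1.
    have [//|h2] := leP 1 (b2 - 1).
    have b21 : b2 - 1 = 0 by lia.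
    by move: E2; rewrite b21 mulr0; lia.
  have : b1 - 1 <= G + 1 by rewrite -E2; apply: ler_peMr => //; lia.
  have : b2 - 1 <= G + 1 by rewrite -E2; apply: ler_peMl => //; lia.
  by lia.
case: s => [|b4 [|b5 [|b6 [|b7 [|b8 [|b9 s]]]]]] //= _.
- move=> /and3P[h1 h2 _] /and4P[k1 k2 k3 _] ha E; rewrite ?big_nil in E.
  have [r1 r2] := @reduced8 (a - 3) (b1 - 1) (b2 - 1) (b3 - 1) 0 0 0 0 0 ltac:(lia) ltac:(lia)
       ltac:(lia) ltac:(lia) ltac:(lia) ltac:(lia) ltac:(lia) ltac:(lia) ltac:(lia).
  by lia.
- move=> /and4P[h1 h2 h3 _] /and5P[k1 k2 k3 k4 _] ha E; rewrite ?big_cons ?big_nil in E.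
  have [r1 r2] := @reduced8 (a - 3) (b1 - 1) (b2 - 1) (b3 - 1) (b4 - 1) 0 0 0 0 ltac:(lia) ltac:(lia)
       ltac:(lia) ltac:(lia) ltac:(lia) ltac:(lia) ltac:(lia) ltac:(lia) ltac:(lia).
  by lia.
- move=> /and5P[h1 h2 h3 h4 _] /and5P[k1 k2 k3 k4 /andP[k5 _]] ha E; rewrite ?big_cons ?big_nil in E.
  have [r1 r2] := @reduced8 (a - 3) (b1 - 1) (b2 - 1) (b3 - 1) (b4 - 1) (b5 - 1) 0 0 0
       ltac:(lia) ltac:(lia)
       ltac:(lia) ltac:(lia) ltac:(lia) ltac:(lia) ltac:(lia) ltac:(lia) ltac:(lia).
  by lia.
- move=> /and5P[h1 h2 h3 h4 /andP[h5 _]] /and5P[k1 k2 k3 k4 /and3P[k5 k6 _]] ha E; rewrite ?big_cons ?big_nil in E.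
  have [r1 r2] := @reduced8 (a - 3) (b1 - 1) (b2 - 1) (b3 - 1) (b4 - 1) (b5 - 1) (b6 - 1) 0 0
       ltac:(lia) ltac:(lia)
       ltac:(lia) ltac:(lia) ltac:(lia) ltac:(lia) ltac:(lia) ltac:(lia) ltac:(lia).
  by lia.
- move=> /and5P[h1 h2 h3 h4 /and3P[h5 h6 _]] /and5P[k1 k2 k3 k4 /and4P[k5 k6 k7 _]] ha E; rewrite ?big_cons ?big_nil in E.
  have [r1 r2] := @reduced8 (a - 3) (b1 - 1) (b2 - 1) (b3 - 1) (b4 - 1) (b5 - 1) (b6 - 1) (b7 - 1) 0
       ltac:(lia) ltac:(lia)
       ltac:(lia) ltac:(lia) ltac:(lia) ltac:(lia) ltac:(lia) ltac:(lia) ltac:(lia).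
  by lia.
- move=> /and5P[h1 h2 h3 h4 /and4P[h5 h6 h7 _]] /and5P[k1 k2 k3 k4 /and5P[k5 k6 k7 k8 _]] ha E; rewrite ?big_cons ?big_nil in E.
  have [r1 r2] := @reduced8 (a - 3) (b1 - 1) (b2 - 1) (b3 - 1) (b4 - 1) (b5 - 1) (b6 - 1) (b7 - 1) (b8 - 1)
       ltac:(lia) ltac:(lia)
       ltac:(lia) ltac:(lia) ltac:(lia) ltac:(lia) ltac:(lia) ltac:(lia) ltac:(lia).
  by lia.
Qed.

(** The sum of squares is bounded in two ways: by m times the sum while [m] is still unbounded, and
    by the square of the sum afterwards, in order to bound [m]. *)
Lemma tail_sums (m : int) (r : seq int) : all (fun b => 1 <= b) r -> all (fun b => b <= m) r ->
  [/\ (size r)%:Z <= \sum_(b <- r) b, \sum_(b <- r) b * b <= m * \sum_(b <- r) b,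
      \sum_(b <- r) b * b <= (\sum_(b <- r) b) * (\sum_(b <- r) b) &
      \sum_(b <- r) b <= \sum_(b <- r) b * b].
Proof.
elim: r => [|b r IH] /=; first by rewrite !big_nil mulr0.
move=> /andP[b1 r1] /andP[bm rm]; have [h1 h2 h3 h4] := IH r1 rm.
rewrite !big_cons; move: (\sum_(j <- r) j) (\sum_(j <- r) j * j) h1 h2 h3 h4 => T Q h1 h2 h3 h4.
have b2 : b <= b * b by apply: ler_peMr => //; lia.
have bb : b * b <= m * b by apply: ler_wpM2r => //; lia.
have bT : 0 <= b * T by apply: mulr_ge0; lia.
split; lia.
Qed.

Lemma big_bound (G a : int) (s : seq int) : 1 <= G -> (9 <= size s)%N ->
  sorted >=%R s -> all (fun b => 1 <= b) s ->
  nth 0 s 0 + nth 0 s 1 + nth 0 s 2 <= a ->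
  a * a - 3 * a - \sum_(b <- s) (b * b - b) = 2 * G ->
  \sum_(b <- s) (b * b + b) <= a * a + 3 * a ->
  a <= 27 * (G * G) + 12 * G + 3 /\ (size s)%:Z <= 9 + 3 * G.
Proof.
move=> G1; rewrite -[sorted _ s]/(sorted (fun x y : int => y <= x) s).
case: s => [|b1 [|b2 [|b3 [|b4 [|b5 [|b6 [|b7 [|b8 [|m r]]]]]]]]] //= _.
move=> /and5P[h1 h2 h3 h4 /and5P[h5 h6 h7 h8 hr]].
move=> /and5P[k1 k2 k3 k4 /and5P[k5 k6 k7 k8 /andP[km kr]]] ha.
rewrite !big_cons.
have rm : all (fun b => b <= m) r.
  by apply: order_path_min hr => x y z /= xy yz; apply: le_trans xy.
have [t1 t2 t3 t4] := tail_sums kr rm.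
have -> : \sum_(b <- r) (b * b - b) = \sum_(b <- r) b * b - \sum_(b <- r) b by rewrite -sumrB.
have -> : \sum_(b <- r) (b * b + b) = \sum_(b <- r) b * b + \sum_(b <- r) b by rewrite -big_split.
move: (\sum_(j <- r) j) (\sum_(j <- r) j * j) t1 t2 t3 t4 => T Q t1 t2 t3 t4 gen vd.
have [r1 r2] := @reduced8 (a - 3 * m) (b1 - m) (b2 - m) (b3 - m) (b4 - m) (b5 - m) (b6 - m)
   (b7 - m) (b8 - m) ltac:(lia) ltac:(lia) ltac:(lia) ltac:(lia) ltac:(lia) ltac:(lia)
   ltac:(lia) ltac:(lia) ltac:(lia).
(* [c] is -K.D over the first nine points, and equals -K.A since K^2 = 0 there. [T] and [Q] are the
   sum and the sum of squares over the remaining points. *)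
pose c := 3 * a - (b1 + b2 + b3 + b4 + b5 + b6 + b7 + b8 + m).
have cE : c = 3 * (a - 3 * m) - (b1 - m + (b2 - m) + (b3 - m) + (b4 - m) + (b5 - m) + (b6 - m)
   + (b7 - m) + (b8 - m)) by rewrite /c; ring.
rewrite -cE in r2.
pose A2 := (a - 3 * m) * (a - 3 * m) - ((b1 - m) * (b1 - m) + (b2 - m) * (b2 - m) +
   (b3 - m) * (b3 - m) + (b4 - m) * (b4 - m) + (b5 - m) * (b5 - m) + (b6 - m) * (b6 - m) +
   (b7 - m) * (b7 - m) + (b8 - m) * (b8 - m)).
have A20 : 0 <= A2 by rewrite /A2 subr_ge0.
have A2s : A2 <= (a - 3 * m) * (a - 3 * m).
  have sq (x : int) : 0 <= x * x by rewrite -expr2 sqr_ge0.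
  by rewrite /A2 gerBl; do !apply: addr_ge0 => //; apply: sq.
have key : A2 + 2 * (c * m) - Q - c + T = 2 * G by rewrite -gen /A2 /c; ring.
(* Subtracting the genus relation from the dimension inequality gives K.D <= G. *)
have Tc : T <= c + G by rewrite /c; lia.
have am : 0 <= a - 3 * m by lia.
clear gen vd h1 h2 h3 h4 h5 h6 h7 h8 k1 k2 k3 k4 k5 k6 k7 k8 cE ha r1.
clearbody c A2.
have c0 : 0 <= c by lia.
have T0 : 0 <= T by lia.
(* Inserting Q <= m T and T <= c + G into [key] gives m c <= (m + 1) G, and m >= 1. *)
have c2G : c <= 2 * G.
  have : (m - 1) * T <= (m - 1) * (c + G) by apply: ler_wpM2l => //; lia.
  move=> h; have h' : m * c <= m * (2 * G) by nia.
  by move: h'; rewrite ler_pM2l //; lia.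
have T3G : T <= 3 * G by lia.
(* If c = 0 then a = 3m and A^2 <= 0, so [key] would give 2G <= T - Q <= 0. *)
have c1 : 1 <= c.
  have [//|c00] := leP 1 c.
  have a0 : a - 3 * m = 0 by lia.
  have cc : c = 0 by lia.
  by move: A2s key; rewrite a0 cc !mul0r; lia.
have TT : T * T <= 9 * (G * G).
  have -> : 9 * (G * G) = (3 * G) * (3 * G) by ring.
  by apply: ler_pM.
(* Now Q <= T^2 <= 9 G^2 turns [key] into 2 c m <= 2G + 9 G^2 + c; dividing by c >= 1 bounds m, and
   a <= 3m + 3c bounds a. *)
have mb : 2 * m <= 2 * G + 9 * (G * G) + 1.
  have h : c * (2 * m) <= c * (2 * G + 9 * (G * G) + 1).
    have : 2 * G + 9 * (G * G) <= c * (2 * G + 9 * (G * G)) by rewrite ler_peMl //; nia.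
    by lia.
  by move: h; rewrite ler_pM2l //; lia.
split; last by lia.
have GG : 0 <= G * G by nia.
lia.
Qed.

End Numerics.

(** * Existence of very general points *)

Section VeryGeneralPoints.
Variable R : realType.
Local Notation K := (R[i] : numClosedFieldType).

(** Cantor's nested intervals: keeps a closed quarter of the interval that does not contain [x]. *)
Definition avoid_step (I : R * R) (x : R) : R * R :=
  let m := (I.1 + I.2) / 2 in
  if x <= m then ((m + I.2) / 2, I.2) else (I.1, (I.1 + m) / 2).

Lemma avoid_stepP (I : R * R) (x : R) : I.1 < I.2 ->
  [/\ I.1 <= (avoid_step I x).1, (avoid_step I x).2 <= I.2,
      (avoid_step I x).1 < (avoid_step I x).2 &
      x < (avoid_step I x).1 \/ (avoid_step I x).2 < x].
Proof.
case: I => a b /= ab; rewrite /avoid_step /=.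
by have [h|h] := leP x ((a + b) / 2); split=> /=; first [lra|left; lra|right; lra].
Qed.

Fixpoint avoid_itv (u : nat -> R) k : R * R :=
  if k is k'.+1 then avoid_step (avoid_itv u k') (u k') else (0, 1).

Lemma real_avoid (u : nat -> R) : exists r, forall k, r != u k.
Proof.
pose I := avoid_itv u.
have lt k : (I k).1 < (I k).2.
  by elim: k => [|k IH] /=; [exact: ltr01|case: (avoid_stepP (u k) IH)].
have step k : [/\ (I k).1 <= (I k.+1).1, (I k.+1).2 <= (I k).2 &
    u k < (I k.+1).1 \/ (I k.+1).2 < u k].
  by case: (avoid_stepP (u k) (lt k)).
have mono1 k l : (I k).1 <= (I (l + k)%N).1.
  by elim: l => // l IH; apply: (le_trans IH); case: (step (l + k)%N).
have mono2 k l : (I (l + k)%N).2 <= (I k).2.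
  by elim: l => // l IH; apply: (le_trans _ IH); case: (step (l + k)%N).
have ab k l : (I k).1 <= (I l).2.
  have h := mono2 l k; rewrite addnC in h.
  exact: le_trans (mono1 k l) (le_trans (ltW (lt _)) h).
pose E : set R := [set x | exists k, x = (I k).1].
have hE : has_sup E.
  split; first by exists (I 0%N).1, 0%N.
  by exists (I 0%N).2 => x [k ->].
exists (sup E) => k; have [_ _ h] := step k.
have s1 : (I k.+1).1 <= sup E by apply: sup_upper_bound => //; exists k.+1.
have s2 : sup E <= (I k.+1).2.
  by apply: ge_sup; [case: hE|move=> x [l ->]].
by apply/negP => /eqP E1; case: h; rewrite -E1; lra.
Qed.

(** A real t suffices: it has to avoid the real parts of all roots, a countable set. *)
Lemma poly_avoid (q : nat -> {poly R[i]}) : (forall k, q k != 0) ->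
  exists t, forall k, (q k).[t] != 0.
Proof.
move=> q0; pose rs k := sval (closed_field_poly_normal (q k)).
have rsE k z : (q k).[z] = 0 -> z \in rs k.
  rewrite /rs; case: closed_field_poly_normal => r /= qE.
  rewrite {1}qE hornerZ => /eqP; rewrite mulf_eq0 lead_coef_eq0 (negbTE (q0 k)) /=.
  by rewrite -[_ == 0]/(root _ z) root_prod_XsubC.
pose u m := if unpickle m is Some ki then complex.Re (nth 0 (rs ki.1) ki.2) else 0 : R.
have [r hr] := real_avoid u.
exists (real_complex R r) => k; apply/negP => /eqP /rsE h.
have := hr (pickle (k, index (real_complex R r) (rs k))).
by rewrite /u pickleK /= nth_index //= eqxx.
Qed.

(** Induction on the number of variables: the first coordinate is fixed at a value that keeps all
    the restricted functions nonzero. *)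
Lemma polyf_avoid N (f : nat -> 'rV[R[i]]_N -> R[i]) :
  (forall k, polyf (f k)) -> (forall k, exists x, f k x != 0) ->
  exists x, forall k, f k x != 0.
Proof.
elim: N f => [|N IH] f pf nf.
  exists 0 => k; have [x hx] := nf k.
  by rewrite (_ : 0 = x) //; apply/rowP => -[].
have /choice [x hx] := nf.
pose c (y : 'rV[R[i]]_N.+1) (t : R[i]) : 'rV[R[i]]_N.+1 :=
  \row_j (if j == ord0 then t else y 0 j).
have pc y : polycurve (K := K) (c y).
  move=> j; have [E|jn] := eqVneq j ord0.
    by exists 'X => t; rewrite hornerX mxE E eqxx.
  by exists (y 0 j)%:P => t; rewrite hornerC mxE (negbTE jn).
have /choice [q hq] : forall k, exists q : {poly R[i]}, forall t, f k (c (x k) t) = q.[t].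
  by move=> k; apply: polyf_curve.
have [t ht] : exists t, forall k, (q k).[t] != 0.
  apply: poly_avoid => k; apply: contraNneq (hx k) => q0.
  have -> : x k = c (x k) (x k 0 ord0).
    by apply/rowP => j; rewrite mxE; case: eqP => // ->.
  by rewrite hq q0 horner0.
pose h (y : 'rV[R[i]]_N) : 'rV[R[i]]_N.+1 :=
  \row_j (if unlift ord0 j is Some i then y 0 i else t).
have [||y hy] := IH (fun k y => f k (h y)).
- move=> k; apply: (polyf_comp (pf k)) => j; case: (unliftP ord0 j) => [i ->|->].
    by apply: polyf_ext (polyf_coord _ i) _ => y; rewrite mxE liftK.
  by apply: polyf_ext (polyf_const _ t) _ => y; rewrite mxE unlift_none.
- move=> k; exists (\row_i (x k) 0 (lift ord0 i)).
  suff -> : h (\row_i (x k) 0 (lift ord0 i)) = c (x k) t by rewrite hq.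
  apply/rowP => j; rewrite !mxE; case: (unliftP ord0 j) => [i ->|->].
    by rewrite mxE eq_sym (negbTE (neq_lift ord0 i)).
  by rewrite eqxx.
by exists (h y).
Qed.

Lemma polyf_avoid_count (I : countType) N (f : I -> 'rV[R[i]]_N -> R[i]) :
  (forall k, polyf (f k)) -> (forall k, exists x, f k x != 0) ->
  exists x, forall k, f k x != 0.
Proof.
move=> pf nf.
have [||x hx] := @polyf_avoid N (fun m => if unpickle m is Some k then f k else fun=> 1).
- by move=> m; case: (unpickle m) => [k|]; [apply: pf|apply: polyf_const].
- move=> m; case: (unpickle m) => [k|]; first exact: nf.
  by exists 0; apply: oner_neq0.
by exists x => k; have := hx (pickle k); rewrite pickleK.
Qed.

Lemma proper_closed_poly m (Z : set 'M[R[i]]_(m, 3)) : zclosed Z ->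
  (exists2 P, is_point P & ~ Z P) -> exists F : {mpoly R[i][m * 3]},
    (exists P, mev F P != 0) /\ forall P, mev F P != 0 -> ~ Z P.
Proof.
move=> [A [_ ->]] [P Pp nZ].
have [F [AF FP]] : exists F, A F /\ mev F P != 0.
  apply: contrapT => H; apply: nZ; split=> // F AF.
  by apply/eqP/negPn/negP => FP; apply: H; exists F.
exists F; split; first by exists P.
by move=> Q FQ [_ /(_ F AF) E]; rewrite E eqxx in FQ.
Qed.

Lemma very_general_point n (Q Q' : 'M[R[i]]_(n, 3) -> Prop) :
  very_general Q -> very_general Q' -> exists P, [/\ Q P, Q' P,
    forall i, row i P != 0 & forall i j, i != j -> crossp (row j P) (row i P) != 0].
Proof.
move=> [Z hZ ZQ] [Z' hZ' ZQ'].
have /choice [F hF] : forall k, exists F : {mpoly R[i][n * 3]},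
    (exists P, mev F P != 0) /\ forall P, mev F P != 0 -> ~ Z k P.
  by move=> k; have [h1 h2] := hZ k; apply: proper_closed_poly.
have /choice [F' hF'] : forall k, exists F : {mpoly R[i][n * 3]},
    (exists P, mev F P != 0) /\ forall P, mev F P != 0 -> ~ Z' k P.
  by move=> k; have [h1 h2] := hZ' k; apply: proper_closed_poly.
(* One coordinate is enough to ensure a nonzero row (i = j) or two distinct points (i different from
   j), and it is a polynomial condition. *)
pose D (ij : 'I_n * 'I_n) (P : 'M[R[i]]_(n, 3)) : R[i] :=
  if ij.1 == ij.2 then P ij.1 i0
  else P ij.2 i1 * P ij.1 i2 - P ij.2 i2 * P ij.1 i1.
pose f (k : nat + nat + ('I_n * 'I_n)) (x : 'rV[R[i]]_(n * 3)) : R[i] :=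
  match k with
  | inl (inl k) => mev (F k) (vec_mx x)
  | inl (inr k) => mev (F' k) (vec_mx x)
  | inr ij => D ij (vec_mx x)
  end.
have pv i j : polyf (fun x : 'rV[R[i]]_(n * 3) => vec_mx x i j).
  by apply: polyf_ext (polyf_coord _ (mxvec_index i j)) _ => x; rewrite mxE.
have [||x hx] := @polyf_avoid_count _ _ f.
- case=> [[k|k]|ij]; [exact: mev_polyf|exact: mev_polyf|].
  rewrite /f /D; case: (ij.1 == ij.2); first exact: pv.
  exact: (polyf_sub (polyf_mul (pv _ _) (pv _ _)) (polyf_mul (pv _ _) (pv _ _))).
- case=> [[k|k]|ij] /=.
  + by have [[P hP] _] := hF k; exists (mxvec P); rewrite mxvecK.
  + by have [[P hP] _] := hF' k; exists (mxvec P); rewrite mxvecK.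
  exists (mxvec (\matrix_(i, j) if ij.1 == ij.2 then 1 else
    if i == ij.2 then (j == i1)%:R else (j == i2)%:R)); rewrite mxvecK /D.
  case E: (ij.1 == ij.2); rewrite !mxE ?E ?oner_neq0 //.
  by rewrite !eqxx /= mulr1 mul0r subr0 oner_neq0.
have p0 i : row i (vec_mx x) != 0.
  have h : vec_mx x i i0 != 0 by have := hx (inr (i, i)); rewrite /f /D eqxx.
  have rE : row i (vec_mx x) 0 i0 = vec_mx x i i0 by rewrite [LHS]mxE.
  by apply: contraNneq h => E; rewrite -rE E mxE.
have Pp : is_point (vec_mx x) by [].
exists (vec_mx x); split=> //.
- by apply: ZQ => // k; apply: (proj2 (hF k)); apply: (hx (inl (inl k))).
- by apply: ZQ' => // k; apply: (proj2 (hF' k)); apply: (hx (inl (inr k))).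
move=> i j ij; have h : vec_mx x j i1 * vec_mx x i i2 - vec_mx x j i2 * vec_mx x i i1 != 0.
  by have := hx (inr (i, j)); rewrite /f /D (negbTE ij).
have rE k l : vec_mx x k l = row k (vec_mx x) 0 l by rewrite [RHS]mxE.
apply: contraNneq h; rewrite !rE => /rowP /(_ i0); rewrite [RHS]mxE => <-.
by rewrite vec3E.
Qed.

End VeryGeneralPoints.

(** * Finiteness of bounded classes and the final bounds *)

Lemma finite_bounded_classes (N M : nat) : finite_set [set c : {n : nat & divclass n} |
  [/\ (projT1 c <= N)%N, 0 <= (projT2 c).1 <= Posz M &
      all (fun b => 0 <= b <= Posz M) (projT2 c).2]].
Proof.
pose T := {k : 'I_N.+1 & ('I_M.+1 * k.-tuple 'I_M.+1)%type}.
pose phi (x : T) : {n : nat & divclass n} :=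
  existT divclass (tag x : nat) (Posz (tagged x).1, map_tuple (fun i : 'I_M.+1 => Posz i) (tagged x).2).
apply: (@sub_finite_set _ _ (phi @` [set: T])); last first.
  by apply: finite_image; apply: finite_finset.
move=> [n [a b]] /= [nN /andP[a0 aM] /allP bM].
have iM (z : int) : 0 <= z <= Posz M -> Posz (inord `|z|%N : 'I_M.+1) = z.
  by move=> /andP[z0 zM]; rewrite inordK ?gez0_abs //; lia.
exists (existT (fun k : 'I_N.+1 => ('I_M.+1 * k.-tuple 'I_M.+1)%type)
  (Ordinal (nN : (n < N.+1)%N))
  (inord `|a|%N, map_tuple (fun z : int => inord `|z|%N) b)) => //.
rewrite /phi /= iM ?a0 //; congr existT; congr (_, _); apply: eq_from_tnth => i.
by rewrite !tnth_map iM //; apply: bM; apply: mem_tnth.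
Qed.

Theorem theorem1 (R : realType) (hSHGH : SHGH R) (g : int) (hg : 2 <= g) :
  finite_set [set c : {n : nat & divclass n} |
    let D := projT2 c in
    [/\ sorted >=%R D.2, all (fun b => 1 <= b) D.2,
        effective_general R D, cremona_minimal D & arith_genus D = g]].
Proof.
(* A common bound for n and a, dominating the cases of at most eight and of at least nine points
   with G = g - 1. *)
pose M := `|(27 * (g * g) + 30 * g + 20)%R|%N.
apply: sub_finite_set (finite_bounded_classes M M).
move=> [n D] /= [srt pos effD cr genus].
(* SHGH and effectivity exclude different countable unions; one configuration outside both, with
   distinct points, suffices because the conclusion is purely numerical. *)
have [p [shgh eff p0 pdist]] := very_general_point (hSHGH n) effD.
have nH : ~ H1_nonzero (blowup p) (divdeg D).
  move=> /(shgh D eff) [E [e [hE he]]].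
  have := cremona_nef srt pos cr (curve_numerics p0 pdist shgh hE).
  by move=> h; have := le_trans h he.
have pos' j : 0 <= tnth D.2 j.
  by have /allP /(_ _ (mem_tnth j D.2)) := pos; apply: le_trans.
have mE j : tnth D.2 j = Posz `|tnth D.2 j|%N by rewrite gez0_abs.
have [a aE cnt] := effective_count p0 pdist mE eff nH.
have vdim : \sum_(b <- D.2) (b * b + b) <= Posz a * Posz a + 3 * Posz a.
  have -> : \sum_(b <- D.2) (b * b + b) =
      Posz (\sum_(j < n) 'C((`|tnth D.2 j|%N).+1, 2))%N * 2.
    rewrite big_tuple (big_morph Posz PoszD (erefl _)) big_distrl /=; apply: eq_bigr => j _.
    have tE := mE j; move: (`|tnth D.2 j|%N) tE => k ->; have := bin2_double k; lia.
  move: cnt; have := bin2_double a.+1; move: (\sum_(j < n) _)%N 'C(_, _) => B C; lia.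
have gen : Posz a * Posz a - 3 * Posz a - \sum_(b <- D.2) (b * b - b) = 2 * (g - 1).
  have := arith_genusE D; rewrite genus aE; move: (\sum_(b <- D.2) _) => S; lia.
have G1 : 1 <= g - 1 by lia.
have cr' : nth 0 D.2 0 + nth 0 D.2 1 + nth 0 D.2 2 <= Posz a by rewrite -aE.
have sz : size D.2 = n by rewrite size_tuple.
have gg : 0 <= g * g by rewrite -expr2 sqr_ge0.
have [nM aM] : n%:Z <= M%:Z /\ Posz a <= M%:Z.
  have ME : M%:Z = 27 * (g * g) + 30 * g + 20 by rewrite /M gez0_abs //; lia.
  rewrite ME; have [h|h] := leqP (size D.2) 8.
    by have := small_bound G1 h srt pos cr' gen; rewrite sz in h; lia.
  have [h1 h2] := big_bound G1 h srt pos cr' gen vdim.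
  by rewrite sz in h2; split; lia.
split.
- by rewrite -lez_nat.
- by rewrite aE.
apply/allP => b /(nthP 0) [j _ <-].
have nn := @nth_noninc D.2.
have /andP[j0 j1] := nn 0%N j srt pos isT.
have /andP[h1 _] := nn 0%N 1%N srt pos isT; have /andP[h2 _] := nn 0%N 2%N srt pos isT.
rewrite j0 /=; apply: (le_trans j1); apply: le_trans aM; apply: le_trans cr'.
by rewrite -addrA lerDl addr_ge0.
Qed.
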